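(* Suppose that $f:\mathbb{R}\to\mathbb{R}$ is $1$-periodic and real analytic. For every integer $q>0$ there exist $\alpha>0$ and $\epsilon_q>0$ such that if $p>\alpha$ ($p$ a positive integer coprime with $q$) and $\|\ddot f\|<\epsilon_q$, then the set of $(p,q)$-periodic complete bouncing motions (those with $(t_{n+q},e_{n+q})=(t_n+p,e_n)$ for all $n\in\mathbb{Z}$) is either finite or degenerate. In the first case at least one $(p,q)$-periodic complete bouncing motion is unstable. In the degenerate case, all $(p,q)$-periodic complete bouncing motions are unstable.
   Context: Let $g>0$ be a fixed constant (gravity) and let $f:\mathbb{R}\to\mathbb{R}$ be $1$-periodic and real analytic (vertical position of the racket). $\|\cdot\|$ is the sup norm, $\dot f,\ddot f$ the first and second derivatives, and $f[t,\bar t]=\frac{f(\bar t)-f(t)}{\bar t-t}$ for $\bar t\neq t$. Bouncing map in time-velocity coordinates: for $(t,v)$ with $v>0$, $(\bar t,\bar v)=\tilde\Psi(t,v)$ is given by $$\bar t=t+\tfrac2g v-\tfrac2g f[t,\bar t]+\tfrac2g\dot f(t),\qquad \bar v=v-2f[t,\bar t]+\dot f(\bar t)+\dot f(t),$$ where $\bar t$ is the smallest solution $\bar t>t$ of the first equation. With $\mathbb{T}=\mathbb{R}/\mathbb{Z}$, $\tilde\Psi$ induces a map $\Psi$ on $\mathbb{T}\times(0,\infty)$. There exists $v_*>4\|\dot f\|$ such that $\Psi$ is a real analytic embedding of $\mathbb{T}\times(v_*,\infty)$ into $\mathbb{T}\times\mathbb{R}$; such a $v_*$ is fixed and $e_*=\frac12v_*^2$.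 Time-energy coordinates: with $e=\frac12v^2$, the map becomes $\tilde\Phi:\mathbb{R}\times(e_*,\infty)\to\mathbb{R}^2$, $\tilde\Phi(t,e)=(\bar t,\bar e)$, $$\bar t=t+\tfrac2g\sqrt{2e}-\tfrac2g f[t,\bar t]+\tfrac2g\dot f(t),\qquad \bar e=\tfrac12\big(\sqrt{2e}-2f[t,\bar t]+\dot f(\bar t)+\dot f(t)\big)^2 .$$ It commutes with $\sigma(t,e)=(t+1,e)$. A complete bouncing motion is a complete orbit $(t_n,e_n)_{n\in\mathbb{Z}}$ of $\tilde\Phi$, i.e. $e_n>e_*$ and $(t_{n+1},e_{n+1})=\tilde\Phi(t_n,e_n)$ for all $n\in\mathbb{Z}$. For coprime positive integers $p,q$ it is called here $(p,q)$-periodic if $(t_{n+q},e_{n+q})=(t_n+p,e_n)$ for all $n\in\mathbb{Z}$. Motions differing by an integer translation of time, $(t_n,e_n)\mapsto(t_n+m,e_n)$ with $m\in\mathbb{Z}$, are identified when speaking of finiteness of the set of $(p,q)$-periodic motions. The set of $(p,q)$-periodic complete bouncing motions is (analytically) degenerate if there is a real analytic curve $s\mapsto(t(s),e(s))$, $s\in\mathbb{R}$, such that $(t(s+1),e(s+1))=(t(s)+1,e(s))$ for all $s$, the function $t(s)$ (taken mod $1$) is bijective for $s\in[0,1)$, and $(t_n,e_n)_{n\in\mathbb{Z}}$ is a $(p,q)$-periodic complete bouncing motion if and only if there exist $n_0,s_0$ with $(t_{n_0},e_{n_0})=(t(s_0),e(s_0))$ (here $(t_n,e_n)_{n\in\mathbb{Z}}$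 denotes an orbit of $\tilde\Phi$). A complete bouncing motion $(t_n,e_n)_{n\in\mathbb{Z}}$ is stable if for every $\varepsilon>0$ there is $\delta>0$ such that for every $(\hat t_0,\hat e_0)$ with $|(t_0,e_0)-(\hat t_0,\hat e_0)|<\delta$ all iterates $\tilde\Phi^n(\hat t_0,\hat e_0)$, $n\in\mathbb{Z}$, are defined and $|\tilde\Phi^n(\hat t_0,\hat e_0)-(t_n,e_n)|<\varepsilon$ for every $n\in\mathbb{Z}$; otherwise it is unstable. *)

(* Defs.v *)
From Stdlib Require Import Reals ZArith Znumtheory List.
From Coquelicot Require Import Coquelicot.
Open Scope R_scope.

(** * Functions *)

Definition periodic1 (f : R -> R) : Prop := forall t, f (t + 1) = f t.

Definition real_analytic (f : R -> R) : Prop :=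
  forall x0, exists (a : nat -> R) (r : R), 0 < r /\
    forall x, Rabs (x - x0) < r -> is_pseries a (x - x0) (f x).

(* Near (x0, y0), [F] is the sum of an absolutely convergent double power
   series; absolute convergence makes the choice of square partial sums
   immaterial. *)
Definition real_analytic2_at (F : R -> R -> R) (x0 y0 : R) : Prop :=
  exists (a : nat -> nat -> R) (r : R), 0 < r /\
    forall x y, Rabs (x - x0) < r -> Rabs (y - y0) < r ->
      let term i j := a i j * (x - x0) ^ i * (y - y0) ^ j in
      (exists M, forall N,
         sum_n (fun i => sum_n (fun j => Rabs (term i j)) N) N <= M) /\
      is_lim_seq (fun N => sum_n (fun i => sum_n (fun j => term i j) N) N) (F x y).

(* Valued in [Rbar]: equal to [p_infty] for unbounded functions. *)
Definition sup_norm (h : R -> R) : Rbar :=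
  Lub_Rbar (fun y => exists x, y = Rabs (h x)).

(** * The bouncing map *)

Definition divdiff (f : R -> R) (t tb : R) : R := (f tb - f t) / (tb - t).

Definition impact_eq (g : R) (f : R -> R) (t v tb : R) : Prop :=
  tb = t + 2 / g * v - 2 / g * divdiff f t tb + 2 / g * Derive f t.

Definition next_impact (g : R) (f : R -> R) (t v tb : R) : Prop :=
  t < tb /\ impact_eq g f t v tb /\
  forall s, t < s -> impact_eq g f t v s -> tb <= s.

(* The maps are given by their graphs, on lifts to the universal cover. *)
Definition Psi (g : R) (f : R -> R) (t v tb vb : R) : Prop :=
  next_impact g f t v tb /\
  vb = v - 2 * divdiff f t tb + Derive f tb + Derive f t.

Definition Phi (g : R) (f : R -> R) (t e tb eb : R) : Prop :=
  next_impact g f t (sqrt (2 * e)) tb /\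
  eb = / 2 * (sqrt (2 * e) - 2 * divdiff f t tb + Derive f tb + Derive f t) ^ 2.

(** * Real analytic embeddings of the half-cylinder *)

(* [x] and [y] are at distance less than [d] in R/Z. *)
Definition circle_near (d x y : R) : Prop :=
  exists m : Z, Rabs (x - (y + IZR m)) < d.

Definition circle_eq (x y : R) : Prop := exists m : Z, x = y + IZR m.

(* (T, V) is the lift of a map of R/Z x (v0, +oo) into R/Z x R; the last four
   clauses say that the latter is analytic, an immersion, injective, and has
   a continuous inverse on its image. *)
Definition analytic_cylinder_embedding (v0 : R) (T V : R -> R -> R) : Prop :=
  (forall t v, v0 < v -> T (t + 1) v = T t v + 1 /\ V (t + 1) v = V t v) /\
  (forall t v, v0 < v -> real_analytic2_at T t v /\ real_analytic2_at V t v) /\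
  (forall t v, v0 < v ->
     Derive (fun x => T x v) t * Derive (fun y => V t y) v
     - Derive (fun y => T t y) v * Derive (fun x => V x v) t <> 0) /\
  (forall t v t' v', v0 < v -> v0 < v' ->
     circle_eq (T t v) (T t' v') -> V t v = V t' v' ->
     circle_eq t t' /\ v = v') /\
  (forall t v, v0 < v -> forall eps, 0 < eps ->
     exists delta, 0 < delta /\
       forall t' v', v0 < v' ->
         circle_near delta (T t' v') (T t v) -> Rabs (V t' v' - V t v) < delta ->
         circle_near eps t' t /\ Rabs (v' - v) < eps).

Definition admissible_velocity (g : R) (f : R -> R) (vstar : R) : Prop :=
  Rbar_lt (Rbar_mult 4 (sup_norm (Derive f))) vstar /\
  exists T V : R -> R -> R,
    (forall t v, vstar < v -> Psi g f t v (T t v) (V t v)) /\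
    analytic_cylinder_embedding vstar T V.

(** * Bouncing motions *)

Definition motion := Z -> R * R.

Definition complete_motion (g : R) (f : R -> R) (vstar : R) (x : motion) : Prop :=
  forall n : Z,
    / 2 * vstar ^ 2 < snd (x n) /\
    Phi g f (fst (x n)) (snd (x n)) (fst (x (n + 1)%Z)) (snd (x (n + 1)%Z)).

Definition periodic_motion (g : R) (f : R -> R) (vstar : R) (p q : Z)
    (x : motion) : Prop :=
  complete_motion g f vstar x /\
  forall n : Z, x (n + q)%Z = (fst (x n) + IZR p, snd (x n)).

Definition translate (m : Z) (x : motion) : motion :=
  fun n => (fst (x n) + IZR m, snd (x n)).

Definition finite_mod_translation (P : motion -> Prop) : Prop :=
  exists l : list motion, forall x, P x ->
    exists y, In y l /\ exists m : Z, forall n : Z, x n = translate m y n.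

Definition degenerate (g : R) (f : R -> R) (vstar : R) (p q : Z) : Prop :=
  exists tc ec : R -> R,
    real_analytic tc /\ real_analytic ec /\
    (forall s, tc (s + 1) = tc s + 1 /\ ec (s + 1) = ec s) /\
    (forall x, exists! s, 0 <= s < 1 /\ circle_eq (tc s) x) /\
    (forall x : motion, complete_motion g f vstar x ->
       (periodic_motion g f vstar p q x <->
        exists (n0 : Z) (s0 : R), x n0 = (tc s0, ec s0))).

(* All iterates of a point are defined exactly when it lies on a complete
   motion, which is then unique because the map is injective for an
   admissible [vstar]. *)
Definition stable (g : R) (f : R -> R) (vstar : R) (x : motion) : Prop :=
  forall eps, 0 < eps -> exists delta, 0 < delta /\
    forall t0 e0, dist_euc (fst (x 0%Z)) (snd (x 0%Z)) t0 e0 < delta ->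
      exists y : motion,
        y 0%Z = (t0, e0) /\ complete_motion g f vstar y /\
        forall n : Z,
          dist_euc (fst (y n)) (snd (y n)) (fst (x n)) (snd (x n)) < eps.

Definition unstable (g : R) (f : R -> R) (vstar : R) (x : motion) : Prop :=
  ~ stable g f vstar x.

(* Main.v *)
(* In terms of impact times, a motion is a critical sequence of the action
   sum of h(t_n, t_{n+1}).  For p large all flights of a (p,q)-periodic motion
   are long, so the divided differences have small Lipschitz constants, and with
   f'' small the map of q bounces is a twist map: the critical chain of q
   flights from x to x + p exists and is unique.  It is the fixed point of a
   contraction in an algebra of absolutely summable power series, so it depends
   analytically on x.  The (p,q)-periodic motions correspond to the zeros of the
   jump of the velocity at x, which up to a positive factor is minus the
   derivative of the action W(x) of the chain.  As the jump is analytic and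
   periodic, it has finitely many zeros modulo 1 or vanishes identically.

   In the first case start next to a maximum of W, slightly above the curve of
   chains: by the twist, successive q-th impact times drift to the right, where
   the curve is mapped above itself, with steps bounded below.  In the second
   case the curve is invariant and the drift could slow down; but the
   trapezoidal rule for h shows that the height above the curve changes by at
   most a multiple of the square of the step, so the height stays comparable to its initial
   value over a fixed interval, and the steps are again bounded below. *)

Require Import Defs.
From Stdlib Require Import Reals ZArith Znumtheory List Lra Lia ClassicalEpsilon.
From Coquelicot Require Import Coquelicot.
Open Scope R_scope.

(** The definitions do not make the two alternatives exclusive: [degenerate] speaks only of complete
    motions, and a point of its curve need not lie on one. So the case split is on the analytic
    function [defect], and both instability claims are proved in both cases. The delicate
    combination is a degenerate set with isolated zeros of [defect]: there a stable motion is
    refuted because stability itself supplies complete motions through nearby points of the curve.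

    Real estimates and analyticity are handled by one norm, the sum of the absolute values of the
    Taylor terms at radius [r]. For [r = 0] it is the absolute value at the centre, so one
    contraction gives the existence of chains for [r = 0] and their analyticity for small [r > 0],
    the local solutions being identified by uniqueness. Under composition the Lipschitz constant in
    this norm exceeds the derivative at the centre by an arbitrarily small amount only, so one
    smallness condition serves both uses.

    [Phi] is only a relation; that it is total and injective above [vstar] is read off from the
    embedding in [admissible_velocity]. *)

Definition absum (a : nat -> R) (M : R) : Prop :=
  forall N, sum_n (fun n => Rabs (a n)) N <= M.

Lemma sum_n_R0 (a : nat -> R) : sum_n a 0 = a 0%nat.
Proof. exact (sum_O a). Qed.

Lemma sum_n_RS (a : nat -> R) n : sum_n a (S n) = sum_n a n + a (S n).
Proof. exact (sum_Sn a n). Qed.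

Lemma sum_n_Rle (a b : nat -> R) N :
  (forall n, (n <= N)%nat -> a n <= b n) -> sum_n a N <= sum_n b N.
Proof.
  induction N as [|N IH]; intros H.
  - rewrite !sum_n_R0. apply H; lia.
  - rewrite !sum_n_RS. simpl. apply Rplus_le_compat.
    + apply IH. intros n Hn; apply H; lia.
    + apply H; lia.
Qed.

Lemma sum_n_Rabs (a : nat -> R) N :
  Rabs (sum_n a N) <= sum_n (fun n => Rabs (a n)) N.
Proof.
  induction N as [|N IH].
  - rewrite !sum_n_R0. lra.
  - rewrite !sum_n_RS. simpl. eapply Rle_trans. apply Rabs_triang. lra.
Qed.

Lemma sum_n_Rext (a b : nat -> R) N :
  (forall n, a n = b n) -> sum_n a N = sum_n b N.
Proof. exact (sum_n_ext a b N). Qed.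

Lemma sum_n_Rplus (a b : nat -> R) N :
  sum_n (fun n => a n + b n) N = sum_n a N + sum_n b N.
Proof. exact (sum_n_plus a b N). Qed.

Lemma sum_n_Rscal (c : R) (a : nat -> R) N :
  sum_n (fun n => c * a n) N = c * sum_n a N.
Proof. exact (sum_n_mult_l c a N). Qed.

Lemma sum_n_Rminus (a b : nat -> R) N :
  sum_n (fun n => a n - b n) N = sum_n a N - sum_n b N.
Proof.
  replace (sum_n a N - sum_n b N) with (sum_n a N + -1 * sum_n b N) by ring.
  rewrite <- sum_n_Rscal, <- sum_n_Rplus. apply sum_n_Rext; intros; ring.
Qed.

Lemma is_series_Rext (a b : nat -> R) (l : R) :
  (forall n, a n = b n) -> is_series a l -> is_series b l.
Proof. exact (is_series_ext a b l). Qed.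

Lemma is_series_Rplus (a b : nat -> R) (la lb : R) :
  is_series a la -> is_series b lb -> is_series (fun n => a n + b n) (la + lb).
Proof. exact (is_series_plus a b la lb). Qed.

Lemma is_series_Rscal (c : R) (a : nat -> R) (l : R) :
  is_series a l -> is_series (fun n => c * a n) (c * l).
Proof. exact (is_series_scal c a l). Qed.

Lemma INR_ge_1 n : (0 < n)%nat -> 1 <= INR n.
Proof. intros H. change 1 with (INR 1). now apply le_INR. Qed.

Lemma INR_ratio n Q : (0 < Q)%nat -> (n <= Q)%nat -> 0 <= INR n / INR Q <= 1.
Proof.
  intros HQ Hn. apply INR_ge_1 in HQ. apply le_INR in Hn. pose proof (pos_INR n).
  split; [apply Rdiv_le_0_compat; lra|].
  apply Rmult_le_reg_r with (INR Q); [lra|]. field_simplify; lra.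
Qed.

Lemma Rabs_le0_eq x y : Rabs (x - y) <= 0 -> x = y.
Proof.
  intros H. apply Rminus_diag_uniq, NNPP. intros Hn.
  apply Rabs_pos_lt in Hn. lra.
Qed.

Lemma absum_pos a M : absum a M -> 0 <= M.
Proof.
  intros H. eapply Rle_trans; [| apply (H O)]. rewrite sum_n_R0. apply Rabs_pos.
Qed.

Lemma absum_term a M n : absum a M -> Rabs (a n) <= M.
Proof.
  intros H. eapply Rle_trans; [| apply (H n)].
  assert (P : forall k, 0 <= sum_n (fun n => Rabs (a n)) k).
  { intros k. rewrite <- (Rmult_0_l (sum_n (fun _ => 0) k)), <- sum_n_Rscal.
    apply sum_n_Rle; intros. rewrite Rmult_0_l. apply Rabs_pos. }
  destruct n as [|n]. rewrite sum_n_R0; lra.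
  rewrite sum_n_RS. specialize (P n). simpl. lra.
Qed.

Lemma absum_ex_series a M : absum a M -> ex_series (fun n => Rabs (a n)).
Proof.
  intros H.
  destruct (ex_finite_lim_seq_incr (sum_n (fun n => Rabs (a n))) M) as [l Hl].
  - intros n. rewrite sum_n_RS. simpl.
    pose proof (Rabs_pos (a (S n))). lra.
  - exact H.
  - exists l. exact Hl.
Qed.

Lemma is_series_le_bound a l M :
  is_series a l -> (forall N, sum_n a N <= M) -> l <= M.
Proof.
  intros Hl H.
  apply (is_lim_seq_le (sum_n a) (fun _ => M) l M H Hl (is_lim_seq_const M)).
Qed.

Lemma absum_is_series_bound a l M : absum a M -> is_series a l -> Rabs l <= M.
Proof.
  intros H Hl.
  assert (L : is_lim_seq (fun N => Rabs (sum_n a N)) (Rabs l)).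
  { apply (is_lim_seq_abs (sum_n a) l Hl). }
  apply (is_lim_seq_le _ (fun _ => M) (Rabs l) M) in L; auto using is_lim_seq_const.
  intros n. eapply Rle_trans. apply sum_n_Rabs. apply H.
Qed.

Lemma absum_is_series a M : absum a M -> is_series a (Series a).
Proof.
  intros H. apply Series_correct, ex_series_Rabs, (absum_ex_series a M H).
Qed.

Lemma is_lim_seq_sum_n (u : nat -> nat -> R) (l : nat -> R) N :
  (forall n, is_lim_seq (u n) (l n)) ->
  is_lim_seq (fun K => sum_n (fun n => u n K) N) (sum_n l N).
Proof.
  intros H. induction N as [|N IH].
  - rewrite sum_n_R0. apply is_lim_seq_ext with (u 0%nat); auto.
    intros n; now rewrite sum_n_R0.
  - rewrite sum_n_RS. apply is_lim_seq_ext with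
      (fun K => sum_n (fun n => u n K) N + u (S N) K).
    intros K; now rewrite sum_n_RS.
    apply (is_lim_seq_plus' _ _ _ _ IH (H (S N))).
Qed.

(** The columns are approximated, in the summed norm, by their partial sums over [k <= K0], with an
    error of at most the tail of [eps]. For finitely many [k] the order of summation is free, and
    the tails tend to 0. *)
Lemma fubini_absum (b : nat -> nat -> R) (eps : nat -> R) (E : R) :
  (forall k, absum (b k) (eps k)) -> (forall K, sum_n eps K <= E) ->
  absum (fun n => Series (fun k => b k n)) E /\
  (forall n, is_series (fun k => b k n) (Series (fun k => b k n))) /\
  forall s, (forall k, is_series (b k) (s k)) ->
    is_series s (Series s) /\
    is_series (fun n => Series (fun k => b k n)) (Series s).
Proof.
  intros Hb HE.
  assert (Heps : forall k, 0 <= eps k) by (intros k; exact (absum_pos _ _ (Hb k))).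
  assert (AE : absum eps E).
  { intros N. rewrite (sum_n_Rext _ eps). apply HE.
    intros n; apply Rabs_pos_eq, Heps. }
  assert (dom : forall u : nat -> R, (forall k, Rabs (u k) <= eps k) ->
            is_series u (Series u)).
  { intros u Hu. apply (absum_is_series u E). intros N.
    eapply Rle_trans; [apply sum_n_Rle; intros; apply Hu | apply HE]. }
  set (c := fun n => Series (fun k => b k n)).
  assert (Hc : forall n, is_series (fun k => b k n) (c n)).
  { intros n. apply dom. intros k. exact (absum_term _ _ n (Hb k)). }
  assert (Se : is_series eps (Series eps)) by exact (absum_is_series _ _ AE).
  assert (SE : Series eps <= E) by exact (is_series_le_bound _ _ _ Se HE).
  assert (fin : forall N K0 m, sum_n (fun n => Rabs (sum_n (fun k => b k n) (K0 + m)
               - sum_n (fun k => b k n) K0)) N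
             <= sum_n eps (K0 + m) - sum_n eps K0).
  { intros N K0 m. induction m as [|m IH].
    - rewrite Nat.add_0_r, Rminus_diag.
      rewrite (sum_n_Rext _ (fun _ => 0 * 0)).
      rewrite sum_n_Rscal. lra.
      intros n. rewrite Rminus_diag, Rabs_R0. ring.
    - rewrite Nat.add_succ_r, sum_n_RS.
      eapply Rle_trans; [apply sum_n_Rle with
        (b := fun n => Rabs (sum_n (fun k => b k n) (K0 + m) - sum_n (fun k => b k n) K0)
                       + Rabs (b (S (K0 + m)) n)) |].
      + intros n _. rewrite sum_n_RS. simpl.
        replace (sum_n (fun k => b k n) (K0 + m) + b (S (K0 + m)) n
                 - sum_n (fun k => b k n) K0)
          with ((sum_n (fun k => b k n) (K0 + m) - sum_n (fun k => b k n) K0)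
                 + b (S (K0 + m)) n) by ring.
        apply Rabs_triang.
      + rewrite sum_n_Rplus. simpl.
        specialize (Hb (S (K0 + m)) N). lra. }
  assert (tail : forall N K0,
     sum_n (fun n => Rabs (c n - sum_n (fun k => b k n) K0)) N
       <= Series eps - sum_n eps K0).
  { intros N K0.
    apply (is_lim_seq_le
      (fun m => sum_n (fun n => Rabs (sum_n (fun k => b k n) (K0 + m)
               - sum_n (fun k => b k n) K0)) N)
      (fun m => sum_n eps (K0 + m) - sum_n eps K0)
      (sum_n (fun n => Rabs (c n - sum_n (fun k => b k n) K0)) N)
      (Series eps - sum_n eps K0)).
    - apply fin.
    - apply (is_lim_seq_sum_n (fun n m => Rabs (sum_n (fun k => b k n) (K0 + m)
               - sum_n (fun k => b k n) K0))).
      intros n.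
      apply (is_lim_seq_abs _ (Finite (c n - sum_n (fun k => b k n) K0))).
      apply is_lim_seq_minus'; [|apply is_lim_seq_const].
      apply is_lim_seq_ext with (fun m => sum_n (fun k => b k n) (m + K0)).
      intros; f_equal; lia.
      apply (is_lim_seq_incr_n (sum_n (fun k => b k n)) K0). exact (Hc n).
    - apply is_lim_seq_minus'; [|apply is_lim_seq_const].
      apply is_lim_seq_ext with (fun m => sum_n eps (m + K0)).
      intros; f_equal; lia.
      apply (is_lim_seq_incr_n (sum_n eps) K0). exact Se. }
  assert (AC : absum c E).
  { intros N. specialize (tail N 0%nat). rewrite sum_n_R0 in tail.
    apply Rle_trans with (sum_n (fun n => Rabs (c n - sum_n (fun k => b k n) 0)
       + Rabs (b 0%nat n)) N).
    - apply sum_n_Rle. intros n _. rewrite sum_n_R0.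
      replace (c n) with ((c n - b 0%nat n) + b 0%nat n) at 1 by ring.
      apply Rabs_triang.
    - rewrite sum_n_Rplus. specialize (Hb 0%nat N). lra. }
  split; [exact AC | split; [exact Hc |]].
  intros s Hs.
  assert (Hs' : is_series s (Series s)).
  { apply dom. intros k. exact (absum_is_series_bound _ _ _ (Hb k) (Hs k)). }
  split; [exact Hs' |].
  assert (HC : is_series c (Series c)) by exact (absum_is_series _ _ AC).
  replace (Series s) with (Series c); [exact HC |].
  (* Uniform in [N]: once the two finite sums are exchanged, what remains is the distance of the
     columns from their partial sums, which [tail] controls. *)
  assert (key : forall K0,
     Rabs (Series c - sum_n s K0) <= Series eps - sum_n eps K0).
  { intros K0.
    apply (is_lim_seq_le
      (fun N => Rabs (sum_n c N - sum_n (fun k => sum_n (b k) N) K0))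
      (fun _ => Series eps - sum_n eps K0)
      (Rabs (Series c - sum_n s K0)) (Series eps - sum_n eps K0)).
    - intros N. rewrite sum_n_switch, <- sum_n_Rminus.
      eapply Rle_trans; [apply sum_n_Rabs | apply tail].
    - apply (is_lim_seq_abs _ (Finite (Series c - sum_n s K0))).
      apply is_lim_seq_minus'; [exact HC |].
      apply (is_lim_seq_sum_n (fun k N => sum_n (b k) N)). exact Hs.
    - apply is_lim_seq_const. }
  assert (L1 : is_lim_seq (fun K0 => Rabs (Series c - sum_n s K0))
                 (Rabs (Series c - Series s))).
  { apply (is_lim_seq_abs _ (Finite (Series c - Series s))).
    apply is_lim_seq_minus'; [apply is_lim_seq_const | exact Hs']. }
  assert (L2 : is_lim_seq (fun K0 => Series eps - sum_n eps K0)
                 (Series eps - Series eps)).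
  { apply is_lim_seq_minus'; [apply is_lim_seq_const | exact Se]. }
  assert (H := is_lim_seq_le _ _ _ _ key L1 L2). simpl in H.
  apply Rabs_le0_eq. lra.
Qed.

(** * Power series with absolutely summable coefficients *)

(* For [r = 0] this only says that [|u x0| <= rho], so that statements about
   real numbers are the case [r = 0] of statements about analytic functions. *)
Definition An (x0 r rho : R) (u : R -> R) : Prop :=
  exists a : nat -> R,
    absum (fun n => a n * r ^ n) rho /\
    forall x, Rabs (x - x0) <= r -> is_series (fun n => a n * (x - x0) ^ n) (u x).

Lemma absum_disc (a : nat -> R) r y M : Rabs y <= r ->
  absum (fun n => a n * r ^ n) M -> absum (fun n => a n * y ^ n) M.
Proof.
  intros Hy H N. pose proof (Rabs_pos y).
  eapply Rle_trans; [|apply (H N)]. apply sum_n_Rle. intros n _. rewrite !Rabs_mult.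
  apply Rmult_le_compat_l; [apply Rabs_pos|].
  rewrite <- !RPow_abs, (Rabs_pos_eq r) by lra. now apply pow_incr.
Qed.

Lemma An_pos x0 r rho u : An x0 r rho u -> 0 <= rho.
Proof. intros [a [H _]]. exact (absum_pos _ _ H). Qed.

Lemma An_ext x0 r rho u v :
  (forall x, Rabs (x - x0) <= r -> u x = v x) -> An x0 r rho u -> An x0 r rho v.
Proof.
  intros E [a [H1 H2]]. exists a; split; auto.
  intros x Hx. rewrite <- E by auto. auto.
Qed.

Lemma An_le x0 r rho rho' u : rho <= rho' -> An x0 r rho u -> An x0 r rho' u.
Proof.
  intros L [a [H1 H2]]. exists a; split; auto.
  intros N. eapply Rle_trans; [apply H1 | exact L].
Qed.

Lemma An_bound x0 r rho u x :
  An x0 r rho u -> Rabs (x - x0) <= r -> Rabs (u x) <= rho.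
Proof.
  intros [a [H1 H2]] Hx. apply (absum_is_series_bound (fun n => a n * (x - x0) ^ n)); auto.
  exact (absum_disc _ _ _ _ Hx H1).
Qed.

Lemma is_series_finite_support (a : nat -> R) (N : nat) :
  (forall n, (N < n)%nat -> a n = 0) -> is_series a (sum_n a N).
Proof.
  intros H. change (is_lim_seq (sum_n a) (sum_n a N)).
  apply (is_lim_seq_ext_loc (fun _ => sum_n a N)).
  - exists N. intros n Hn. induction Hn as [|m Hm IH]; [reflexivity|].
    rewrite sum_n_RS, <- IH, H by lia. symmetry; apply Rplus_0_r.
  - apply is_lim_seq_const.
Qed.

Lemma An_affine x0 r (A B : R) : 0 <= r ->
  An x0 r (Rabs A + Rabs B * r) (fun x => A + B * (x - x0)).
Proof.
  intros Hr.
  exists (fun n => match n with O => A | S O => B | _ => 0 end). split.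
  - intros N. destruct N as [|N].
    + rewrite sum_n_R0. simpl. rewrite Rmult_1_r.
      pose proof (Rmult_le_pos _ _ (Rabs_pos B) Hr). lra.
    + induction N as [|N IH].
      * rewrite sum_n_RS, sum_n_R0. simpl.
        rewrite !Rmult_1_r, Rabs_mult, (Rabs_pos_eq r) by lra. lra.
      * rewrite sum_n_RS. simpl. simpl in IH.
        rewrite Rmult_0_l, Rabs_R0. lra.
  - intros x _.
    assert (H := is_series_finite_support
      (fun n => match n with O => A | S O => B | _ => 0 end * (x - x0) ^ n) 1).
    rewrite sum_n_RS, sum_n_R0 in H. simpl in H.
    replace (A + B * (x - x0)) with (A * 1 + B * ((x - x0) * 1)) by ring.
    apply H. intros [|[|n]] Hn; try lia. ring.
Qed.

Lemma An_const x0 r A : 0 <= r -> An x0 r (Rabs A) (fun _ => A).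
Proof.
  intros Hr. assert (H := An_affine x0 r A 0 Hr).
  rewrite Rabs_R0, Rmult_0_l, Rplus_0_r in H.
  eapply An_ext; [|exact H]. intros; simpl; ring.
Qed.

Lemma An_plus x0 r rho1 rho2 u v :
  An x0 r rho1 u -> An x0 r rho2 v -> An x0 r (rho1 + rho2) (fun x => u x + v x).
Proof.
  intros [a [A1 A2]] [b [B1 B2]]. exists (fun n => a n + b n). split.
  - intros N. specialize (A1 N). specialize (B1 N).
    eapply Rle_trans with (sum_n (fun n => Rabs (a n * r ^ n) + Rabs (b n * r ^ n)) N).
    + apply sum_n_Rle. intros n _. rewrite Rmult_plus_distr_r. apply Rabs_triang.
    + rewrite sum_n_Rplus. lra.
  - intros x Hx.
    apply is_series_Rext with (fun n => a n * (x - x0) ^ n + b n * (x - x0) ^ n).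
    intros n. ring.
    apply is_series_Rplus; auto.
Qed.

Lemma An_scal x0 r rho c u :
  An x0 r rho u -> An x0 r (Rabs c * rho) (fun x => c * u x).
Proof.
  intros [a [A1 A2]]. exists (fun n => c * a n). split.
  - intros N. rewrite (sum_n_Rext _ (fun n => Rabs c * Rabs (a n * r ^ n))).
    rewrite sum_n_Rscal. apply Rmult_le_compat_l; [apply Rabs_pos | apply A1].
    intros n. rewrite <- Rabs_mult. f_equal. ring.
  - intros x Hx.
    apply is_series_Rext with (fun n => c * (a n * (x - x0) ^ n)).
    intros n. ring.
    apply is_series_Rscal. auto.
Qed.

Lemma An_opp x0 r rho u : An x0 r rho u -> An x0 r rho (fun x => - u x).
Proof.
  intros H. apply (An_scal _ _ _ (-1)) in H.
  replace (Rabs (-1) * rho) with rho in H by (rewrite Rabs_left; lra).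
  eapply An_ext; [|exact H]. intros; simpl; ring.
Qed.

Lemma An_minus x0 r rho1 rho2 u v :
  An x0 r rho1 u -> An x0 r rho2 v -> An x0 r (rho1 + rho2) (fun x => u x - v x).
Proof. intros Hu Hv. apply An_plus; auto using An_opp. Qed.

(** Cauchy product: its coefficients are dominated by the Cauchy product of the absolute values, so
    the norm is submultiplicative. *)
Lemma An_mult x0 r rho1 rho2 u v : 0 <= r ->
  An x0 r rho1 u -> An x0 r rho2 v -> An x0 r (rho1 * rho2) (fun x => u x * v x).
Proof.
  intros Hr [a [A1 A2]] [b [B1 B2]].
  assert (cauchy : forall y n,
    sum_f_R0 (fun k => a k * b (n - k)%nat) n * y ^ n =
    sum_f_R0 (fun k => (a k * y ^ k) * (b (n - k)%nat * y ^ (n - k))) n).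
  { intros y n. rewrite Rmult_comm, scal_sum. apply sum_eq. intros k Hk.
    replace (y ^ n) with (y ^ k * y ^ (n - k)).
    ring. rewrite <- pow_add. f_equal. lia. }
  assert (absum_le : forall (c : nat -> R) rho, absum (fun n => c n * r ^ n) rho ->
    forall x, Rabs (x - x0) <= r -> ex_series (fun n => Rabs (c n * (x - x0) ^ n))).
  { intros c rho H x Hx. exact (absum_ex_series _ rho (absum_disc _ _ _ _ Hx H)). }
  exists (fun n => sum_f_R0 (fun k => a k * b (n - k)%nat) n). split.
  - destruct (absum_ex_series _ _ A1) as [la Hla].
    destruct (absum_ex_series _ _ B1) as [lb Hlb].
    assert (La : 0 <= la <= rho1).
    { split; [|exact (is_series_le_bound _ _ _ Hla A1)].
      apply (is_lim_seq_le (fun _ => 0) _ 0 la) in Hla; auto using is_lim_seq_const.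
      intros n. eapply Rle_trans; [apply Rabs_pos | apply sum_n_Rabs]. }
    assert (Lb : 0 <= lb <= rho2).
    { split; [|exact (is_series_le_bound _ _ _ Hlb B1)].
      apply (is_lim_seq_le (fun _ => 0) _ 0 lb) in Hlb; auto using is_lim_seq_const.
      intros n. eapply Rle_trans; [apply Rabs_pos | apply sum_n_Rabs]. }
    assert (Hab := is_series_mult _ _ _ _ Hla Hlb).
    match type of Hab with ?P -> _ => assert (HP : P) end.
    { exists la. eapply is_series_Rext; [|exact Hla]. intros; simpl. now rewrite Rabs_Rabsolu. }
    specialize (Hab HP). clear HP.
    match type of Hab with ?P -> _ => assert (HP : P) end.
    { exists lb. eapply is_series_Rext; [|exact Hlb]. intros; simpl. now rewrite Rabs_Rabsolu. }
    specialize (Hab HP). clear HP.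
    intros N. apply Rle_trans with (la * lb); [|apply Rmult_le_compat; lra].
    eapply Rle_trans; [apply sum_n_Rle; intros n _; rewrite cauchy;
       rewrite <- sum_n_Reals; apply sum_n_Rabs |].
    match type of Hab with is_series ?s _ => set (w := s) in * end.
    assert (Hw : forall n, 0 <= w n).
    { intros n. unfold w. apply cond_pos_sum. intros k.
      apply Rmult_le_pos; apply Rabs_pos. }
    eapply Rle_trans; [apply sum_n_Rle with (b := w); intros n _ |].
    + unfold w. rewrite sum_n_Reals. right. apply sum_eq. intros; apply Rabs_mult.
    + apply (is_lim_seq_incr_compare (sum_n w) (la * lb)); [exact Hab|].
      intros n. rewrite sum_n_RS. specialize (Hw (S n)). simpl. lra.
  - intros x Hx.
    eapply is_series_Rext; [intros n; symmetry; apply cauchy|].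
    apply (is_series_mult (fun n => a n * (x - x0) ^ n) (fun n => b n * (x - x0) ^ n));
      eauto.
Qed.

Lemma An_pow x0 r rho u k : 0 <= r ->
  An x0 r rho u -> An x0 r (rho ^ k) (fun x => u x ^ k).
Proof.
  intros Hr H. induction k as [|k IH]; simpl.
  - eapply An_le; [|now apply (An_const x0 r 1)]. rewrite Rabs_R1; lra.
  - now apply An_mult.
Qed.

(** The splitting [u^(k+1) - v^(k+1) = u (u^k - v^k) + (u - v) v^k] gives by induction the
    derivative of the monomial at [rho] as Lipschitz constant. *)
Lemma An_pow_lip x0 r rho eps u v k : 0 <= r ->
  An x0 r rho u -> An x0 r rho v -> An x0 r eps (fun x => u x - v x) ->
  An x0 r (INR k * rho ^ pred k * eps) (fun x => u x ^ k - v x ^ k).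
Proof.
  intros Hr Hu Hv Huv. induction k as [|k IH].
  - eapply An_le; [|eapply An_ext; [|now apply (An_const x0 r 0)]].
    + rewrite Rabs_R0. simpl. lra.
    + intros; simpl; ring.
  - apply An_ext with (fun x => u x * (u x ^ k - v x ^ k) + (u x - v x) * v x ^ k).
    intros; simpl; ring.
    eapply An_le; [|apply An_plus;
      [exact (An_mult _ _ _ _ _ _ Hr Hu IH)
      |exact (An_mult _ _ _ _ _ _ Hr Huv (An_pow _ _ _ _ k Hr Hv))]].
    right. rewrite S_INR. destruct k as [|k]; simpl; [ring|]. ring.
Qed.

Lemma An_r0 x0 rho u : An x0 0 rho u <-> Rabs (u x0) <= rho.
Proof.
  split; intros H.
  - apply (An_bound x0 0 rho); auto. rewrite Rminus_diag, Rabs_R0; lra.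
  - eapply An_ext; [|eapply An_le; [exact H|now apply An_const; right]].
    intros x Hx. simpl. now rewrite (Rabs_le0_eq x x0 Hx).
Qed.

(** Completeness of the norm: a series of functions whose norms are summable stays in the class.
    Limits of iterations are obtained through it. *)
Lemma An_series x0 r (eps : nat -> R) (E : R) (u : nat -> R -> R) : 0 <= r ->
  (forall k, An x0 r (eps k) (u k)) -> (forall K, sum_n eps K <= E) ->
  (forall x, Rabs (x - x0) <= r ->
     is_series (fun k => u k x) (Series (fun k => u k x))) /\
  An x0 r E (fun x => Series (fun k => u k x)).
Proof.
  intros Hr Hu HE.
  assert (S1 : forall x, Rabs (x - x0) <= r -> absum (fun k => u k x) E).
  { intros x Hx N. eapply Rle_trans; [apply sum_n_Rle | apply HE].
    intros n _. exact (An_bound _ _ _ _ _ (Hu n) Hx). }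
  split.
  { intros x Hx. exact (absum_is_series _ _ (S1 x Hx)). }
  (* For [r = 0] the norm controls only the constant coefficient, and the division by [r ^ n] below
     is impossible; the claim is then an inequality between numbers. *)
  destruct (Req_dec r 0) as [->|Hr0].
  { assert (Hx0 : Rabs (x0 - x0) <= 0) by (rewrite Rminus_diag, Rabs_R0; lra).
    apply An_r0.
    exact (absum_is_series_bound _ _ _ (S1 _ Hx0) (absum_is_series _ _ (S1 _ Hx0))). }
  set (a := fun k => proj1_sig (constructive_indefinite_description _ (Hu k))).
  assert (Ha : forall k, absum (fun n => a k n * r ^ n) (eps k) /\
    forall x, Rabs (x - x0) <= r -> is_series (fun n => a k n * (x - x0) ^ n) (u k x)).
  { intros k. unfold a. exact (proj2_sig (constructive_indefinite_description _ (Hu k))). }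
  destruct (fubini_absum (fun k n => a k n * r ^ n) eps E) as [F1 [F2 _]].
  { intros k. apply Ha. } { exact HE. }
  (* The bounds concern coefficients scaled by [r ^ n]; these are summed over [k] and scaled
     back. *)
  exists (fun n => Series (fun k => a k n * r ^ n) / r ^ n). split.
  - intros N. rewrite (sum_n_Rext _ (fun n => Rabs (Series (fun k => a k n * r ^ n)))).
    apply F1. intros n. f_equal. field. now apply pow_nonzero.
  - intros x Hx.
    destruct (fubini_absum (fun k n => a k n * (x - x0) ^ n) eps E) as [G1 [G2 G3]].
    { intros k. exact (absum_disc _ _ _ _ Hx (proj1 (Ha k))). } { exact HE. }
    destruct (G3 (fun k => u k x)) as [_ G4].
    { intros k. now apply Ha. }
    eapply is_series_Rext; [|exact G4]. intros n. simpl.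
    apply is_series_unique.
    replace (Series (fun k => a k n * r ^ n) / r ^ n * (x - x0) ^ n) with
      ((x - x0) ^ n / r ^ n * Series (fun k => a k n * r ^ n))
      by (field; now apply pow_nonzero).
    eapply is_series_Rext; [|exact (is_series_Rscal ((x - x0) ^ n / r ^ n) _ _ (F2 n))].
    intros k. simpl. field. now apply pow_nonzero.
Qed.

(** * Functions analytic at a point *)

Definition analytic_at (phi : R -> R) (c : R) : Prop :=
  exists (a : nat -> R) (r : R), 0 < r /\
    forall x, Rabs (x - c) < r -> is_pseries a (x - c) (phi x).

Lemma is_pseries_bounded (a : nat -> R) (y l : R) :
  is_pseries a y l -> exists M, forall n, Rabs (a n * y ^ n) <= M.
Proof.
  intros H. apply is_pseries_R in H.
  assert (E : ex_series (fun n => a n * y ^ n)) by now exists l.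
  apply ex_series_lim_0 in E.
  destruct (filterlim_bounded (fun n => a n * y ^ n)) as [M HM].
  - exists 0. exact E.
  - exists M. exact HM.
Qed.

(** At the midpoint of [Rabs y] and [r] the terms are bounded, which puts the radius of convergence
    beyond [Rabs y]. *)
Lemma is_pseries_CV_radius (a : nat -> R) (phi : R -> R) (r : R) :
  (forall y, Rabs y < r -> is_pseries a y (phi y)) ->
  forall y, Rabs y < r -> Rbar_lt (Rabs y) (CV_radius a).
Proof.
  intros H y Hy. set (z := (Rabs y + r) / 2).
  pose proof (Rabs_pos y) as Py.
  assert (Hz : Rabs z < r) by (rewrite Rabs_pos_eq; unfold z; lra).
  destruct (is_pseries_bounded _ _ _ (H z Hz)) as [M HM].
  apply Rbar_lt_le_trans with z.
  - simpl. unfold z; lra.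
  - apply (proj1 (CV_radius_bounded a) z). now exists M.
Qed.

(** One series serves the function and, term by term, its derivative. Identifying [a 1] with the
    derivative is what later ties the majorants to [Derive phi c]. *)
Lemma analytic_at_expand (phi : R -> R) (c : R) : analytic_at phi c ->
  exists (a : nat -> R) (r : R), 0 < r /\ a 1%nat = Derive phi c /\
    (forall x, Rabs (x - c) < r -> is_pseries a (x - c) (phi x)) /\
    (forall x, Rabs (x - c) < r -> ex_derive phi x /\
       is_pseries (PS_derive a) (x - c) (Derive phi x)).
Proof.
  intros [a [r [Hr H]]]. exists a, r.
  assert (CV : forall y, Rabs y < r -> Rbar_lt (Rabs y) (CV_radius a)).
  { apply (is_pseries_CV_radius a (fun y => phi (y + c))).
    intros y Hy. assert (E : y = (y + c) - c) by ring.
    rewrite E at 1. apply H. now rewrite <- E. }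
  assert (D : forall x, Rabs (x - c) < r ->
            is_derive phi x (PSeries (PS_derive a) (x - c))).
  { intros x Hx.
    apply (is_derive_ext_loc (fun t => PSeries a (t - c))).
    - assert (He : 0 < r - Rabs (x - c)) by lra.
      exists (mkposreal _ He). intros t Ht.
      apply is_pseries_unique, H.
      change (Rabs (t - x) < r - Rabs (x - c)) in Ht.
      replace (t - c) with ((t - x) + (x - c)) by ring.
      eapply Rle_lt_trans; [apply Rabs_triang|]. lra.
    - evar_last.
      apply (is_derive_comp (PSeries a) (fun t => t - c)).
      + apply is_derive_PSeries, CV, Hx.
      + auto_derive; reflexivity.
      + unfold scal; simpl; unfold mult; simpl. ring. }
  assert (c0 : Rabs (c - c) < r) by (rewrite Rminus_diag, Rabs_R0; exact Hr).
  split; [exact Hr|]. split; [|split; [exact H|]].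
  - rewrite (is_derive_unique _ _ _ (D c c0)), Rminus_diag, PSeries_0.
    unfold PS_derive. simpl. ring.
  - intros x Hx. split.
    + eexists; exact (D x Hx).
    + rewrite (is_derive_unique _ _ _ (D x Hx)).
      apply PSeries_correct, CV_radius_inside.
      rewrite CV_radius_derive. now apply CV.
Qed.

Lemma analytic_at_Derive phi c : analytic_at phi c -> analytic_at (Derive phi) c.
Proof.
  intros H. destruct (analytic_at_expand phi c H) as [a [r [Hr [_ [_ D]]]]].
  exists (PS_derive a), r. split; [exact Hr|]. intros x Hx. now apply D.
Qed.

Lemma analytic_at_ex_derive phi c : analytic_at phi c -> ex_derive phi c.
Proof.
  intros H. destruct (analytic_at_expand phi c H) as [a [r [Hr [_ [_ D]]]]].
  apply D. rewrite Rminus_diag, Rabs_R0; exact Hr.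
Qed.

Lemma real_analytic_Derive f : real_analytic f -> real_analytic (Derive f).
Proof. intros H x. exact (analytic_at_Derive f x (H x)). Qed.

Lemma An_analytic_at x0 r rho u : 0 < r -> An x0 r rho u -> analytic_at u x0.
Proof.
  intros Hr [a [_ H]]. exists a, r. split; [exact Hr|].
  intros x Hx. apply is_pseries_R, H. lra.
Qed.

Lemma analytic_at_inv c : c <> 0 -> analytic_at Rinv c.
Proof.
  intros Hc. exists (fun n => / c * (- / c) ^ n), (Rabs c).
  split; [now apply Rabs_pos_lt|].
  intros x Hx. apply is_pseries_R.
  apply is_series_Rext with (fun n => / c * (- (x - c) / c) ^ n).
  - intros n. rewrite Rmult_assoc, <- Rpow_mult_distr. do 2 f_equal. field. exact Hc.
  - assert (x <> 0).
    { intros ->. rewrite Rminus_0_l, Rabs_Ropp in Hx. lra. }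
    replace (/ x) with (/ c * / (1 - (- (x - c) / c))).
    + apply is_series_Rscal, is_series_geom.
      unfold Rdiv. rewrite Rabs_mult, Rabs_Ropp, Rabs_inv.
      apply Rmult_lt_reg_r with (Rabs c). now apply Rabs_pos_lt.
      rewrite Rmult_assoc, Rinv_l by now apply Rabs_no_R0. lra.
    + replace (1 - - (x - c) / c) with (x / c) by (field; exact Hc).
      field. now split.
Qed.

Lemma INR_le_pow2 n : INR n <= 2 ^ n.
Proof.
  induction n as [|n IH]; [simpl; lra|]. rewrite S_INR. simpl.
  assert (1 <= 2 ^ n) by (apply pow_R1_Rle; lra). lra.
Qed.

(* The power series of the derivative at [rho] with absolute values taken
   tends to [|phi' c|] as [rho -> 0]. *)
Lemma majorant_small (a : nat -> R) (R1 M : R) (eps : R) :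
  0 < R1 -> 0 < eps -> (forall n, Rabs (a n * R1 ^ n) <= M) ->
  exists rho, 0 < rho /\ rho <= R1 /\ forall N,
    sum_n (fun k => Rabs (a k) * (INR k * rho ^ pred k)) N <= Rabs (a 1%nat) + eps.
Proof.
  intros HR He HM.
  assert (M0 : 0 <= M) by (eapply Rle_trans; [apply Rabs_pos | apply (HM 0%nat)]).
  set (B := M / R1 + 1).
  assert (B0 : 0 < B).
  { unfold B, Rdiv. assert (0 <= M * / R1).
    { apply Rmult_le_pos; auto. left; now apply Rinv_0_lt_compat. } lra. }
  (* At most 1/4, so that after [INR n <= 2 ^ n] the terms still decay like powers of 1/2, and so
     small that they add up to at most [eps / 2]. *)
  set (th := Rmin (/ 4) (eps / (16 * B))).
  assert (T0 : 0 < th).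
  { unfold th. apply Rmin_glb_lt; [lra|]. apply Rdiv_lt_0_compat; lra. }
  assert (T1 : th <= / 4) by apply Rmin_l.
  assert (T2 : 16 * B * th <= eps).
  { assert (H := Rmin_r (/ 4) (eps / (16 * B))). fold th in H.
    apply (Rmult_le_compat_l (16 * B)) in H; [|lra].
    replace (16 * B * (eps / (16 * B))) with eps in H by (field; lra). exact H. }
  exists (th * R1).
  assert (P0 : 0 < th * R1) by (apply Rmult_lt_0_compat; lra).
  split; [exact P0|]. split.
  { rewrite <- (Rmult_1_l R1) at 2. apply Rmult_le_compat_r; lra. }
  assert (term : forall k, Rabs (a (S (S k))) * (INR (S (S k)) * (th * R1) ^ S k)
            <= 4 * B * th * (/ 2) ^ k).
  { intros k.
    apply Rle_trans with (B * (INR (S (S k)) * th ^ S k)).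
    - specialize (HM (S (S k))). rewrite Rabs_mult in HM.
      rewrite (Rabs_pos_eq (R1 ^ _)) in HM by (apply pow_le; lra).
      rewrite Rpow_mult_distr.
      replace (Rabs (a (S (S k))) * (INR (S (S k)) * (th ^ S k * R1 ^ S k)))
        with ((Rabs (a (S (S k))) * R1 ^ S (S k)) / R1 * (INR (S (S k)) * th ^ S k)).
      2: { change (R1 ^ S (S k)) with (R1 * R1 ^ S k). field. lra. }
      apply Rmult_le_compat_r.
      + apply Rmult_le_pos; [apply pos_INR | apply pow_le; lra].
      + unfold B. apply Rle_trans with (M / R1); [|lra].
        apply Rmult_le_compat_r; [|exact HM]. left; now apply Rinv_0_lt_compat.
    - rewrite (Rmult_comm 4 B), !Rmult_assoc. apply Rmult_le_compat_l; [lra|].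
      apply Rle_trans with (2 ^ S (S k) * (th * (/ 4) ^ k)).
      + apply Rmult_le_compat; [apply pos_INR | | apply INR_le_pow2 |].
        apply pow_le; lra.
        simpl. apply Rmult_le_compat_l; [lra|]. apply pow_incr; lra.
      + right. replace (/ 4) with (/ 2 * / 2) by lra. rewrite Rpow_mult_distr.
        simpl. assert (E : 2 ^ k * (/ 2) ^ k = 1).
        { rewrite <- Rpow_mult_distr, Rinv_r by lra. apply pow1. }
        replace (2 * (2 * 2 ^ k) * (th * ((/ 2) ^ k * (/ 2) ^ k)))
          with (4 * th * (/ 2) ^ k * (2 ^ k * (/ 2) ^ k)) by ring.
        rewrite E. ring. }
  assert (claim : forall N,
    sum_n (fun k => Rabs (a k) * (INR k * (th * R1) ^ pred k)) (S N)
      <= Rabs (a 1%nat) + 8 * B * th * (1 - (/ 2) ^ N)).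
  { induction N as [|N IH].
    - rewrite sum_n_RS, sum_n_R0. simpl. lra.
    - rewrite sum_n_RS. specialize (term N). simpl pred.
      simpl ((/ 2) ^ S N). simpl pred in IH. lra. }
  intros N. destruct N as [|N].
  - rewrite sum_n_R0. simpl. pose proof (Rabs_pos (a 1%nat)). lra.
  - eapply Rle_trans; [apply claim|].
    assert (0 < (/ 2) ^ N) by (apply pow_lt; lra).
    assert (0 < B * th) by (apply Rmult_lt_0_compat; lra).
    assert (0 <= 8 * B * th * (/ 2) ^ N).
    { apply Rmult_le_pos; [|lra]. lra. }
    lra.
Qed.

(** With [An_pow_lip] applied to each power of the expansion at [c], the constant is the sum of
    [Rabs (a k) * k * rho ^ (k - 1)], which for small [rho] is close to its first term. Passing from
    numbers to power series thus costs only [eps], and the contraction survives. *)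
Lemma An_comp_lip (phi : R -> R) (c eps : R) : analytic_at phi c -> 0 < eps ->
  exists rho, 0 < rho /\ forall x0 r d u v, 0 <= r ->
    An x0 r rho (fun x => u x - c) -> An x0 r rho (fun x => v x - c) ->
    An x0 r d (fun x => u x - v x) ->
    An x0 r ((Rabs (Derive phi c) + eps) * d) (fun x => phi (u x) - phi (v x)).
Proof.
  intros H He.
  destruct (analytic_at_expand phi c H) as [a [R0 [HR [A1 [Hphi _]]]]].
  assert (HR1 : Rabs (c + R0 / 2 - c) < R0).
  { replace (c + R0 / 2 - c) with (R0 / 2) by ring. rewrite Rabs_pos_eq; lra. }
  destruct (is_pseries_bounded _ _ _ (Hphi _ HR1)) as [M HM].
  replace (c + R0 / 2 - c) with (R0 / 2) in HM by ring.
  destruct (majorant_small a (R0 / 2) M eps) as [rho [P0 [P1 P2]]]; auto; [lra|].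
  exists rho. split; [exact P0|].
  intros x0 r d u v Hr Hu Hv Huv.
  assert (Hd := An_pos _ _ _ _ Huv).
  destruct (An_series x0 r (fun k => Rabs (a k) * (INR k * rho ^ pred k) * d)
     ((Rabs (Derive phi c) + eps) * d)
     (fun k x => a k * ((u x - c) ^ k - (v x - c) ^ k))) as [S1 S2]; auto.
  - intros k. rewrite Rmult_assoc. apply An_scal, An_pow_lip; auto.
    eapply An_ext; [|exact Huv]. intros; simpl; ring.
  - intros K. rewrite <- A1.
    rewrite (sum_n_Rext _ (fun k => d * (Rabs (a k) * (INR k * rho ^ pred k))))
      by (intros; ring).
    rewrite sum_n_Rscal, (Rmult_comm _ d). apply Rmult_le_compat_l; auto.
  - eapply An_ext; [|exact S2]. intros x Hx. simpl.
    assert (B : forall w, An x0 r rho (fun x => w x - c) ->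
       is_series (fun k => a k * (w x - c) ^ k) (phi (w x))).
    { intros w Hw. apply is_pseries_R, Hphi.
      eapply Rle_lt_trans; [exact (An_bound _ _ _ _ _ Hw Hx)|]. lra. }
    apply is_series_unique.
    replace (phi (u x) - phi (v x)) with (phi (u x) + -1 * phi (v x)) by ring.
    eapply is_series_Rext;
      [|exact (is_series_Rplus _ _ _ _ (B u Hu) (is_series_Rscal (-1) _ _ (B v Hv)))].
    intros k; simpl; ring.
Qed.

Lemma analytic_at_continuous phi c : analytic_at phi c -> continuous phi c.
Proof. intros H. apply (ex_derive_continuous phi), analytic_at_ex_derive, H. Qed.

Lemma continuous_eps (phi : R -> R) c eps : continuous phi c -> 0 < eps ->
  exists r, 0 < r /\ forall x, Rabs (x - c) < r -> Rabs (phi x - phi c) < eps.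
Proof.
  intros H Hc.
  destruct (proj1 (filterlim_locally phi (phi c)) H (mkposreal _ Hc)) as [r Hr].
  exists r. split; [apply r|]. intros x Hx. exact (Hr x Hx).
Qed.

(** * Zeros of analytic functions *)

Lemma CV_radius_decr_n (a : nat -> R) k : CV_radius (PS_decr_n a k) = CV_radius a.
Proof.
  induction k as [|k IH]; [now apply CV_radius_ext|].
  rewrite <- IH, <- (CV_radius_decr_1 (PS_decr_n a k)). apply CV_radius_ext.
  intros n. unfold PS_decr_1, PS_decr_n. f_equal. lia.
Qed.

(** If some coefficient is nonzero, the power of [x - c] of the first such coefficient factors out
    and leaves a series that is continuous and nonzero at [c]. *)
Lemma analytic_isolated_zeros phi c : analytic_at phi c ->
  (exists r, 0 < r /\ forall x, Rabs (x - c) < r -> phi x = 0) \/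
  (exists r, 0 < r /\ forall x, 0 < Rabs (x - c) < r -> phi x <> 0).
Proof.
  intros [a [r [Hr H]]].
  destruct (classic (forall n, a n = 0)) as [Z|NZ].
  - left. exists r. split; [exact Hr|]. intros x Hx.
    rewrite <- (is_pseries_unique _ _ _ (H x Hx)).
    rewrite <- (PSeries_const_0 (x - c)). now apply PSeries_ext.
  - right.
    assert (Hk : exists k, a k <> 0 /\ forall n, (n < k)%nat -> a n = 0).
    { apply not_all_ex_not in NZ. destruct NZ as [m Hm].
      induction m as [m IH] using (well_founded_ind lt_wf).
      destruct (classic (exists n, (n < m)%nat /\ a n <> 0)) as [[n [N1 N2]]|N].
      - exact (IH n N1 N2).
      - exists m. split; [exact Hm|]. intros n Hn. apply NNPP. intros E.
        apply N. now exists n. }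
    destruct Hk as [k [Hk1 Hk2]].
    assert (CV : forall y, Rabs y < r -> Rbar_lt (Rabs y) (CV_radius a)).
    { apply (is_pseries_CV_radius a (fun y => phi (y + c))).
      intros y Hy. assert (E : y = (y + c) - c) by ring.
      rewrite E at 1. apply H. now rewrite <- E. }
    set (b := PS_decr_n a k).
    assert (Cb : continuous (PSeries b) 0).
    { apply continuity_pt_filterlim, PSeries_continuity.
      unfold b. rewrite CV_radius_decr_n. apply CV. now rewrite Rabs_R0. }
    assert (b0 : PSeries b 0 = a k).
    { rewrite PSeries_0. unfold b, PS_decr_n. f_equal. lia. }
    destruct (continuous_eps _ _ (Rabs (a k)) Cb) as [r1 [p1 H1]];
      [now apply Rabs_pos_lt|].
    exists (Rmin r r1). split; [now apply Rmin_glb_lt|].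
    intros x [Hx1 Hx2] E.
    assert (Hx : Rabs (x - c) < r) by (eapply Rlt_le_trans; [exact Hx2|apply Rmin_l]).
    assert (Hx' : Rabs (x - c) < r1) by (eapply Rlt_le_trans; [exact Hx2|apply Rmin_r]).
    rewrite <- (is_pseries_unique _ _ _ (H x Hx)) in E.
    rewrite (PSeries_decr_n_aux a k (x - c) Hk2) in E.
    apply Rmult_integral in E. destruct E as [E|E].
    + revert E. apply pow_nonzero. intros E. rewrite E, Rabs_R0 in Hx1. lra.
    + specialize (H1 (x - c)). fold b in E. rewrite Rminus_0_r, E, b0 in H1.
      specialize (H1 Hx'). rewrite Rminus_0_l, Rabs_Ropp in H1. lra.
Qed.

(* Cousin's lemma. *)
Lemma interval_induction (J : R -> R -> Prop) (a b : R) : a <= b ->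
  (forall x y z, x <= y <= z -> J x y -> J y z -> J x z) ->
  (forall x, a <= x <= b -> exists d, 0 < d /\
     forall u v, x - d < u <= x -> x <= v < x + d -> J u v) -> J a b.
Proof.
  intros Hab tr loc.
  destruct (completeness (fun y => a <= y <= b /\ J a y)) as [s [S1 S2]].
  - exists b. intros y [Hy _]. lra.
  - exists a. split; [lra|]. destruct (loc a) as [d [d0 Hd]]; [lra|]. apply Hd; lra.
  - assert (as_ : a <= s).
    { apply S1. split; [lra|]. destruct (loc a) as [d [d0 Hd]]; [lra|]. apply Hd; lra. }
    assert (sb : s <= b) by (apply S2; intros y [Hy _]; lra).
    destruct (loc s) as [d [d0 Hd]]; [lra|].
    assert (Hy : exists y, s - d < y /\ a <= y <= b /\ J a y).
    { apply NNPP. intros N. assert (s <= s - d); [|lra]. apply S2.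
      intros y Hy. apply Rnot_lt_le. intros L. apply N. now exists y. }
    destruct Hy as [y [Y1 [Y2 Y3]]].
    assert (ys : y <= s) by (apply S1; now split).
    destruct (Rle_lt_or_eq_dec _ _ sb) as [L|E].
    + exfalso. set (v := Rmin b (s + d / 2)).
      assert (v1 : v <= b) by apply Rmin_l.
      assert (v2 : v <= s + d / 2) by apply Rmin_r.
      assert (v3 : s < v) by (apply Rmin_glb_lt; lra).
      assert (v <= s); [|lra]. apply S1. split; [lra|].
      apply (tr a y v); [lra | exact Y3 | apply Hd; lra].
    + subst b. apply (tr a y s); [lra | exact Y3 | apply Hd; lra].
Qed.

(** The set [Z] of points around which [phi] vanishes is open and closed: membership is locally
    constant, hence constant along every interval. *)
Lemma analytic_zeros_dichotomy phi : real_analytic phi ->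
  (forall x, phi x = 0) \/
  (forall c, exists r, 0 < r /\ forall x, 0 < Rabs (x - c) < r -> phi x <> 0).
Proof.
  intros H.
  set (Z := fun c => exists r, 0 < r /\ forall x, Rabs (x - c) < r -> phi x = 0).
  destruct (classic (exists c, Z c)) as [[c Hc]|N].
  - left.
    assert (loc : forall x, exists d, 0 < d /\ forall y, Rabs (y - x) < d -> (Z y <-> Z x)).
    { intros x. destruct (analytic_isolated_zeros phi x (H x)) as [[r [r0 Hr]]|[r [r0 Hr]]].
      - exists r. split; [exact r0|]. intros y Hy. split; intros _.
        + now exists r.
        + exists (r - Rabs (y - x)). split; [lra|]. intros z Hz. apply Hr.
          replace (z - x) with ((z - y) + (y - x)) by ring.
          eapply Rle_lt_trans; [apply Rabs_triang|]. lra.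
      - exists r. split; [exact r0|]. intros y Hy.
        assert (nz : forall z, Rabs (z - x) < r -> ~ Z z).
        { intros z Hz [s [s0 Hs]].
          set (m := Rmin s (r - Rabs (z - x))).
          assert (m0 : 0 < m) by (apply Rmin_glb_lt; lra).
          assert (m1 : m <= s) by apply Rmin_l.
          assert (m2 : m <= r - Rabs (z - x)) by apply Rmin_r.
          (* [z] may be the excluded centre [x], hence a point [w] close to [z] and different from
             [x]. *)
          assert (A : exists w, Rabs (w - z) < m /\ w <> x).
          { destruct (Req_dec z x) as [->|Hn].
            - exists (x + m / 2). split; [|lra].
              replace (x + m / 2 - x) with (m / 2) by ring. rewrite Rabs_pos_eq; lra.
            - exists z. split; [|exact Hn]. rewrite Rminus_diag, Rabs_R0. exact m0. }
          destruct A as [w [W1 W2]]. apply (Hr w).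
          - split; [apply Rabs_pos_lt; lra|].
            replace (w - x) with ((w - z) + (z - x)) by ring.
            eapply Rle_lt_trans; [apply Rabs_triang|]. lra.
          - apply Hs. lra. }
        assert (n1 := nz y Hy).
        assert (n2 := nz x). rewrite Rminus_diag, Rabs_R0 in n2. tauto. }
    assert (con : forall u v, u <= v -> (Z u <-> Z v)).
    { intros u v Huv. apply (interval_induction (fun u v => Z u <-> Z v)); auto.
      - intros; tauto.
      - intros x _. destruct (loc x) as [d [d0 Hd]]. exists d. split; [exact d0|].
        intros w w' Hw Hw'. rewrite (Hd w), (Hd w'); [tauto | |].
        + rewrite Rabs_pos_eq; lra.
        + rewrite Rabs_left1; lra. }
    intros x. assert (Zx : Z x).
    { destruct (Rle_dec c x); [now apply (con c x)|]. apply (con x c); auto. lra. }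
    destruct Zx as [r [r0 Hr]]. apply Hr. now rewrite Rminus_diag, Rabs_R0.
  - right. intros c. destruct (analytic_isolated_zeros phi c (H c)) as [Y|Y]; auto.
    exfalso. apply N. now exists c.
Qed.

(** Compactness by Cousin's lemma: a short interval around any point contains no zero except
    possibly that point. *)
Lemma isolated_zeros_finite phi a b : a <= b ->
  (forall c, exists r, 0 < r /\ forall x, 0 < Rabs (x - c) < r -> phi x <> 0) ->
  exists l : list R, forall x, a <= x <= b -> phi x = 0 -> In x l.
Proof.
  intros Hab H.
  apply (interval_induction
    (fun u v => exists l : list R, forall x, u <= x <= v -> phi x = 0 -> In x l)); auto.
  - intros x y z Hxyz [l1 H1] [l2 H2]. exists (l1 ++ l2)%list.
    intros w Hw E. apply in_or_app.
    destruct (Rle_dec w y); [left; apply H1 | right; apply H2]; auto; lra.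
  - intros x _. destruct (H x) as [r [r0 Hr]]. exists r. split; [exact r0|].
    intros u v Hu Hv. exists (x :: nil). intros w Hw E. left.
    apply NNPP. intros Hn. apply (Hr w); auto. split; [apply Rabs_pos_lt; lra|].
    apply Rabs_def1; lra.
Qed.

(** * Periodic functions *)

Lemma periodic_IZR (phi : R -> R) : periodic1 phi ->
  forall (m : Z) t, phi (t + IZR m) = phi t.
Proof.
  intros H.
  assert (N : forall (n : nat) t, phi (t + INR n) = phi t).
  { induction n as [|n IH]; intros t; [now rewrite Rplus_0_r|].
    rewrite S_INR, <- Rplus_assoc, H. apply IH. }
  intros m t. destruct (Z_le_gt_dec 0 m).
  - rewrite <- (Z2Nat.id m), <- INR_IZR_INZ by lia. apply N.
  - rewrite <- (N (Z.to_nat (- m)) (t + IZR m)), INR_IZR_INZ, Z2Nat.id by lia.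
    rewrite Rplus_assoc, <- plus_IZR, Z.add_opp_diag_r. f_equal. simpl. ring.
Qed.

Lemma fractional (x : R) : exists m : Z, 0 <= x + IZR m < 1.
Proof.
  exists (- Int_part x)%Z. rewrite opp_IZR.
  destruct (base_Int_part x). lra.
Qed.

Lemma periodic_bounded (phi : R -> R) : periodic1 phi -> (forall x, continuous phi x) ->
  exists M, forall x, Rabs (phi x) <= M.
Proof.
  intros H C.
  destruct (continuity_ab_maj (fun x => Rabs (phi x)) 0 1) as [m [Hm _]]; [lra| |].
  - intros x _. apply continuity_pt_filterlim.
    apply (continuous_comp phi Rabs); [apply C | apply continuous_Rabs].
  - exists (Rabs (phi m)). intros x. destruct (fractional x) as [k Hk].
    rewrite <- (periodic_IZR phi H k x). apply Hm. lra.
Qed.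

Lemma periodic_Derive (phi : R -> R) : periodic1 phi -> periodic1 (Derive phi).
Proof.
  intros H t. rewrite <- (Derive_ext _ _ t H).
  unfold Derive. f_equal. apply Lim_ext. intros h.
  do 3 f_equal; ring.
Qed.

(* Sums over [nat] live in [R_AbelianMonoid], which [ring] does not recognize. *)
Ltac as_R := match goal with |- @eq _ ?a ?b => change (@eq R a b) end.

(* Substitution into [N] is [K]-Lipschitz for the norm of [An], on the ball of
   radius [rho] about the constants [c1, c2]. *)
Definition lip_on (N : R -> R -> R) (c1 c2 K rho : R) : Prop :=
  forall x0 r d u1 u2 v1 v2, 0 <= r ->
    An x0 r rho (fun x => u1 x - c1) -> An x0 r rho (fun x => u2 x - c2) ->
    An x0 r rho (fun x => v1 x - c1) -> An x0 r rho (fun x => v2 x - c2) ->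
    An x0 r d (fun x => u1 x - v1 x) -> An x0 r d (fun x => u2 x - v2 x) ->
    An x0 r (K * d) (fun x => N (u1 x) (u2 x) - N (v1 x) (v2 x)).

(** Only the constant is tracked. The radius shrinks with every sum, product or composition and its
    value does not matter, so it is hidden. *)
Definition lip_at (N : R -> R -> R) (c1 c2 K : R) : Prop :=
  exists rho, 0 < rho /\ lip_on N c1 c2 K rho.

Lemma lip_on_le N c1 c2 K rho rho' : rho' <= rho ->
  lip_on N c1 c2 K rho -> lip_on N c1 c2 K rho'.
Proof.
  intros Hr H x0 r d u1 u2 v1 v2 H0 A1 A2 A3 A4 A5 A6.
  apply H; auto; eapply An_le; eauto.
Qed.

Lemma An_zero x0 r rho c : 0 <= r -> 0 <= rho -> An x0 r rho (fun _ => c - c).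
Proof.
  intros Hr Hrho. eapply An_ext; [|eapply An_le; [|exact (An_const x0 r 0 Hr)]].
  intros; simpl; ring. now rewrite Rabs_R0.
Qed.

Lemma lip_at_fst c1 c2 : lip_at (fun a _ => a) c1 c2 1.
Proof.
  exists 1. split; [lra|]. intros x0 r d u1 u2 v1 v2. now rewrite Rmult_1_l.
Qed.

Lemma lip_at_snd c1 c2 : lip_at (fun _ b => b) c1 c2 1.
Proof.
  exists 1. split; [lra|]. intros x0 r d u1 u2 v1 v2. now rewrite Rmult_1_l.
Qed.

Lemma lip_at_le N c1 c2 K K' : K <= K' -> lip_at N c1 c2 K -> lip_at N c1 c2 K'.
Proof.
  intros HK [rho [P H]]. exists rho. split; [exact P|].
  intros x0 r d u1 u2 v1 v2 Hr A1 A2 A3 A4 A5 A6.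
  assert (Hd := An_pos _ _ _ _ A5).
  eapply An_le; [|apply (H x0 r d u1 u2 v1 v2); assumption]. now apply Rmult_le_compat_r.
Qed.

Lemma lip_at_plus N1 N2 c1 c2 K1 K2 :
  lip_at N1 c1 c2 K1 -> lip_at N2 c1 c2 K2 ->
  lip_at (fun a b => N1 a b + N2 a b) c1 c2 (K1 + K2).
Proof.
  intros [r1 [P1 H1]] [r2 [P2 H2]]. exists (Rmin r1 r2).
  split; [now apply Rmin_glb_lt|].
  pose proof (Rmin_l r1 r2). pose proof (Rmin_r r1 r2).
  intros x0 r d u1 u2 v1 v2 Hr A1 A2 A3 A4 A5 A6.
  eapply An_le; [|eapply An_ext; [|apply An_plus;
    [apply (H1 x0 r d u1 u2 v1 v2) | apply (H2 x0 r d u1 u2 v1 v2)]]];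
    auto; try (eapply An_le; [|eassumption]; assumption).
  - lra.
  - intros; simpl; ring.
Qed.

Lemma lip_at_scal N c1 c2 K s :
  lip_at N c1 c2 K -> lip_at (fun a b => s * N a b) c1 c2 (Rabs s * K).
Proof.
  intros [rho [P H]]. exists rho. split; [exact P|].
  intros x0 r d u1 u2 v1 v2 Hr A1 A2 A3 A4 A5 A6.
  rewrite Rmult_assoc.
  eapply An_ext; [|apply An_scal, (H x0 r d u1 u2 v1 v2); auto].
  intros; simpl; ring.
Qed.

Lemma lip_at_minus N1 N2 c1 c2 K1 K2 :
  lip_at N1 c1 c2 K1 -> lip_at N2 c1 c2 K2 ->
  lip_at (fun a b => N1 a b - N2 a b) c1 c2 (K1 + K2).
Proof.
  intros H1 H2. apply (lip_at_scal _ _ _ _ (-1)) in H2.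
  replace (Rabs (-1) * K2) with K2 in H2 by (rewrite Rabs_left; lra).
  destruct (lip_at_plus _ _ _ _ _ _ H1 H2) as [rho [P H]].
  exists rho. split; [exact P|].
  intros x0 r d u1 u2 v1 v2 Hr A1 A2 A3 A4 A5 A6. eapply An_ext; [|eapply (H x0 r d u1 u2 v1 v2); eauto].
  intros; simpl; ring.
Qed.

(** Comparison with the constants [c1], [c2]: on a smaller ball the values of [N] stay in any
    prescribed ball around [N c1 c2], as the next composition requires. *)
Lemma lip_at_near N c1 c2 K eps : 0 <= K -> 0 < eps -> lip_at N c1 c2 K ->
  exists rho, 0 < rho /\ (forall x0 r u1 u2, 0 <= r ->
    An x0 r rho (fun x => u1 x - c1) -> An x0 r rho (fun x => u2 x - c2) ->
    An x0 r eps (fun x => N (u1 x) (u2 x) - N c1 c2)) /\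
    lip_on N c1 c2 K rho.
Proof.
  intros HK He [rho [P H]].
  assert (Q : 0 < eps / (K + 1)) by (apply Rdiv_lt_0_compat; lra).
  exists (Rmin rho (eps / (K + 1))).
  pose proof (Rmin_l rho (eps / (K + 1))) as L1.
  pose proof (Rmin_r rho (eps / (K + 1))) as L2.
  set (m := Rmin rho (eps / (K + 1))) in *.
  assert (m0 : 0 < m) by now apply Rmin_glb_lt.
  split; [exact m0|]. split.
  - intros x0 r u1 u2 Hr A1 A2.
    eapply An_le; [|apply (H x0 r m u1 u2 (fun _ => c1) (fun _ => c2)); auto;
      try (apply An_zero; lra); eapply An_le; eauto].
    apply Rle_trans with ((K + 1) * (eps / (K + 1))).
    + apply Rmult_le_compat; lra.
    + right. field. lra.
  - now apply (lip_on_le _ _ _ _ rho).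
Qed.

Lemma lip_at_comp phi N c1 c2 K Lp : 0 <= K -> lip_at N c1 c2 K ->
  analytic_at phi (N c1 c2) -> Rabs (Derive phi (N c1 c2)) < Lp ->
  lip_at (fun a b => phi (N a b)) c1 c2 (Lp * K).
Proof.
  intros HK HN Hphi HL.
  destruct (An_comp_lip phi (N c1 c2) (Lp - Rabs (Derive phi (N c1 c2))) Hphi)
    as [rho [P H]]; [lra|].
  destruct (lip_at_near N c1 c2 K rho HK P HN) as [m [m0 [H1 H2]]].
  exists m. split; [exact m0|].
  intros x0 r d u1 u2 v1 v2 Hr A1 A2 A3 A4 A5 A6.
  rewrite Rmult_assoc.
  replace Lp with (Rabs (Derive phi (N c1 c2)) + (Lp - Rabs (Derive phi (N c1 c2))))
    by ring.
  apply (H x0 r (K * d) (fun x => N (u1 x) (u2 x)) (fun x => N (v1 x) (v2 x))); auto.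
Qed.

Lemma An_shift x0 r eps u c : 0 <= r ->
  An x0 r eps (fun x => u x - c) -> An x0 r (eps + Rabs c) u.
Proof.
  intros Hr H. eapply An_ext; [|exact (An_plus _ _ _ _ _ _ H (An_const x0 r c Hr))].
  intros; simpl; ring.
Qed.

(** Strictness of the bounds [B1] and [B2] leaves room for the variation of the factors on a small
    ball, so their values at the centre suffice for the product rule. *)
Lemma lip_at_mult N1 N2 c1 c2 K1 K2 B1 B2 : 0 <= K1 -> 0 <= K2 ->
  lip_at N1 c1 c2 K1 -> lip_at N2 c1 c2 K2 ->
  Rabs (N1 c1 c2) < B1 -> Rabs (N2 c1 c2) < B2 ->
  lip_at (fun a b => N1 a b * N2 a b) c1 c2 (K1 * B2 + B1 * K2).
Proof.
  intros HK1 HK2 L1 L2 HB1 HB2.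
  destruct (lip_at_near N1 c1 c2 K1 (B1 - Rabs (N1 c1 c2)) HK1) as [m1 [P1 [S1 H1]]];
    [lra|auto|].
  destruct (lip_at_near N2 c1 c2 K2 (B2 - Rabs (N2 c1 c2)) HK2) as [m2 [P2 [S2 H2]]];
    [lra|auto|].
  exists (Rmin m1 m2). split; [now apply Rmin_glb_lt|].
  pose proof (Rmin_l m1 m2). pose proof (Rmin_r m1 m2).
  intros x0 r d u1 u2 v1 v2 Hr A1 A2 A3 A4 A5 A6.
  assert (w : forall u, An x0 r (Rmin m1 m2) u -> An x0 r m1 u /\ An x0 r m2 u).
  { intros u Hu; split; eapply An_le; eauto. }
  destruct (w _ A1), (w _ A2), (w _ A3), (w _ A4).
  assert (X1 := S1 x0 r v1 v2 Hr ltac:(auto) ltac:(auto)).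
  assert (X2 := S2 x0 r u1 u2 Hr ltac:(auto) ltac:(auto)).
  apply An_shift in X1; auto. apply An_shift in X2; auto.
  assert (Y1 := H1 x0 r d u1 u2 v1 v2 Hr ltac:(auto) ltac:(auto) ltac:(auto) ltac:(auto) A5 A6).
  assert (Y2 := H2 x0 r d u1 u2 v1 v2 Hr ltac:(auto) ltac:(auto) ltac:(auto) ltac:(auto) A5 A6).
  eapply An_le; [|eapply An_ext; [|apply An_plus;
    [exact (An_mult _ _ _ _ _ _ Hr Y1 X2)|exact (An_mult _ _ _ _ _ _ Hr X1 Y2)]]].
  - right. ring.
  - intros; simpl; ring.
Qed.

Lemma lip_at_analytic N c1 c2 K u1 u2 x0 : 0 <= K -> lip_at N c1 c2 K ->
  (forall rho, 0 < rho -> exists r, 0 < r /\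
     An x0 r rho (fun x => u1 x - c1) /\ An x0 r rho (fun x => u2 x - c2)) ->
  exists r rho, 0 < r /\ An x0 r rho (fun x => N (u1 x) (u2 x)).
Proof.
  intros HK HN Hu.
  destruct (lip_at_near N c1 c2 K 1 HK Rlt_0_1 HN) as [rho [P [H _]]].
  destruct (Hu rho P) as [r [Hr [A1 A2]]].
  exists r, (1 + Rabs (N c1 c2)). split; [exact Hr|].
  apply (An_shift x0 r 1 (fun x => N (u1 x) (u2 x))); [lra|]. apply H; auto; lra.
Qed.

Lemma analytic_at_ext phi psi c : (forall x, phi x = psi x) ->
  analytic_at phi c -> analytic_at psi c.
Proof.
  intros E [a [r [r0 H]]]. exists a, r. split; [exact r0|].
  intros x Hx. rewrite <- E. now apply H.
Qed.

Lemma analytic_at_comb phi psi s c : analytic_at phi c -> analytic_at psi c ->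
  analytic_at (fun x => phi x + s * psi x) c.
Proof.
  intros [a [r [r0 H]]] [b [r' [r0' H']]].
  exists (fun n => a n + s * b n), (Rmin r r'). split; [now apply Rmin_glb_lt|].
  intros x Hx. apply is_pseries_R.
  assert (H1 := proj1 (is_pseries_R _ _ _) (H x (Rlt_le_trans _ _ _ Hx (Rmin_l _ _)))).
  assert (H2 := proj1 (is_pseries_R _ _ _) (H' x (Rlt_le_trans _ _ _ Hx (Rmin_r _ _)))).
  eapply is_series_Rext; [|exact (is_series_Rplus _ _ _ _ H1 (is_series_Rscal s _ _ H2))].
  intros n; simpl; ring.
Qed.

Lemma analytic_at_scal phi s c : analytic_at phi c -> analytic_at (fun x => s * phi x) c.
Proof.
  intros H. refine (analytic_at_ext _ _ _ _ (analytic_at_comb _ _ (s - 1) _ H H)).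
  intros x. ring.
Qed.

Lemma analytic_at_mult phi psi c : analytic_at phi c -> analytic_at psi c ->
  analytic_at (fun x => phi x * psi x) c.
Proof.
  assert (lip : forall h, analytic_at h c ->
    lip_at (fun a _ => h a) c c ((Rabs (Derive h c) + 1) * 1)).
  { intros h Hh. apply (lip_at_comp h (fun a _ => a)); auto using lip_at_fst; lra. }
  intros H1 H2.
  pose proof (Rabs_pos (Derive phi c)). pose proof (Rabs_pos (Derive psi c)).
  pose proof (Rabs_pos (phi c)). pose proof (Rabs_pos (psi c)).
  (* A function of one variable is viewed as one of two with an idle second slot, so that the
     product rule for [lip_at] applies. *)
  assert (L : lip_at (fun a _ => phi a * psi a) c c
    ((Rabs (Derive phi c) + 1) * 1 * (Rabs (psi c) + 1)
     + (Rabs (phi c) + 1) * ((Rabs (Derive psi c) + 1) * 1))).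
  { apply (lip_at_mult (fun a _ => phi a) (fun a _ => psi a)); auto; lra. }
  apply (lip_at_analytic _ _ _ _ (fun x => x) (fun x => x) c) in L.
  - destruct L as [r [rho [r0 A]]]. exact (An_analytic_at c r rho _ r0 A).
  - apply Rplus_le_le_0_compat; apply Rmult_le_pos; lra.
  - intros rho rho0. exists rho. split; [exact rho0|].
    assert (A : An c rho rho (fun x => x - c)); [|now split].
    eapply An_ext; [|eapply An_le; [|exact (An_affine c rho 0 1 (Rlt_le _ _ rho0))]].
    + intros; simpl; ring.
    + rewrite Rabs_R0, Rabs_R1. lra.
Qed.

(** * The discrete Dirichlet problem *)

Fixpoint sum1 (phi : nat -> R) (n : nat) : R :=
  match n with O => 0 | S m => sum1 phi m + phi (S m) end.

Fixpoint sum2 (phi : nat -> R) (n : nat) : R :=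
  match n with O => 0 | S m => sum2 phi m + sum1 phi m end.

(** The discrete Green operator with zero ends: [sum2 phi] has second difference [phi] and starts
    from zero with zero slope, and the linear term brings the value at [Q] back to zero. *)
Definition green (Q : nat) (phi : nat -> R) (n : nat) : R :=
  sum2 phi n - INR n / INR Q * sum2 phi Q.

Lemma green_0 Q phi : green Q phi 0 = 0.
Proof. unfold green. simpl. unfold Rdiv. ring. Qed.

Lemma green_end Q phi : (0 < Q)%nat -> green Q phi Q = 0.
Proof.
  intros HQ. unfold green. field. apply not_0_INR. lia.
Qed.

Lemma green_second_difference Q phi n :
  green Q phi (S (S n)) - 2 * green Q phi (S n) + green Q phi n = phi (S n).
Proof. unfold green. rewrite !S_INR. simpl. unfold Rdiv. ring. Qed.

Lemma sum1_ext phi psi n : (forall j, (0 < j <= n)%nat -> phi j = psi j) ->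
  sum1 phi n = sum1 psi n.
Proof.
  induction n as [|n IH]; intros H; simpl; [reflexivity|].
  rewrite IH, H; auto; [lia|]. intros; apply H; lia.
Qed.

Lemma sum2_ext phi psi n : (forall j, (0 < j < n)%nat -> phi j = psi j) ->
  sum2 phi n = sum2 psi n.
Proof.
  induction n as [|n IH]; intros H; simpl; [reflexivity|].
  rewrite IH, (sum1_ext phi psi); auto; intros; apply H; lia.
Qed.

Lemma green_ext Q phi psi n : (n <= Q)%nat ->
  (forall j, (0 < j < Q)%nat -> phi j = psi j) -> green Q phi n = green Q psi n.
Proof.
  intros Hn H. unfold green.
  rewrite (sum2_ext phi psi n), (sum2_ext phi psi Q); auto. intros; apply H; lia.
Qed.

Lemma sum1_minus phi psi n :
  sum1 phi n - sum1 psi n = sum1 (fun j => phi j - psi j) n.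
Proof. induction n as [|n IH]; simpl; [ring|]. rewrite <- IH. ring. Qed.

Lemma sum2_minus phi psi n :
  sum2 phi n - sum2 psi n = sum2 (fun j => phi j - psi j) n.
Proof.
  induction n as [|n IH]; simpl; [ring|]. rewrite <- IH, <- sum1_minus. ring.
Qed.

Lemma green_minus Q phi psi n :
  green Q phi n - green Q psi n = green Q (fun j => phi j - psi j) n.
Proof. unfold green. rewrite <- !sum2_minus. ring. Qed.

Lemma An_sums x0 r mu (Q : nat) (phi : nat -> R -> R) : 0 <= r -> 0 <= mu ->
  (forall j, (0 < j < Q)%nat -> An x0 r mu (phi j)) ->
  (forall n, (n < Q)%nat -> An x0 r (INR Q * mu) (fun x => sum1 (fun j => phi j x) n)) /\
  (forall n, (n <= Q)%nat ->
     An x0 r (INR n * (INR Q * mu)) (fun x => sum2 (fun j => phi j x) n)).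
Proof.
  intros Hr Hmu H.
  assert (zero : An x0 r 0 (fun _ => 0)).
  { rewrite <- Rabs_R0 at 1. now apply An_const. }
  assert (A1 : forall n, (n < Q)%nat -> An x0 r (INR n * mu) (fun x => sum1 (fun j => phi j x) n)).
  { induction n as [|n IH]; intros Hn; [now rewrite Rmult_0_l|].
    rewrite S_INR, Rmult_plus_distr_r, Rmult_1_l.
    simpl. apply An_plus; [apply IH; lia | apply H; lia]. }
  assert (A1' : forall n, (n < Q)%nat ->
     An x0 r (INR Q * mu) (fun x => sum1 (fun j => phi j x) n)).
  { intros n Hn. eapply An_le; [|now apply A1].
    apply Rmult_le_compat_r; [exact Hmu|]. apply le_INR. lia. }
  split; [exact A1'|].
  induction n as [|n IH]; intros Hn; [now rewrite Rmult_0_l|].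
  rewrite S_INR, Rmult_plus_distr_r, Rmult_1_l.
  simpl. apply An_plus; [apply IH; lia | apply A1'; lia].
Qed.

(** The constant is crude: each of the two summations has at most [Q] terms, and the linear
    correction doubles the bound. *)
Lemma An_green x0 r mu (Q : nat) (phi : nat -> R -> R) : 0 <= r -> (0 < Q)%nat ->
  0 <= mu -> (forall j, (0 < j < Q)%nat -> An x0 r mu (phi j)) ->
  forall n, (n <= Q)%nat ->
    An x0 r (2 * INR Q ^ 2 * mu) (fun x => green Q (fun j => phi j x) n).
Proof.
  intros Hr HQ Hmu H n Hn.
  destruct (An_sums x0 r mu Q phi Hr Hmu H) as [_ A2].
  assert (HQ' : 1 <= INR Q) by now apply INR_ge_1.
  assert (Hn' : INR n <= INR Q) by now apply le_INR.
  pose proof (pos_INR n) as Pn.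
  assert (Q2 : 0 <= INR n / INR Q <= 1) by now apply INR_ratio.
  assert (mQ : 0 <= INR Q * mu) by (apply Rmult_le_pos; lra).
  eapply An_le; [|unfold green; apply An_minus;
    [apply A2; exact Hn | apply An_scal, A2; lia]].
  rewrite Rabs_pos_eq by lra.
  replace (2 * INR Q ^ 2 * mu) with (INR Q * (INR Q * mu) + 1 * (INR Q * (INR Q * mu)))
    by ring.
  apply Rplus_le_compat.
  - apply Rmult_le_compat_r; lra.
  - apply Rmult_le_compat_r; [|lra]. apply Rmult_le_pos; lra.
Qed.

Lemma green_bound (Q : nat) (phi : nat -> R) mu n : (0 < Q)%nat -> 0 <= mu ->
  (forall j, (0 < j < Q)%nat -> Rabs (phi j) <= mu) -> (n <= Q)%nat ->
  Rabs (green Q phi n) <= 2 * INR Q ^ 2 * mu.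
Proof.
  intros HQ Hmu H Hn.
  apply (An_r0 0 _ (fun _ => green Q phi n)).
  apply (An_green 0 0 mu Q (fun j _ => phi j)); auto; [lra|].
  intros j Hj. apply An_r0; auto.
Qed.

Lemma green_slope_bound (Q : nat) (phi : nat -> R) mu n : (0 < Q)%nat -> 0 <= mu ->
  (forall j, (0 < j < Q)%nat -> Rabs (phi j) <= mu) -> (n < Q)%nat ->
  Rabs (green Q phi (S n) - green Q phi n) <= 2 * INR Q * mu.
Proof.
  intros HQ Hmu H Hn.
  destruct (An_sums 0 0 mu Q (fun j _ => phi j)) as [B1 B2]; [lra | exact Hmu | |].
  { intros j Hj. now apply An_r0, H. }
  specialize (B1 n Hn). specialize (B2 Q (le_n Q)). apply An_r0 in B1, B2.
  change (Rabs (sum1 phi n) <= INR Q * mu) in B1.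
  change (Rabs (sum2 phi Q) <= INR Q * (INR Q * mu)) in B2.
  assert (HQ' : 1 <= INR Q) by now apply INR_ge_1.
  replace (green Q phi (S n) - green Q phi n) with
    (sum1 phi n - / INR Q * sum2 phi Q).
  2: { unfold green. rewrite S_INR. simpl. field. lra. }
  eapply Rle_trans; [apply Rabs_triang|]. rewrite Rabs_Ropp, Rabs_mult, Rabs_inv.
  rewrite (Rabs_pos_eq (INR Q)) by lra.
  assert (/ INR Q * Rabs (sum2 phi Q) <= INR Q * mu).
  { apply Rmult_le_reg_l with (INR Q); [lra|].
    rewrite <- Rmult_assoc, Rinv_r by lra. lra. }
  lra.
Qed.

Definition second_difference (d : nat -> R) (n : nat) : R :=
  d (S n) - 2 * d n + d (pred n).

Lemma green_repr (Q : nat) (d : nat -> R) n : (0 < Q)%nat ->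
  d n = d 0%nat + INR n / INR Q * (d Q - d 0%nat) + green Q (second_difference d) n.
Proof.
  intros HQ.
  assert (A1 : forall n, sum1 (second_difference d) n = (d (S n) - d n) - (d 1%nat - d 0%nat)).
  { intros m. induction m as [|m IH]; simpl; [ring|]. rewrite IH.
    unfold second_difference. simpl. ring. }
  assert (A2 : forall n, d n = d 0%nat + INR n * (d 1%nat - d 0%nat) + sum2 (second_difference d) n).
  { intros m. induction m as [|m IH]; [simpl; ring|].
    rewrite S_INR. simpl sum2. rewrite A1. lra. }
  unfold green. rewrite (A2 Q), (A2 n) at 1. field. apply not_0_INR. lia.
Qed.

Lemma finite_max (d : nat -> R) (Q : nat) :
  exists M, (forall n, (n <= Q)%nat -> Rabs (d n) <= M) /\
    exists n, (n <= Q)%nat /\ Rabs (d n) = M.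
Proof.
  induction Q as [|Q [M [H [n [Hn E]]]]].
  - exists (Rabs (d 0%nat)). split; [|now exists 0%nat].
    intros n Hn. replace n with 0%nat by lia. lra.
  - exists (Rmax M (Rabs (d (S Q)))). split.
    + intros m Hm. destruct (Nat.eq_dec m (S Q)) as [->|].
      apply Rmax_r. eapply Rle_trans; [apply H; lia | apply Rmax_l].
    + destruct (Rle_dec M (Rabs (d (S Q)))).
      * exists (S Q). split; [lia|]. now rewrite Rmax_right.
      * exists n. split; [lia|]. rewrite Rmax_left; auto. lra.
Qed.

(** As the Green operator has norm at most [2 * INR Q ^ 2], the maximum satisfies [M <= B + M / 4].
    The slope estimate matters most: when one end is fixed and the other moves by [B], the mean
    slope has size [B / INR Q], and every slope stays within half of that from it. Uniqueness of
    chains and their twist both come from here. *)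
Lemma nearly_affine (Q : nat) (d : nat -> R) (lam B : R) : (0 < Q)%nat -> 0 <= lam ->
  8 * INR Q ^ 2 * lam <= 1 ->
  Rabs (d 0%nat) <= B -> Rabs (d Q) <= B ->
  (forall M, (forall n, (n <= Q)%nat -> Rabs (d n) <= M) ->
     forall n, (0 < n < Q)%nat -> Rabs (second_difference d n) <= lam * M) ->
  (forall n, (n <= Q)%nat -> Rabs (d n) <= 2 * B) /\
  forall n, (n < Q)%nat ->
    Rabs (d (S n) - d n - (d Q - d 0%nat) / INR Q) <= B / (2 * INR Q).
Proof.
  intros HQ Hl HlQ H0 H1 Hd.
  assert (HQ' : 1 <= INR Q) by now apply INR_ge_1.
  destruct (finite_max d Q) as [M [HM [n0 [Hn0 E0]]]].
  assert (M0 : 0 <= M) by (rewrite <- E0; apply Rabs_pos).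
  assert (lM : 0 <= lam * M) by now apply Rmult_le_pos.
  specialize (Hd M HM).
  assert (MB : M <= 2 * B).
  { assert (G := green_bound Q _ (lam * M) n0 HQ lM Hd Hn0).
    assert (R := green_repr Q d n0 HQ).
    assert (Hn' : INR n0 <= INR Q) by now apply le_INR.
    pose proof (pos_INR n0) as Pn.
    assert (Q2 : 0 <= INR n0 / INR Q <= 1) by now apply INR_ratio.
    set (th := INR n0 / INR Q) in *.
    assert (X : Rabs (d 0%nat + th * (d Q - d 0%nat)) <= B).
    { replace (d 0%nat + th * (d Q - d 0%nat)) with ((1 - th) * d 0%nat + th * d Q) by ring.
      eapply Rle_trans; [apply Rabs_triang|]. rewrite !Rabs_mult.
      rewrite (Rabs_pos_eq (1 - th)), (Rabs_pos_eq th) by lra.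
      replace B with ((1 - th) * B + th * B) by ring.
      apply Rplus_le_compat; apply Rmult_le_compat_l; lra. }
    assert (Y : 8 * INR Q ^ 2 * lam * M <= 1 * M) by now apply Rmult_le_compat_r.
    assert (Z : M <= B + 2 * INR Q ^ 2 * (lam * M)).
    { rewrite <- E0 at 1. rewrite R.
      eapply Rle_trans; [apply Rabs_triang|]. lra. }
    lra. }
  split.
  - intros n Hn. specialize (HM n Hn). lra.
  - intros n Hn.
    assert (G := green_slope_bound Q _ (lam * M) n HQ lM Hd Hn).
    assert (R1 := green_repr Q d (S n) HQ). assert (R2 := green_repr Q d n HQ).
    rewrite S_INR in R1.
    replace ((INR n + 1) / INR Q * (d Q - d 0%nat)) with
      (INR n / INR Q * (d Q - d 0%nat) + (d Q - d 0%nat) / INR Q) in R1 by (field; lra).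
    replace (d (S n) - d n - (d Q - d 0%nat) / INR Q) with
      (green Q (second_difference d) (S n) - green Q (second_difference d) n) by lra.
    eapply Rle_trans; [exact G|].
    apply Rmult_le_reg_r with (4 * INR Q); [lra|].
    replace (B / (2 * INR Q) * (4 * INR Q)) with (2 * B) by (field; lra).
    assert (Y : 8 * INR Q ^ 2 * lam * M <= 1 * M) by now apply Rmult_le_compat_r.
    lra.
Qed.

(** Banach's principle with ratio 1/2: the iterates stay in the ball because the first step is at
    most half its radius. The limit is a telescoping series, which [An_series] controls. *)
Lemma An_fixed_point x0 r rho (Q : nat) (Step : (nat -> R -> R) -> nat -> R -> R)
  (y0 : nat -> R -> R) : 0 <= r -> 0 <= rho ->
  (forall y z d,
     (forall n, (n <= Q)%nat -> An x0 r rho (fun x => y n x - y0 n x)) ->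
     (forall n, (n <= Q)%nat -> An x0 r rho (fun x => z n x - y0 n x)) ->
     (forall n, (n <= Q)%nat -> An x0 r d (fun x => y n x - z n x)) ->
     forall n, (n <= Q)%nat -> An x0 r (d / 2) (fun x => Step y n x - Step z n x)) ->
  (forall n, (n <= Q)%nat -> An x0 r (rho / 2) (fun x => Step y0 n x - y0 n x)) ->
  exists y, (forall n, (n <= Q)%nat -> An x0 r rho (fun x => y n x - y0 n x)) /\
    forall n x, (n <= Q)%nat -> Rabs (x - x0) <= r -> Step y n x = y n x.
Proof.
  intros Hr Hrho Hlip Hstart.
  set (it := fun k => Nat.iter k Step y0).
  assert (h0 : forall k, 0 < (/ 2) ^ k) by (intros; apply pow_lt; lra).
  assert (inv : forall k,
    (forall n, (n <= Q)%nat -> An x0 r (rho * (1 - (/ 2) ^ k)) (fun x => it k n x - y0 n x)) /\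
    (forall n, (n <= Q)%nat -> An x0 r (rho * (/ 2) ^ S k) (fun x => it (S k) n x - it k n x))).
  { induction k as [|k [IH1 IH2]].
    - split; intros n Hn.
      + simpl. eapply An_ext; [|apply (An_zero x0 r _ 0)]; auto.
        * intros; simpl; ring.
        * simpl; lra.
      + replace (rho * (/ 2) ^ 1) with (rho / 2) by (simpl; field).
        exact (Hstart n Hn).
    - assert (IH3 : forall n, (n <= Q)%nat ->
        An x0 r (rho * (1 - (/ 2) ^ S k)) (fun x => it (S k) n x - y0 n x)).
      { intros n Hn. eapply An_le; [|eapply An_ext; [|apply An_plus;
          [exact (IH2 n Hn) | exact (IH1 n Hn)]]].
        - right. simpl. field.
        - intros; simpl; ring. }
      split; [exact IH3|].
      intros n Hn. simpl ((/ 2) ^ S (S k)).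
      replace (rho * (/ 2 * (/ 2 * (/ 2) ^ k))) with ((rho * (/ 2) ^ S k) / 2)
        by (simpl; field).
      assert (w : forall k n, An x0 r (rho * (1 - (/ 2) ^ k)) (fun x => it k n x - y0 n x) ->
         An x0 r rho (fun x => it k n x - y0 n x)).
      { intros j m. apply An_le.
        rewrite <- (Rmult_1_r rho) at 2. apply Rmult_le_compat_l; auto.
        specialize (h0 j). lra. }
      change (An x0 r ((rho * (/ 2) ^ S k) / 2)
        (fun x => Step (it (S k)) n x - Step (it k) n x)).
      apply Hlip; auto. }
  assert (geo : forall k K, sum_n (fun j => rho * (/ 2) ^ S (k + j)) K <= rho * (/ 2) ^ k).
  { intros k K.
    assert (E : sum_n (fun j => rho * (/ 2) ^ S (k + j)) K =
      rho * (/ 2) ^ k - rho * (/ 2) ^ S (k + K)).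
    { induction K as [|K IH].
      - rewrite sum_n_R0, Nat.add_0_r. simpl. field.
      - rewrite sum_n_RS, IH, Nat.add_succ_r. simpl. as_R; field. }
    rewrite E. assert (0 <= rho * (/ 2) ^ S (k + K)); [|lra].
    apply Rmult_le_pos; [exact Hrho|left; apply h0]. }
  set (y := fun n x => y0 n x + Series (fun j => it (S j) n x - it j n x)).
  assert (tel : forall k n x K, sum_n (fun j => it (S (k + j)) n x - it (k + j)%nat n x) K
     = it (S (k + K)) n x - it k n x).
  { intros k n x K. induction K as [|K IH].
    - rewrite sum_n_R0, Nat.add_0_r. reflexivity.
    - rewrite sum_n_RS, IH, Nat.add_succ_r. as_R; ring. }
  assert (tail : forall k n, (n <= Q)%nat ->
     An x0 r (rho * (/ 2) ^ k) (fun x => y n x - it k n x)).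
  { intros k n Hn.
    destruct (An_series x0 r (fun j => rho * (/ 2) ^ S (k + j)) (rho * (/ 2) ^ k)
      (fun j x => it (S (k + j)) n x - it (k + j)%nat n x) Hr) as [S1 S2]; auto.
    { intros j. now apply (proj2 (inv (k + j)%nat)). }
    destruct (An_series x0 r (fun j => rho * (/ 2) ^ S (0 + j)) (rho * (/ 2) ^ 0)
      (fun j x => it (S (0 + j)) n x - it (0 + j)%nat n x) Hr) as [T1 _]; auto.
    { intros j. now apply (proj2 (inv (0 + j)%nat)). }
    eapply An_ext; [|exact S2]. intros x Hx. simpl.
    specialize (S1 x Hx). specialize (T1 x Hx). simpl in T1.
    apply is_series_unique. unfold y.
    set (s := Series (fun j => it (S j) n x - it j n x)) in *.
    change (is_lim_seq (sum_n (fun j => it (S j) n x - it j n x)) s) in T1.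
    change (is_lim_seq (sum_n (fun j => it (S (k + j)) n x - it (k + j)%nat n x))
              (y0 n x + s - it k n x)).
    apply is_lim_seq_ext with (fun K => (y0 n x +
      sum_n (fun j => it (S j) n x - it j n x) (K + k)) - it k n x).
    { intros K. rewrite tel.
      assert (T := tel 0%nat n x (K + k)%nat).
      change (sum_n (fun j => it (S j) n x - it j n x) (K + k)
        = it (S (K + k)) n x - it 0%nat n x) in T. rewrite T.
      rewrite (Nat.add_comm K k). change (it 0%nat n x) with (y0 n x). ring. }
    apply is_lim_seq_minus'; [|apply is_lim_seq_const].
    apply is_lim_seq_plus'; [apply is_lim_seq_const|].
    now apply (is_lim_seq_incr_n (sum_n (fun j => it (S j) n x - it j n x)) k). }
  exists y.
  assert (dom : forall n, (n <= Q)%nat -> An x0 r rho (fun x => y n x - y0 n x)).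
  { intros n Hn. rewrite <- (Rmult_1_r rho). exact (tail 0%nat n Hn). }
  split; [exact dom|].
  intros n x Hn Hx.
  (* [Step y - y] is the sum of [Step y - Step (it k)] and [it (S k) - y], each of size at most
     [rho * (/ 2) ^ S k]. *)
  assert (key : forall k, Rabs (Step y n x - y n x) <= rho * (/ 2) ^ k).
  { intros k.
    assert (A := Hlip y (it k) (rho * (/ 2) ^ k) dom).
    assert (B : forall m, (m <= Q)%nat -> An x0 r rho (fun x => it k m x - y0 m x)).
    { intros m Hm. eapply An_le; [|now apply (proj1 (inv k))].
      rewrite <- (Rmult_1_r rho) at 2. apply Rmult_le_compat_l; auto.
      specialize (h0 k). lra. }
    specialize (A B (fun m Hm => tail k m Hm) n Hn).
    assert (T := tail (S k) n Hn).
    apply (An_bound _ _ _ _ x) in A; auto.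
    apply (An_bound _ _ _ _ x) in T; auto.
    cbv beta in A, T. change (it (S k) n x) with (Step (it k) n x) in T.
    replace (Step y n x - y n x) with
      ((Step y n x - Step (it k) n x) - (y n x - Step (it k) n x)) by ring.
    eapply Rle_trans; [apply Rabs_triang|]. rewrite Rabs_Ropp.
    simpl ((/ 2) ^ S k) in T. lra. }
  apply Rabs_le0_eq. set (e := Rabs (Step y n x - y n x)) in *.
  assert (L : is_lim_seq (fun k => rho * (/ 2) ^ k) (rho * 0)).
  { apply (is_lim_seq_scal_l _ rho 0). apply is_lim_seq_geom.
    rewrite Rabs_pos_eq; lra. }
  rewrite Rmult_0_r in L.
  assert (H := is_lim_seq_le (fun _ => e) _ e 0 key (is_lim_seq_const e) L).
  simpl in H. lra.
Qed.

Lemma derive_bound_lipschitz h D x y :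
  (forall t, ex_derive h t) -> (forall t, Rabs (Derive h t) <= D) ->
  Rabs (h y - h x) <= D * Rabs (y - x).
Proof.
  intros H1 H2. apply (bounded_variation h (Derive h)).
  intros t _. split; [now apply Derive_correct | apply H2].
Qed.

(** * Chains of impact times *)

Section Chains.

(* [L] is a lower bound for flight times, [kap] a Lipschitz constant of the
   divided difference on flights of length at least [L]. *)
Variables (g : R) (f : R -> R) (Q : nat) (M0 M1 M2 L kap : R).
Hypothesis hg : 0 < g.
Hypothesis hQ : (0 < Q)%nat.
Hypothesis hf : real_analytic f.
Hypothesis hM0 : forall x, Rabs (f x) <= M0.
Hypothesis hM1 : forall x, Rabs (Derive f x) <= M1.
Hypothesis hM2 : forall x, Rabs (Derive (Derive f) x) < M2.
Hypothesis hL : 0 < L.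
(** The left side is the product rule for [f b - f a] times [/ (b - a)] on flights of length at
    least [L]. The added 1s and one factor 2 in each term make the bounds on the factors strict; the
    other factors 2 count the two ends. *)
Hypothesis hkap : 4 * (M1 + 1) / L + (2 * M0 + 1) * (4 / L ^ 2) <= kap.
(** The right side of the node equations has Lipschitz constant [4 / g * (M2 + kap)] and the Green
    operator has norm at most [2 * INR Q ^ 2]: their product is at most 1/4. *)
Hypothesis hsmall : 8 * INR Q ^ 2 * (4 / g * (M2 + kap)) <= 1.

(* The velocities after the impact at [a] and after the impact at [b] of a ball
   flying from [a] to [b]. *)
Definition leave_vel (a b : R) : R := g / 2 * (b - a) + divdiff f a b - Derive f a.
Definition arrive_vel (a b : R) : R := g / 2 * (b - a) - divdiff f a b + Derive f b.

(** Up to sign, the kicks are the deviations from [g / 2 * (b - a)], the velocity at both ends of a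
    flight over a racket at rest. They contain the whole nonlinearity, and have small Lipschitz
    constants on long flights. *)
Definition leave_kick (a b : R) : R := Derive f a - divdiff f a b.
Definition arrive_kick (a b : R) : R := Derive f b - divdiff f a b.

Lemma M1_pos : 0 <= M1.
Proof. eapply Rle_trans; [apply Rabs_pos | apply (hM1 0)]. Qed.

Lemma M0_pos : 0 <= M0.
Proof. eapply Rle_trans; [apply Rabs_pos | apply (hM0 0)]. Qed.

Lemma M2_pos : 0 < M2.
Proof. eapply Rle_lt_trans; [apply Rabs_pos | apply (hM2 0)]. Qed.

Lemma gL_pos : 0 < g * L.
Proof. now apply Rmult_lt_0_compat. Qed.

Lemma kap_bound : 4 * M1 / L <= kap.
Proof.
  assert (H := M0_pos). eapply Rle_trans; [|exact hkap].
  assert (0 < / L) by now apply Rinv_0_lt_compat.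
  assert (0 < / L ^ 2) by (apply Rinv_0_lt_compat, pow_lt, hL).
  assert (0 <= (2 * M0 + 1) * (4 / L ^ 2)).
  { apply Rmult_le_pos; unfold Rdiv; lra. }
  unfold Rdiv in *. lra.
Qed.

Lemma kap_pos : 0 <= kap.
Proof.
  eapply Rle_trans; [|exact kap_bound].
  apply Rmult_le_pos; [pose proof M1_pos; lra|]. left; now apply Rinv_0_lt_compat.
Qed.

Lemma Q_ge_1 : 1 <= INR Q.
Proof. now apply INR_ge_1. Qed.

Lemma lam_pos : 0 <= 4 / g * (M2 + kap).
Proof.
  pose proof M2_pos. pose proof kap_pos.
  apply Rmult_le_pos; [|lra]. left. apply Rdiv_lt_0_compat; lra.
Qed.

Lemma kap_le_g : kap <= g / 32.
Proof.
  pose proof M2_pos. pose proof kap_pos. pose proof lam_pos.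
  assert (H2 : 4 / g * (M2 + kap) <= / 8).
  { assert (1 * (4 / g * (M2 + kap)) <= INR Q ^ 2 * (4 / g * (M2 + kap))); [|lra].
    apply Rmult_le_compat_r; auto. apply pow_R1_Rle, Q_ge_1. }
  apply (Rmult_le_compat_l (g / 4)) in H2; [|lra].
  replace (g / 4 * (4 / g * (M2 + kap))) with (M2 + kap) in H2 by (field; lra). lra.
Qed.

Lemma f_ex_derive x : ex_derive f x.
Proof. apply analytic_at_ex_derive, hf. Qed.

Lemma f1_ex_derive x : ex_derive (Derive f) x.
Proof. apply analytic_at_ex_derive, (real_analytic_Derive f hf). Qed.

Lemma f_lipschitz x y : Rabs (f y - f x) <= M1 * Rabs (y - x).
Proof. apply derive_bound_lipschitz; [apply f_ex_derive | exact hM1]. Qed.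

Lemma f1_lipschitz x y : Rabs (Derive f y - Derive f x) <= M2 * Rabs (y - x).
Proof.
  apply derive_bound_lipschitz; [apply f1_ex_derive|]. intros; left; apply hM2.
Qed.

Lemma divdiff_bound a b : a < b -> Rabs (divdiff f a b) <= M1.
Proof.
  intros H. unfold divdiff, Rdiv. rewrite Rabs_mult, Rabs_inv.
  assert (P : 0 < Rabs (b - a)) by (apply Rabs_pos_lt; lra).
  apply Rmult_le_reg_r with (Rabs (b - a)); [exact P|].
  rewrite Rmult_assoc, Rinv_l, Rmult_1_r by lra. apply f_lipschitz.
Qed.

Lemma divdiff_lipschitz a b a' b' d : L <= b - a -> L <= b' - a' ->
  Rabs (a' - a) <= d -> Rabs (b' - b) <= d ->
  Rabs (divdiff f a' b' - divdiff f a b) <= kap * d.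
Proof.
  intros H H' Ha Hb.
  assert (d0 : 0 <= d) by (eapply Rle_trans; [apply Rabs_pos|exact Ha]).
  apply Rle_trans with (4 * M1 / L * d); [|apply Rmult_le_compat_r; auto using kap_bound].
  (* The old quotient times the change of the gap is subtracted in the numerator, so that only the
     new gap, at least [L], is divided by. *)
  assert (E : divdiff f a' b' - divdiff f a b =
    (((f b' - f b) - (f a' - f a)) - divdiff f a b * ((b' - b) - (a' - a))) / (b' - a')).
  { unfold divdiff. field. lra. }
  rewrite E. unfold Rdiv. rewrite Rabs_mult, Rabs_inv, (Rabs_pos_eq (b' - a')) by lra.
  pose proof M1_pos as P1.
  assert (B := divdiff_bound a b ltac:(lra)).
  assert (X : Rabs ((f b' - f b) - (f a' - f a) - divdiff f a b * ((b' - b) - (a' - a)))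
      <= 4 * M1 * d).
  { assert (Y1 : Rabs (f b' - f b) <= M1 * d).
    { eapply Rle_trans; [apply f_lipschitz|]. now apply Rmult_le_compat_l. }
    assert (Y2 : Rabs (f a' - f a) <= M1 * d).
    { eapply Rle_trans; [apply f_lipschitz|]. now apply Rmult_le_compat_l. }
    assert (Y3 : Rabs (divdiff f a b * ((b' - b) - (a' - a))) <= M1 * (2 * d)).
    { rewrite Rabs_mult. apply Rmult_le_compat; auto using Rabs_pos.
      eapply Rle_trans; [apply Rabs_triang|]. rewrite Rabs_Ropp. lra. }
    eapply Rle_trans; [apply Rabs_triang|]. rewrite Rabs_Ropp.
    eapply Rle_trans; [apply Rplus_le_compat_r, Rabs_triang|]. rewrite Rabs_Ropp. lra. }
  rewrite Rmult_assoc, (Rmult_comm (/ L)), <- Rmult_assoc.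
  apply Rmult_le_compat; auto using Rabs_pos.
  - left; apply Rinv_0_lt_compat; lra.
  - apply Rinv_le_contravar; lra.
Qed.

Lemma kicks_lipschitz a b a' b' d : L <= b - a -> L <= b' - a' ->
  Rabs (a' - a) <= d -> Rabs (b' - b) <= d ->
  Rabs (leave_kick a' b' - leave_kick a b) <= (M2 + kap) * d /\
  Rabs (arrive_kick a' b' - arrive_kick a b) <= (M2 + kap) * d.
Proof.
  intros H H' Ha Hb.
  assert (D := divdiff_lipschitz a b a' b' d H H' Ha Hb).
  pose proof M2_pos as P2.
  assert (X : forall x y, Rabs (y - x) <= d -> Rabs (Derive f y - Derive f x) <= M2 * d).
  { intros x y Hxy. eapply Rle_trans; [apply f1_lipschitz|].
    apply Rmult_le_compat_l; lra. }
  unfold leave_kick, arrive_kick. split.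
  - replace (Derive f a' - divdiff f a' b' - (Derive f a - divdiff f a b))
      with ((Derive f a' - Derive f a) - (divdiff f a' b' - divdiff f a b)) by ring.
    eapply Rle_trans; [apply Rabs_triang|]. rewrite Rabs_Ropp.
    specialize (X _ _ Ha). lra.
  - replace (Derive f b' - divdiff f a' b' - (Derive f b - divdiff f a b))
      with ((Derive f b' - Derive f b) - (divdiff f a' b' - divdiff f a b)) by ring.
    eapply Rle_trans; [apply Rabs_triang|]. rewrite Rabs_Ropp.
    specialize (X _ _ Hb). lra.
Qed.

Lemma kicks_bound a b : a < b ->
  Rabs (leave_kick a b) <= 2 * M1 /\ Rabs (arrive_kick a b) <= 2 * M1.
Proof.
  intros H. assert (B := divdiff_bound a b H).
  unfold leave_kick, arrive_kick. split; eapply Rle_trans; try apply Rabs_triang;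
  rewrite Rabs_Ropp; [pose proof (hM1 a)|pose proof (hM1 b)]; lra.
Qed.

(** The counterpart of [divdiff_lipschitz] for power series; the form of [hkap] is dictated by
    it. *)
Lemma divdiff_lip_at a b : L <= b - a -> lip_at (divdiff f) a b kap.
Proof.
  intros H. pose proof M1_pos as P1. pose proof M0_pos as P0.
  assert (PL2 : 0 < L ^ 2) by now apply pow_lt.
  apply lip_at_le with ((2 * (M1 + 1)) * (2 / L) + (2 * M0 + 1) * (2 / L ^ 2 * 2)).
  { eapply Rle_trans; [|exact hkap]. right. field. lra. }
  change (divdiff f) with (fun a b => (f b - f a) * / (b - a)).
  apply lip_at_mult.
  - lra.
  - apply Rmult_le_pos; [|lra]. left. apply Rdiv_lt_0_compat; lra.
  - replace (2 * (M1 + 1)) with ((M1 + 1) * 1 + (M1 + 1) * 1) by ring.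
    apply lip_at_minus.
    + apply (lip_at_comp f (fun _ b => b)); [lra | apply lip_at_snd | apply hf |].
      specialize (hM1 b). lra.
    + apply (lip_at_comp f (fun a _ => a)); [lra | apply lip_at_fst | apply hf |].
      specialize (hM1 a). lra.
  - apply (lip_at_comp Rinv (fun a b => b - a)); [lra | | apply analytic_at_inv; lra |].
    + replace 2 with (1 + 1) by ring. apply lip_at_minus; [apply lip_at_snd|apply lip_at_fst].
    + assert (D : is_derive Rinv (b - a) (- / (b - a) ^ 2)).
      { auto_derive; [lra|]. field. lra. }
      rewrite (is_derive_unique _ _ _ D), Rabs_Ropp, Rabs_pos_eq.
      * assert (/ (b - a) ^ 2 <= / L ^ 2).
        { apply Rinv_le_contravar; auto. apply pow_incr. lra. }
        assert (0 < / L ^ 2) by now apply Rinv_0_lt_compat. lra.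
      * left. apply Rinv_0_lt_compat, pow_lt. lra.
  - pose proof (hM0 a). pose proof (hM0 b).
    eapply Rle_lt_trans; [apply Rabs_triang|]. rewrite Rabs_Ropp. lra.
  - rewrite Rabs_pos_eq by (left; apply Rinv_0_lt_compat; lra).
    assert (/ (b - a) <= / L) by (apply Rinv_le_contravar; lra).
    assert (0 < / L) by now apply Rinv_0_lt_compat. lra.
Qed.

Lemma Derive_f_lip_at_fst a b : lip_at (fun a _ => Derive f a) a b M2.
Proof.
  rewrite <- (Rmult_1_r M2). apply (lip_at_comp (Derive f) (fun a _ => a));
    [lra | apply lip_at_fst | apply (real_analytic_Derive f hf) | apply hM2].
Qed.

Lemma Derive_f_lip_at_snd a b : lip_at (fun _ b => Derive f b) a b M2.
Proof.
  rewrite <- (Rmult_1_r M2). apply (lip_at_comp (Derive f) (fun _ b => b));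
    [lra | apply lip_at_snd | apply (real_analytic_Derive f hf) | apply hM2].
Qed.

Lemma leave_kick_lip_at a b : L <= b - a -> lip_at leave_kick a b (M2 + kap).
Proof.
  intros H. apply (lip_at_minus (fun a _ => Derive f a) (divdiff f));
    [apply Derive_f_lip_at_fst | now apply divdiff_lip_at].
Qed.

Lemma arrive_kick_lip_at a b : L <= b - a -> lip_at arrive_kick a b (M2 + kap).
Proof.
  intros H. apply (lip_at_minus (fun _ b => Derive f b) (divdiff f));
    [apply Derive_f_lip_at_snd | now apply divdiff_lip_at].
Qed.

(** * Chains, their uniqueness and their twist *)

Definition node (t : nat -> R) (n : nat) : Prop :=
  arrive_vel (t (pred n)) (t n) = leave_vel (t n) (t (S n)).

Definition chain (l : R) (t : nat -> R) : Prop :=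
  (forall n, (n < Q)%nat -> l <= t (S n) - t n) /\
  forall n, (0 < n < Q)%nat -> node t n.

(** Multiplied by [2 / g], the matching of velocities at an impact becomes a discrete second-order
    equation whose right side has a small Lipschitz constant. *)
Lemma node_second_difference t n : node t n <->
  second_difference t n =
    2 / g * (arrive_kick (t (pred n)) (t n) + leave_kick (t n) (t (S n))).
Proof.
  unfold node, second_difference, arrive_vel, leave_vel, arrive_kick, leave_kick.
  split; intros H.
  - apply Rmult_eq_reg_l with (g / 2); [|lra]. rewrite <- Rmult_assoc.
    replace (g / 2 * (2 / g)) with 1 by (field; lra). lra.
  - apply (Rmult_eq_compat_l (g / 2)) in H. rewrite <- Rmult_assoc in H.
    replace (g / 2 * (2 / g)) with 1 in H by (field; lra). lra.
Qed.

Lemma chain_weaken l l' t : l' <= l -> chain l t -> chain l' t.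
Proof.
  intros H [A B]. split; [|exact B]. intros n Hn. specialize (A n Hn). lra.
Qed.

(** The second difference of the distance between two chains is bounded by a small multiple of the
    maximal distance, so [nearly_affine] applies without linearization. *)
Lemma chain_compare t t' B : chain L t -> chain L t' ->
  Rabs (t' 0%nat - t 0%nat) <= B -> Rabs (t' Q - t Q) <= B ->
  (forall n, (n <= Q)%nat -> Rabs (t' n - t n) <= 2 * B) /\
  forall n, (n < Q)%nat ->
    Rabs ((t' (S n) - t (S n)) - (t' n - t n)
          - ((t' Q - t Q) - (t' 0%nat - t 0%nat)) / INR Q) <= B / (2 * INR Q).
Proof.
  intros [G N] [G' N'] H0 H1.
  apply (nearly_affine Q (fun n => t' n - t n) (4 / g * (M2 + kap)) B); auto using lam_pos.
  intros M HM n Hn.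
  specialize (N n Hn). specialize (N' n Hn).
  apply node_second_difference in N, N'.
  replace (second_difference (fun n => t' n - t n) n) with
    (second_difference t' n - second_difference t n)
    by (unfold second_difference; ring).
  rewrite N, N', <- Rmult_minus_distr_l, Rabs_mult, (Rabs_pos_eq (2 / g))
    by (left; apply Rdiv_lt_0_compat; lra).
  destruct n as [|n]; [lia|]. simpl pred in *.
  destruct (kicks_lipschitz (t n) (t (S n)) (t' n) (t' (S n)) M) as [_ K1];
    try apply G; try apply G'; try apply HM; try lia.
  destruct (kicks_lipschitz (t (S n)) (t (S (S n))) (t' (S n)) (t' (S (S n))) M) as [K2 _];
    try apply G; try apply G'; try apply HM; try lia.
  replace (4 / g * (M2 + kap) * M) with (2 / g * (2 * ((M2 + kap) * M))) by (field; lra).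
  apply Rmult_le_compat_l; [left; apply Rdiv_lt_0_compat; lra|].
  match goal with |- Rabs ?w <= _ => replace w with
    ((arrive_kick (t' n) (t' (S n)) - arrive_kick (t n) (t (S n))) +
     (leave_kick (t' (S n)) (t' (S (S n))) - leave_kick (t (S n)) (t (S (S n))))) by ring end.
  eapply Rle_trans; [apply Rabs_triang|]. lra.
Qed.

Lemma chain_unique t t' : chain L t -> chain L t' ->
  t' 0%nat = t 0%nat -> t' Q = t Q -> forall n, (n <= Q)%nat -> t' n = t n.
Proof.
  intros H H' E0 E1 n Hn.
  destruct (chain_compare t t' 0 H H') as [A _].
  - rewrite E0, Rminus_diag, Rabs_R0. lra.
  - rewrite E1, Rminus_diag, Rabs_R0. lra.
  - specialize (A n Hn). apply Rabs_le0_eq. lra.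
Qed.

(** Since [kap <= g / 32], the slope [g / 2] of the ballistic term dominates the divided
    difference. *)
Lemma leave_vel_diff a b b' : L <= b - a -> L <= b' - a -> b <= b' ->
  g / 4 * (b' - b) <= leave_vel a b' - leave_vel a b <= g * (b' - b).
Proof.
  intros H H' Hb.
  assert (D := divdiff_lipschitz a b a b' (b' - b) H H').
  rewrite Rminus_diag, Rabs_R0, (Rabs_pos_eq (b' - b)) in D by lra.
  specialize (D ltac:(lra) ltac:(lra)).
  pose proof kap_le_g. pose proof kap_pos.
  assert (kap * (b' - b) <= g / 32 * (b' - b)) by (apply Rmult_le_compat_r; lra).
  assert (0 <= g * (b' - b)) by (apply Rmult_le_pos; lra).
  apply Rabs_le_between in D. unfold leave_vel. split; lra.
Qed.

Lemma arrive_vel_diff a a' b : L <= b - a -> L <= b - a' -> a <= a' ->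
  g / 4 * (a' - a) <= arrive_vel a b - arrive_vel a' b <= g * (a' - a).
Proof.
  intros H H' Ha.
  assert (D := divdiff_lipschitz a b a' b (a' - a) H H').
  rewrite Rminus_diag, Rabs_R0, (Rabs_pos_eq (a' - a)) in D by lra.
  specialize (D ltac:(lra) ltac:(lra)).
  pose proof kap_le_g. pose proof kap_pos.
  assert (kap * (a' - a) <= g / 32 * (a' - a)) by (apply Rmult_le_compat_r; lra).
  assert (0 <= g * (a' - a)) by (apply Rmult_le_pos; lra).
  apply Rabs_le_between in D. unfold arrive_vel. split; lra.
Qed.

(** [e] is the change of one gap and [del / INR Q] the average change; [e] lies between one half and
    three halves of the average. *)
Lemma slope_bounds e del : 0 <= del ->
  Rabs (e - del / INR Q) <= del / (2 * INR Q) ->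
  0 <= e /\ g / (8 * INR Q) * del <= g / 4 * e /\ g * e <= 2 * g * del.
Proof.
  intros d0 A. pose proof Q_ge_1 as q1. apply Rabs_le_between in A.
  set (s := del / (2 * INR Q)) in *.
  replace (del / INR Q) with (2 * s) in A by (unfold s; field; lra).
  assert (s0 : 0 <= s) by (apply Rdiv_le_0_compat; lra).
  assert (sd : s <= del / 2).
  { unfold s. apply Rmult_le_compat_l; auto. apply Rinv_le_contravar; lra. }
  replace (g / (8 * INR Q) * del) with (g / 4 * s) by (unfold s; field; lra).
  split; [lra|]. split; [apply Rmult_le_compat_l; lra|].
  rewrite (Rmult_comm 2 g), Rmult_assoc. apply Rmult_le_compat_l; lra.
Qed.

(** The twist: moving the far end forward by some amount lengthens the first flight by at least half
    the average share, and the leaving velocity grows with the flight. *)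
Lemma chain_twist_leave t t' : chain L t -> chain L t' ->
  t' 0%nat = t 0%nat -> t Q <= t' Q ->
  g / (8 * INR Q) * (t' Q - t Q)
    <= leave_vel (t' 0%nat) (t' 1%nat) - leave_vel (t 0%nat) (t 1%nat)
    <= 2 * g * (t' Q - t Q).
Proof.
  intros H H' E0 HQ'. set (del := t' Q - t Q). assert (d0 : 0 <= del) by (unfold del; lra).
  destruct (chain_compare t t' del H H') as [_ A].
  - rewrite E0, Rminus_diag, Rabs_R0. exact d0.
  - fold del. rewrite Rabs_pos_eq; lra.
  - specialize (A 0%nat hQ). fold del in A.
    rewrite E0, Rminus_diag, !Rminus_0_r in A.
    destruct (slope_bounds _ _ d0 A) as [S0 [S1 S2]].
    destruct H as [G _], H' as [G' _].
    specialize (G 0%nat hQ). specialize (G' 0%nat hQ). rewrite E0 in *.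
    destruct (leave_vel_diff (t 0%nat) (t 1%nat) (t' 1%nat)) as [V1 V2]; lra.
Qed.

Lemma chain_twist_arrive t t' : chain L t -> chain L t' ->
  t' Q = t Q -> t 0%nat <= t' 0%nat ->
  g / (8 * INR Q) * (t' 0%nat - t 0%nat)
    <= arrive_vel (t (pred Q)) (t Q) - arrive_vel (t' (pred Q)) (t' Q)
    <= 2 * g * (t' 0%nat - t 0%nat).
Proof.
  intros H H' E0 HQ'. set (del := t' 0%nat - t 0%nat).
  assert (d0 : 0 <= del) by (unfold del; lra).
  destruct (chain_compare t t' del H H') as [_ A].
  - fold del. rewrite Rabs_pos_eq; lra.
  - rewrite E0, Rminus_diag, Rabs_R0. exact d0.
  - assert (EQ : S (pred Q) = Q) by lia.
    specialize (A (pred Q) ltac:(lia)). rewrite EQ in A. fold del in A.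
    rewrite E0, Rminus_diag, !Rminus_0_l, <- Rabs_Ropp in A.
    replace (- (- (t' (pred Q) - t (pred Q)) - - del / INR Q)) with
      (t' (pred Q) - t (pred Q) - del / INR Q) in A by (unfold Rdiv; ring).
    destruct (slope_bounds _ _ d0 A) as [S0 [S1 S2]].
    destruct H as [G _], H' as [G' _].
    specialize (G (pred Q) ltac:(lia)). specialize (G' (pred Q) ltac:(lia)).
    rewrite EQ, ?E0 in *.
    destruct (arrive_vel_diff (t (pred Q)) (t' (pred Q)) (t Q)) as [V1 V2]; lra.
Qed.

(* Substituting [second_difference y] into the representation [green_repr] turns
   the node equations with [y 0 = x] and [y Q = x + P] into a fixed point
   equation. *)
Variable P : R.

Definition dirichlet_step (y : nat -> R -> R) (n : nat) (x : R) : R :=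
  x + INR n / INR Q * P + green Q (fun j => 2 / g *
    (arrive_kick (y (pred j) x) (y j x) + leave_kick (y j x) (y (S j) x))) n.

Lemma dirichlet_step_chain l y x :
  (forall n, (n <= Q)%nat -> dirichlet_step y n x = y n x) ->
  (forall n, (n < Q)%nat -> l <= y (S n) x - y n x) ->
  chain l (fun n => y n x) /\ y 0%nat x = x /\ y Q x = x + P.
Proof.
  intros H G. pose proof Q_ge_1 as q1. split; [split|split].
  - exact G.
  - intros n Hn. apply node_second_difference.
    destruct n as [|n]; [lia|]. unfold second_difference. simpl pred.
    rewrite <- (H (S (S n))), <- (H (S n)), <- (H n) by lia.
    unfold dirichlet_step.
    set (phi := fun j => 2 / g *
      (arrive_kick (y (pred j) x) (y j x) + leave_kick (y j x) (y (S j) x))).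
    assert (E := green_second_difference Q phi n).
    replace (arrive_kick _ _ + leave_kick _ _) with
      (arrive_kick (y n x) (y (S n) x) + leave_kick (y (S n) x) (y (S (S n)) x)).
    2: { rewrite <- (H (S (S n))), <- (H (S n)), <- (H n) by lia. reflexivity. }
    change (2 / g * (arrive_kick (y n x) (y (S n) x) + leave_kick (y (S n) x) (y (S (S n)) x)))
      with (phi (S n)).
    rewrite <- E, !S_INR. field. lra.
  - rewrite <- H by lia. unfold dirichlet_step. rewrite green_0. simpl. field. lra.
  - rewrite <- H by lia. unfold dirichlet_step. rewrite green_end by exact hQ. field. lra.
Qed.

Lemma chain_dirichlet_step l (t : nat -> R) x : chain l t ->
  t 0%nat = x -> t Q = x + P ->
  forall n, (n <= Q)%nat -> dirichlet_step (fun n _ => t n) n x = t n.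
Proof.
  intros [_ N] E0 EQ n Hn. unfold dirichlet_step.
  rewrite (green_repr Q t n hQ), E0, EQ.
  rewrite (green_ext Q (second_difference t) (fun j => 2 / g *
    (arrive_kick (t (pred j)) (t j) + leave_kick (t j) (t (S j)))) n Hn).
  - ring.
  - intros j Hj. apply node_second_difference, N, Hj.
Qed.

(** The hypothesis concerns the kicks only, so that it can be met by real Lipschitz estimates for
    [r = 0] and by [lip_on] for [r > 0]. *)
Lemma dirichlet_step_lip x0 r d y z : 0 <= r ->
  (forall j, (j < Q)%nat ->
     An x0 r ((M2 + kap) * d) (fun x =>
       arrive_kick (y j x) (y (S j) x) - arrive_kick (z j x) (z (S j) x)) /\
     An x0 r ((M2 + kap) * d) (fun x =>
       leave_kick (y j x) (y (S j) x) - leave_kick (z j x) (z (S j) x))) ->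
  forall n, (n <= Q)%nat -> 0 <= d ->
    An x0 r (d / 2) (fun x => dirichlet_step y n x - dirichlet_step z n x).
Proof.
  intros Hr H n Hn Hd. pose proof M2_pos. pose proof kap_pos.
  assert (g2 : 0 < 2 / g) by (apply Rdiv_lt_0_compat; lra).
  assert (Kd : 0 <= (M2 + kap) * d) by (apply Rmult_le_pos; lra).
  set (mu := 2 / g * ((M2 + kap) * d + (M2 + kap) * d)).
  assert (mu0 : 0 <= mu) by (apply Rmult_le_pos; lra).
  eapply An_le; [|eapply An_ext; [|apply (An_green x0 r mu Q (fun j x =>
     2 / g * (arrive_kick (y (pred j) x) (y j x) + leave_kick (y j x) (y (S j) x))
     - 2 / g * (arrive_kick (z (pred j) x) (z j x) + leave_kick (z j x) (z (S j) x)))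
     Hr hQ mu0) with (n := n)]]; auto.
  - unfold mu. assert (X := Rmult_le_compat_r d _ _ Hd hsmall).
    replace (2 * INR Q ^ 2 * (2 / g * ((M2 + kap) * d + (M2 + kap) * d))) with
      (8 * INR Q ^ 2 * (4 / g * (M2 + kap)) * d / 4) by (field; lra).
    lra.
  - intros x Hx. simpl. unfold dirichlet_step. rewrite <- green_minus. ring.
  - intros j Hj. destruct j as [|j]; [lia|]. simpl pred.
    assert (X := An_scal x0 r _ (2 / g) _ (An_plus _ _ _ _ _ _
      (proj1 (H j ltac:(lia))) (proj2 (H (S j) ltac:(lia))))).
    eapply An_ext; [|eapply An_le; [|exact X]].
    + intros x Hx. simpl. ring.
    + rewrite Rabs_pos_eq by lra. unfold mu. lra.
Qed.

(** The mean gap still leaves [2 * L] after both its ends have moved by the radius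
    [32 * INR Q ^ 2 * M1 / g] of the ball used in [chain_exists]. *)
Hypothesis hP : 2 * L + 64 * INR Q ^ 2 * M1 / g <= P / INR Q.

(** The contraction with [r = 0], started from evenly spaced impact times. Each kick is at most
    [2 * M1], which bounds the first step; the radius is twice that bound. *)
Lemma chain_exists x : exists t, chain (2 * L) t /\ t 0%nat = x /\ t Q = x + P.
Proof.
  pose proof Q_ge_1 as q1. pose proof M1_pos as P1.
  set (rho := 32 * INR Q ^ 2 * M1 / g).
  assert (Q2 : 1 <= INR Q ^ 2) by now apply pow_R1_Rle.
  assert (rho0 : 0 <= rho).
  { unfold rho. apply Rdiv_le_0_compat; [|exact hg].
    apply Rmult_le_pos; [apply Rmult_le_pos|]; lra. }
  assert (hP' : 2 * L + 2 * rho <= P / INR Q).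
  { eapply Rle_trans; [|exact hP]. unfold rho. right. field. lra. }
  set (y0 := fun (n : nat) (x : R) => x + INR n / INR Q * P).
  assert (gap : forall y, (forall n, (n <= Q)%nat -> An x 0 rho (fun x => y n x - y0 n x)) ->
     forall n, (n < Q)%nat -> 2 * L <= y (S n) x - y n x).
  { intros y Hy n Hn.
    assert (A := proj1 (An_r0 _ _ _) (Hy (S n) ltac:(lia))).
    assert (B := proj1 (An_r0 _ _ _) (Hy n ltac:(lia))).
    apply Rabs_le_between in A, B. unfold y0 in A, B. rewrite S_INR in A.
    replace ((INR n + 1) / INR Q * P) with (INR n / INR Q * P + P / INR Q) in A
      by (field; lra). lra. }
  destruct (An_fixed_point x 0 rho Q dirichlet_step y0) as [y [Hy1 Hy2]]; auto; [lra| | |].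
  - intros y z d Hy Hz Hd n Hn.
    assert (d0 : 0 <= d) by exact (An_pos _ _ _ _ (Hd n Hn)).
    apply dirichlet_step_lip; auto; [lra|].
    intros j Hj.
    assert (G1 := gap y Hy j Hj). assert (G2 := gap z Hz j Hj).
    assert (D1 := proj1 (An_r0 _ _ _) (Hd j ltac:(lia))).
    assert (D2 := proj1 (An_r0 _ _ _) (Hd (S j) ltac:(lia))).
    destruct (kicks_lipschitz (z j x) (z (S j) x) (y j x) (y (S j) x) d) as [K1 K2];
      auto; try lra.
    split; apply An_r0; auto.
  - intros n Hn. apply An_r0.
    replace (dirichlet_step y0 n x - y0 n x) with
      (green Q (fun j => 2 / g *
         (arrive_kick (y0 (pred j) x) (y0 j x) + leave_kick (y0 j x) (y0 (S j) x))) n)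
      by (unfold dirichlet_step, y0; ring).
    assert (g2 : 0 < 2 / g) by (apply Rdiv_lt_0_compat; lra).
    replace (rho / 2) with (2 * INR Q ^ 2 * (2 / g * (4 * M1))) by (unfold rho; field; lra).
    apply green_bound; auto; [apply Rmult_le_pos; lra|].
    intros j Hj. rewrite Rabs_mult, (Rabs_pos_eq (2 / g)) by lra.
    apply Rmult_le_compat_l; [lra|].
    assert (lt : forall k, y0 k x < y0 (S k) x).
    { intros k. unfold y0. rewrite S_INR.
      replace ((INR k + 1) / INR Q * P) with (INR k / INR Q * P + P / INR Q) by (field; lra).
      lra. }
    destruct j as [|j]; [lia|]. simpl pred.
    destruct (kicks_bound _ _ (lt j)) as [_ K1].
    destruct (kicks_bound _ _ (lt (S j))) as [K2 _].
    eapply Rle_trans; [apply Rabs_triang|]. lra.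
  - exists (fun n => y n x).
    apply dirichlet_step_chain.
    + intros n Hn. apply Hy2; auto. rewrite Rminus_diag, Rabs_R0. lra.
    + now apply gap.
Qed.

(** * Analytic dependence of chains on the starting point *)

Lemma finite_radius (N : nat) (good : nat -> R -> Prop) :
  (forall n rho rho', good n rho -> 0 < rho' <= rho -> good n rho') ->
  (forall n, (n < N)%nat -> exists rho, 0 < rho /\ good n rho) ->
  exists rho, 0 < rho /\ forall n, (n < N)%nat -> good n rho.
Proof.
  intros down H. induction N as [|N IH].
  - exists 1. split; [lra|]. intros; lia.
  - destruct IH as [r1 [p1 H1]]; [intros; apply H; lia|].
    destruct (H N ltac:(lia)) as [r2 [p2 H2]].
    assert (p3 : 0 < Rmin r1 r2) by now apply Rmin_glb_lt.
    exists (Rmin r1 r2). split; [exact p3|].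
    intros n Hn. destruct (Nat.eq_dec n N) as [->|].
    + apply down with r2; auto. split; [exact p3 | apply Rmin_r].
    + apply down with r1; [apply H1; lia|]. split; [exact p3 | apply Rmin_l].
Qed.

Variable tau : R -> nat -> R.
Hypothesis htau : forall x, chain (2 * L) (tau x) /\ tau x 0%nat = x /\ tau x Q = x + P.

(** The same contraction with [r > 0]. Its fixed point consists of power series in [x - x0] and is,
    for each [x] near [x0], a chain from [x] to [x + P]; uniqueness identifies it with [tau x],
    which was chosen pointwise. *)
Lemma chain_analytic x0 rho1 : 0 < rho1 ->
  exists r, 0 < r /\ forall n, (n <= Q)%nat ->
    An x0 r rho1 (fun x => tau x n - tau x0 n).
Proof.
  intros Hrho1.
  set (c := tau x0). destruct (htau x0) as [[G N] [E0 EQ]]. fold c in G, N, E0, EQ.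
  set (lips := fun Nn j rho => lip_on Nn (c j) (c (S j)) (M2 + kap) rho).
  destruct (finite_radius Q (fun j rho => lips arrive_kick j rho /\ lips leave_kick j rho))
    as [rho [Hrho HL]].
  { intros n r r' [A B] Hr'.
    split; [apply (lip_on_le _ _ _ _ r)|apply (lip_on_le _ _ _ _ r)]; auto; lra. }
  { intros n Hn. assert (Gn := G n Hn).
    destruct (arrive_kick_lip_at (c n) (c (S n)) ltac:(lra)) as [r1 [p1 H1]].
    destruct (leave_kick_lip_at (c n) (c (S n)) ltac:(lra)) as [r2 [p2 H2]].
    exists (Rmin r1 r2). split; [now apply Rmin_glb_lt|].
    split; [apply (lip_on_le _ _ _ _ r1)|apply (lip_on_le _ _ _ _ r2)]; auto;
      [apply Rmin_l | apply Rmin_r]. }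
  (* Every sequence in the ball stays within [2 * r] of [c], hence within [rho] and within [rho1];
     the bound [L / 4] keeps its gaps above [L]. *)
  set (r := Rmin (Rmin (rho / 2) (rho1 / 2)) (L / 4)).
  assert (r1 : r <= rho / 2) by (eapply Rle_trans; [apply Rmin_l | apply Rmin_l]).
  assert (r2 : r <= rho1 / 2) by (eapply Rle_trans; [apply Rmin_l | apply Rmin_r]).
  assert (r3 : r <= L / 4) by apply Rmin_r.
  assert (r0 : 0 < r) by (unfold r; repeat apply Rmin_glb_lt; lra).
  set (y0 := fun (n : nat) (x : R) => c n + (x - x0)).
  assert (Y0 : forall n, An x0 r r (fun x => y0 n x - c n)).
  { intros n. eapply An_ext; [|eapply An_le; [|exact (An_affine x0 r 0 1 (Rlt_le _ _ r0))]].
    - intros; unfold y0; simpl; ring.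
    - rewrite Rabs_R0, Rabs_R1. lra. }
  assert (Y1 : forall y n, An x0 r r (fun x => y n x - y0 n x) ->
     An x0 r (2 * r) (fun x => y n x - c n)).
  { intros y n Hy. eapply An_ext; [|eapply An_le;
      [|exact (An_plus _ _ _ _ _ _ Hy (Y0 n))]]; [|lra].
    intros; simpl; ring. }
  assert (near : forall y n, An x0 r (2 * r) (fun x => y n x - c n) ->
     An x0 r rho (fun x => y n x - c n)).
  { intros y n. apply An_le. lra. }
  assert (cst : forall n rho, 0 < rho -> An x0 r rho (fun _ => c n - c n)).
  { intros n m Hm. apply An_zero; lra. }
  destruct (An_fixed_point x0 r r Q dirichlet_step y0) as [y [Hy1 Hy2]]; try lra.
  - intros y z d Hy Hz Hd n Hn.
    assert (d0 : 0 <= d) by exact (An_pos _ _ _ _ (Hd n Hn)).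
    apply dirichlet_step_lip; auto; [lra|].
    intros j Hj. destruct (HL j Hj) as [A B].
    assert (Hr0 : 0 <= r) by lra.
    assert (Ny : forall m, (m <= Q)%nat -> An x0 r rho (fun x => y m x - c m))
      by (intros m Hm; apply near, Y1, Hy, Hm).
    assert (Nz : forall m, (m <= Q)%nat -> An x0 r rho (fun x => z m x - c m))
      by (intros m Hm; apply near, Y1, Hz, Hm).
    assert (Hj' : (j <= Q)%nat) by lia.
    split; [apply (A x0 r d (y j) (y (S j)) (z j) (z (S j)))
           |apply (B x0 r d (y j) (y (S j)) (z j) (z (S j)))]; auto.
  - intros n Hn.
    apply An_ext with (fun x => dirichlet_step y0 n x - dirichlet_step (fun n _ => c n) n x).
    + intros x Hx. assert (E := chain_dirichlet_step _ c x0 (conj G N) E0 EQ n Hn).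
      assert (E2 : dirichlet_step (fun n _ => c n) n x = c n + (x - x0))
        by (unfold dirichlet_step in E |- *; lra).
      rewrite E2. reflexivity.
    + apply dirichlet_step_lip; auto; [lra| |lra].
      intros j Hj. destruct (HL j Hj) as [A B].
      assert (Hr0 : 0 <= r) by lra.
      assert (N0 : forall m, An x0 r rho (fun x => y0 m x - c m)).
      { intros m. eapply An_le; [|apply Y0]. lra. }
      split; [apply (A x0 r r (y0 j) (y0 (S j)) (fun _ => c j) (fun _ => c (S j)))
             |apply (B x0 r r (y0 j) (y0 (S j)) (fun _ => c j) (fun _ => c (S j)))];
        auto.
  - exists r. split; [exact r0|]. intros n Hn.
    eapply An_ext; [|apply (An_le x0 r (2 * r)); [lra | exact (Y1 y n (Hy1 n Hn))]].
    intros x Hx. simpl. f_equal.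
    destruct (htau x) as [T1 [T2 T3]].
    destruct (dirichlet_step_chain L y x) as [U1 [U2 U3]].
    + intros m Hm. now apply Hy2.
    + intros m Hm.
      assert (A := An_bound _ _ _ _ x (Hy1 m ltac:(lia)) Hx).
      assert (B := An_bound _ _ _ _ x (Hy1 (S m) ltac:(lia)) Hx).
      apply Rabs_le_between in A, B. unfold y0 in A, B. specialize (G m Hm). lra.
    + apply (chain_unique (tau x) (fun n => y n x)); auto.
      * apply chain_weaken with (2 * L); auto. lra.
      * now rewrite U2, T2.
      * now rewrite U3, T3.
Qed.

(** * The periodic action *)

Hypothesis hper : periodic1 f.
Variable p : Z.
Hypothesis hp : P = IZR p.

Lemma f_shift (m : Z) x : f (x + IZR m) = f x.
Proof. exact (periodic_IZR f hper m x). Qed.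

Lemma f1_shift (m : Z) x : Derive f (x + IZR m) = Derive f x.
Proof. exact (periodic_IZR (Derive f) (periodic_Derive f hper) m x). Qed.

Lemma divdiff_shift (m : Z) a b : divdiff f (a + IZR m) (b + IZR m) = divdiff f a b.
Proof.
  unfold divdiff. rewrite !f_shift. f_equal. ring.
Qed.

Lemma leave_vel_shift (m : Z) a b :
  leave_vel (a + IZR m) (b + IZR m) = leave_vel a b.
Proof. unfold leave_vel. rewrite divdiff_shift, f1_shift. ring. Qed.

Lemma arrive_vel_shift (m : Z) a b :
  arrive_vel (a + IZR m) (b + IZR m) = arrive_vel a b.
Proof. unfold arrive_vel. rewrite divdiff_shift, f1_shift. ring. Qed.

Lemma chain_shift l (m : Z) t : chain l t -> chain l (fun n => t n + IZR m).
Proof.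
  intros [G N]. split.
  - intros n Hn. specialize (G n Hn). lra.
  - intros n Hn. unfold node. rewrite leave_vel_shift, arrive_vel_shift. now apply N.
Qed.

Lemma tau_chain x : chain L (tau x).
Proof. apply chain_weaken with (2 * L); [lra | apply htau]. Qed.

Lemma tau_0 x : tau x 0%nat = x.
Proof. apply htau. Qed.

Lemma tau_end x : tau x Q = x + P.
Proof. apply htau. Qed.

Lemma tau_gap x n : (n < Q)%nat -> L <= tau x (S n) - tau x n.
Proof. apply (tau_chain x). Qed.

Lemma tau_gap_last x : L <= tau x Q - tau x (pred Q).
Proof.
  assert (H := tau_gap x (pred Q) ltac:(lia)). now replace (S (pred Q)) with Q in H by lia.
Qed.

Lemma tau_shift (m : Z) x n : (n <= Q)%nat -> tau (x + IZR m) n = tau x n + IZR m.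
Proof.
  intros Hn. apply (chain_unique (fun n => tau x n + IZR m)); auto using chain_shift, tau_chain.
  - now rewrite !tau_0.
  - rewrite !tau_end. ring.
Qed.

(** The graph of [vel_out] is the curve of chains in the time-velocity plane; up to the translation
    by [P], its image under [Q] bounces is the graph of [vel_in]. *)
Definition vel_out (x : R) : R := leave_vel (tau x 0%nat) (tau x 1%nat).
Definition vel_in (x : R) : R := arrive_vel (tau x (pred Q)) (tau x Q).

Lemma vel_out_shift (m : Z) x : vel_out (x + IZR m) = vel_out x.
Proof. unfold vel_out. rewrite !tau_shift by lia. apply leave_vel_shift. Qed.

Lemma vel_in_shift (m : Z) x : vel_in (x + IZR m) = vel_in x.
Proof. unfold vel_in. rewrite !tau_shift by lia. apply arrive_vel_shift. Qed.

Lemma leave_vel_near a b : a < b -> Rabs (leave_vel a b - g / 2 * (b - a)) <= 2 * M1.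
Proof.
  intros H. destruct (kicks_bound a b H) as [K _]. rewrite <- Rabs_Ropp in K.
  now replace (leave_vel a b - g / 2 * (b - a)) with (- leave_kick a b)
    by (unfold leave_vel, leave_kick; ring).
Qed.

Lemma arrive_vel_near a b : a < b -> Rabs (arrive_vel a b - g / 2 * (b - a)) <= 2 * M1.
Proof.
  intros H. destruct (kicks_bound a b H) as [_ K].
  now replace (arrive_vel a b - g / 2 * (b - a)) with (arrive_kick a b)
    by (unfold arrive_vel, arrive_kick; ring).
Qed.

Lemma L_dominates : 2 * M1 <= g * L / 4.
Proof.
  pose proof kap_bound. pose proof kap_le_g.
  assert (H1 : 4 * M1 / L <= g / 32) by lra.
  apply (Rmult_le_compat_r L) in H1; [|lra].
  replace (4 * M1 / L * L) with (4 * M1) in H1 by (field; lra).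
  pose proof gL_pos. lra.
Qed.

Lemma vel_pos a b : L <= b - a -> g * L / 4 <= leave_vel a b /\ g * L / 4 <= arrive_vel a b.
Proof.
  intros H. pose proof L_dominates.
  assert (g / 2 * L <= g / 2 * (b - a)) by (apply Rmult_le_compat_l; lra).
  assert (X := leave_vel_near a b ltac:(lra)). assert (Y := arrive_vel_near a b ltac:(lra)).
  apply Rabs_le_between in X, Y. lra.
Qed.

Lemma vel_out_pos x : 0 < vel_out x.
Proof.
  pose proof gL_pos.
  destruct (vel_pos (tau x 0%nat) (tau x 1%nat)); [apply tau_gap; lia|].
  unfold vel_out. lra.
Qed.

Lemma vel_in_pos x : 0 < vel_in x.
Proof.
  pose proof gL_pos.
  destruct (vel_pos (tau x (pred Q)) (tau x Q)).
  - apply tau_gap_last.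
  - unfold vel_in. lra.
Qed.

Lemma tau_analytic n x : (n <= Q)%nat -> analytic_at (fun x => tau x n) x.
Proof.
  intros Hn. destruct (chain_analytic x 1 Rlt_0_1) as [r [r0 Hr]].
  apply (An_analytic_at x r (1 + Rabs (tau x n))); [exact r0|].
  apply (An_shift x r 1 (fun x => tau x n)); [lra|]. now apply Hr.
Qed.

Lemma tau_lip_analytic Nn K i j x : 0 <= K -> (i <= Q)%nat -> (j <= Q)%nat ->
  lip_at Nn (tau x i) (tau x j) K -> analytic_at (fun x => Nn (tau x i) (tau x j)) x.
Proof.
  intros HK Hi Hj HN.
  destruct (lip_at_analytic Nn _ _ _ (fun x => tau x i) (fun x => tau x j) x HK HN)
    as [r [rho [r0 A]]].
  - intros rho rho0. destruct (chain_analytic x rho rho0) as [r [r0 Hr]].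
    exists r. auto.
  - now apply (An_analytic_at x r rho).
Qed.

Lemma vel_out_analytic : real_analytic vel_out.
Proof.
  intros x. pose proof M2_pos. pose proof kap_pos.
  assert (A : analytic_at (fun x => leave_kick (tau x 0%nat) (tau x 1%nat)) x).
  { apply (tau_lip_analytic leave_kick (M2 + kap)); try lia; [lra|].
    apply leave_kick_lip_at, tau_gap, hQ. }
  refine (analytic_at_ext _ _ _ _ (analytic_at_comb _ _ (g / 2) _
    (analytic_at_comb _ _ (- (g / 2)) _ (analytic_at_scal _ (-1) _ A)
      (tau_analytic 0 x ltac:(lia))) (tau_analytic 1 x ltac:(lia)))).
  intros y. unfold vel_out, leave_vel, leave_kick. ring.
Qed.

Lemma vel_in_analytic : real_analytic vel_in.
Proof.
  intros x. pose proof M2_pos. pose proof kap_pos.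
  assert (A : analytic_at (fun x => arrive_kick (tau x (pred Q)) (tau x Q)) x).
  { apply (tau_lip_analytic arrive_kick (M2 + kap)); try lia; [lra|].
    apply arrive_kick_lip_at, tau_gap_last. }
  refine (analytic_at_ext _ _ _ _ (analytic_at_comb _ _ (g / 2) _
    (analytic_at_comb _ _ (- (g / 2)) _ A
      (tau_analytic (pred Q) x ltac:(lia))) (tau_analytic Q x ltac:(lia)))).
  intros y. unfold vel_in, arrive_vel, arrive_kick. ring.
Qed.

(** Written with [-1 *] to match [analytic_at_comb]. *)
Definition defect (x : R) : R := vel_in x + -1 * vel_out x.

Lemma defect_analytic : real_analytic defect.
Proof. intros x. apply analytic_at_comb; [apply vel_in_analytic | apply vel_out_analytic]. Qed.

Lemma defect_shift (m : Z) x : defect (x + IZR m) = defect x.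
Proof. unfold defect. now rewrite vel_in_shift, vel_out_shift. Qed.

Lemma energy_analytic : real_analytic (fun x => / 2 * vel_out x ^ 2).
Proof.
  intros x. assert (A := vel_out_analytic x).
  refine (analytic_at_ext _ _ _ _ (analytic_at_scal _ (/ 2) _ (analytic_at_mult _ _ _ A A))).
  intros y. ring.
Qed.

(* The generating function of one bounce, without the terms
   [-(1/2) int f'^2 + g int f] over [[a, b]], which add up to a constant along
   chains from [x] to [x + P]. *)
Definition action (a b : R) : R :=
  - (g ^ 2 / 24) * (b - a) ^ 3 + (f b - f a) ^ 2 / (2 * (b - a))
  - g / 2 * (b - a) * (f a + f b).

(** [action_fst] and [action_snd] are the partial derivatives of [action]. The terms in [f] and its
    derivative stem from the omitted integrals; they cancel at every node and, by periodicity,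
    between [x] and [x + P]. *)
Definition action_fst (a b : R) : R :=
  / 2 * leave_vel a b ^ 2 - / 2 * Derive f a ^ 2 + g * f a.
Definition action_snd (a b : R) : R :=
  - (/ 2 * arrive_vel a b ^ 2 - / 2 * Derive f b ^ 2 + g * f b).

Lemma is_derive_action (u v : R -> R) (du dv x : R) :
  is_derive u x du -> is_derive v x dv -> u x < v x ->
  is_derive (fun y => action (u y) (v y)) x
    (action_fst (u x) (v x) * du + action_snd (u x) (v x) * dv).
Proof.
  intros Hu Hv Huv. unfold action.
  assert (Du : Derive (fun x => u x) x = du) by now apply is_derive_unique.
  assert (Dv : Derive (fun x => v x) x = dv) by now apply is_derive_unique.
  assert (Eu : ex_derive u x) by now exists du.
  assert (Ev : ex_derive v x) by now exists dv.
  pose proof (f_ex_derive (u x)). pose proof (f_ex_derive (v x)).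
  auto_derive.
  - repeat split; auto. lra.
  - rewrite Du, Dv. unfold action_fst, action_snd, leave_vel, arrive_vel, divdiff.
    change (Derive (fun x => f x)) with (Derive f). field. lra.
Qed.

Lemma action_node t n : node t n ->
  action_snd (t (pred n)) (t n) + action_fst (t n) (t (S n)) = 0.
Proof. unfold node, action_fst, action_snd. intros ->. ring. Qed.

Fixpoint chain_action (t : nat -> R) (n : nat) : R :=
  match n with O => 0 | S m => chain_action t m + action (t m) (t (S m)) end.

Lemma is_derive_chain_action x :
  is_derive (fun x => chain_action (tau x) Q) x (- / 2 * (vel_in x ^ 2 - vel_out x ^ 2)).
Proof.
  assert (D : forall n, (n <= Q)%nat ->
     is_derive (fun x => tau x n) x (Derive (fun x => tau x n) x)).
  { intros n Hn. apply Derive_correct, analytic_at_ex_derive, tau_analytic, Hn. }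
  assert (D0 : Derive (fun x => tau x 0%nat) x = 1).
  { rewrite (Derive_ext _ (fun x => x)); [apply Derive_id|]. intros; apply tau_0. }
  assert (DQ : Derive (fun x => tau x Q) x = 1).
  { apply is_derive_unique. apply (is_derive_ext (fun x => x + P)).
    - intros; symmetry; apply tau_end.
    - auto_derive; [exact I | ring]. }
  (* The node equations cancel the interior contributions: only the first boundary term and the
     current last one remain. *)
  assert (A : forall n, (n < Q)%nat ->
    is_derive (fun x => chain_action (tau x) (S n)) x
      (action_fst (tau x 0%nat) (tau x 1%nat) * 1
       + action_snd (tau x n) (tau x (S n)) * Derive (fun x => tau x (S n)) x)).
  { induction n as [|n IH]; intros Hn.
    - apply (is_derive_ext (fun x => action (tau x 0%nat) (tau x 1%nat))).
      + intros y. simpl. ring.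
      + rewrite <- D0 at 1.
        apply (is_derive_action (fun x => tau x 0%nat) (fun x => tau x 1%nat)).
        * apply D; lia.
        * apply D; lia.
        * pose proof (tau_gap x 0 Hn). lra.
    - evar_last.
      + apply (is_derive_plus (fun x => chain_action (tau x) (S n))
          (fun x => action (tau x (S n)) (tau x (S (S n))))).
        * apply IH. lia.
        * apply (is_derive_action (fun x => tau x (S n)) (fun x => tau x (S (S n)))).
          -- apply D; lia.
          -- apply D; lia.
          -- pose proof (tau_gap x (S n) Hn). lra.
      + assert (E := action_node (tau x) (S n) (proj2 (tau_chain x) (S n) ltac:(lia))).
        simpl pred in E. unfold plus; simpl.
        replace (action_snd (tau x n) (tau x (S n))) with
          (- action_fst (tau x (S n)) (tau x (S (S n)))) by lra.
        ring. }
  specialize (A (pred Q) ltac:(lia)).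
  replace (S (pred Q)) with Q in A by lia. rewrite DQ in A.
  evar_last; [exact A|].
  unfold action_fst, action_snd. fold (vel_out x) (vel_in x).
  rewrite tau_0, tau_end, hp, f_shift, f1_shift. field.
Qed.

Lemma chain_action_shift (m : Z) x : chain_action (tau (x + IZR m)) Q = chain_action (tau x) Q.
Proof.
  assert (A : forall n, (n <= Q)%nat ->
    chain_action (tau (x + IZR m)) n = chain_action (tau x) n).
  { induction n as [|n IH]; intros Hn; [reflexivity|].
    simpl. rewrite IH by lia. f_equal. rewrite !tau_shift by lia.
    unfold action. rewrite !f_shift. do 2 f_equal.
    - f_equal. f_equal. ring.
    - f_equal. ring.
    - f_equal. ring. }
  apply A. lia.
Qed.

Lemma derive_increasing (w dw : R -> R) (a b : R) : a < b ->
  (forall x, is_derive w x (dw x)) -> (forall x, a < x < b -> 0 < dw x) -> w a < w b.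
Proof.
  intros Hab D Hp.
  destruct (MVT_cor2 w dw a b Hab) as [c [E Hc]].
  - intros x _. apply is_derive_Reals, D.
  - specialize (Hp c Hc). assert (0 < dw c * (b - a)) by (apply Rmult_lt_0_compat; lra). lra.
Qed.

(** At a maximum of the periodic action [defect] vanishes. To the right of it, isolation of zeros
    and the intermediate value theorem leave a single sign, and the negative one would make the
    action exceed its maximum. *)
Lemma up_crossing :
  (forall c, exists r, 0 < r /\ forall x, 0 < Rabs (x - c) < r -> defect x <> 0) ->
  exists c r, 0 < r /\ defect c = 0 /\ forall x, c < x < c + r -> 0 < defect x.
Proof.
  intros iso.
  set (w := fun x => chain_action (tau x) Q).
  assert (Dw := is_derive_chain_action). fold w in Dw.
  assert (sign : forall x, - / 2 * (vel_in x ^ 2 - vel_out x ^ 2) =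
    - (/ 2 * (vel_in x + vel_out x)) * defect x) by (intros; unfold defect; field).
  assert (pos : forall x, 0 < / 2 * (vel_in x + vel_out x)).
  { intros x. pose proof (vel_in_pos x). pose proof (vel_out_pos x). lra. }
  destruct (continuity_ab_maj w 0 1) as [c [Hc _]]; [lra| |].
  { intros x _. apply continuity_pt_filterlim.
    apply (ex_derive_continuous w). eexists; apply Dw. }
  assert (Hmax : forall x, w x <= w c).
  { intros x. destruct (fractional x) as [m Hm].
    assert (E := chain_action_shift m x). fold (w (x + IZR m)) (w x) in E.
    rewrite <- E. apply Hc. lra. }
  destruct (iso c) as [r [r0 Hr]].
  assert (C : forall x, continuous defect x).
  { intros x. apply analytic_at_continuous, defect_analytic. }
  exists c, r. split; [exact r0|]. split.
  - assert (Z := deriv_maximum w (c - 1) (c + 1) c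
      (exist _ _ (proj1 (is_derive_Reals _ _ _) (Dw c)))
      ltac:(lra) ltac:(lra) (fun x _ _ => Hmax x)).
    change (- / 2 * (vel_in c ^ 2 - vel_out c ^ 2) = 0) in Z. rewrite sign in Z.
    apply Rmult_integral in Z. destruct Z as [Z|Z]; [specialize (pos c); lra|exact Z].
  - intros x Hx. apply Rnot_le_lt. intros Hle.
    assert (neg : forall y, c < y < c + r -> defect y < 0).
    { intros y Hy. apply Rnot_le_lt. intros Hge.
      assert (Z : exists z, c < z < c + r /\ defect z = 0).
      { destruct (IVT_gen defect x y 0) as [z [Hz Ez]].
        - intros u. apply continuity_pt_filterlim, C.
        - rewrite Rmin_left, Rmax_right; lra.
        - exists z. split; [|exact Ez].
          assert (c < Rmin x y) by (apply Rmin_glb_lt; lra).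
          assert (Rmax x y < c + r) by (apply Rmax_lub_lt; lra). lra. }
      destruct Z as [z [Hz Ez]]. apply (Hr z); auto. rewrite Rabs_pos_eq; lra. }
    assert (w c < w x); [|specialize (Hmax x); lra].
    apply (derive_increasing w _ _ _) with (2 := Dw); [lra|]. intros y Hy.
    rewrite sign. specialize (neg y ltac:(lra)).
    replace (- (/ 2 * (vel_in y + vel_out y)) * defect y) with
        (/ 2 * (vel_in y + vel_out y) * (- defect y)) by ring.
    apply Rmult_lt_0_compat; [apply pos | lra].
Qed.

Lemma chain_action_constant : (forall x, defect x = 0) ->
  forall x y, chain_action (tau x) Q = chain_action (tau y) Q.
Proof.
  intros H.
  assert (A : forall x y, x < y -> chain_action (tau x) Q = chain_action (tau y) Q).
  { intros x y Hxy.
    destruct (MVT_cor2 (fun x => chain_action (tau x) Q)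
      (fun x => - / 2 * (vel_in x ^ 2 - vel_out x ^ 2)) x y Hxy) as [c [E _]].
    - intros z _. apply is_derive_Reals, is_derive_chain_action.
    - assert (D : vel_in c = vel_out c) by (specialize (H c); unfold defect in H; lra).
      rewrite D in E. lra. }
  intros x y. destruct (Rtotal_order x y) as [?|[->|?]]; auto. symmetry; now apply A.
Qed.

(** * Drift along chains *)

(** Comparison with two chains of the family. [tau a] has the same start: by the twist, the larger
    velocity carries the last impact beyond [a + P]. [tau a'] has the same end: starting later, it
    arrives more slowly. *)
Lemma chain_step s : chain L s -> vel_out (s 0%nat) < leave_vel (s 0%nat) (s 1%nat) ->
  let a := s 0%nat in let a' := s Q - P in let v := leave_vel (s 0%nat) (s 1%nat) in
  a < a' /\ g / (8 * INR Q) * (a' - a) <= v - vel_out a <= 2 * g * (a' - a) /\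
  vel_in a' < arrive_vel (s (pred Q)) (s Q).
Proof.
  intros Hs Hv a a' v. change (vel_out a < v) in Hv. pose proof Q_ge_1 as q1.
  assert (E0 : s 0%nat = tau a 0%nat) by now rewrite tau_0.
  assert (le : tau a Q <= s Q).
  { apply Rnot_lt_le. intros Hlt.
    destruct (chain_twist_leave s (tau a) Hs (tau_chain a)) as [H _]; [auto | lra |].
    fold (vel_out a) v in H.
    assert (0 < g / (8 * INR Q) * (tau a Q - s Q)); [|lra].
    apply Rmult_lt_0_compat; [apply Rdiv_lt_0_compat|]; lra. }
  destruct (chain_twist_leave (tau a) s (tau_chain a) Hs E0 le) as [H1 H2].
  fold (vel_out a) v in H1, H2. rewrite tau_end in H1, H2.
  replace (s Q - (a + P)) with (a' - a) in H1, H2 by (unfold a'; ring).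
  assert (lt : a < a').
  { apply Rnot_le_lt. intros Hle.
    assert (2 * g * (a' - a) <= 0); [|lra].
    rewrite <- (Rmult_0_r (2 * g)). apply Rmult_le_compat_l; lra. }
  split; [exact lt|]. split; [now split|].
  destruct (chain_twist_arrive s (tau a') Hs (tau_chain a')) as [H3 _].
  - rewrite tau_end. unfold a'. ring.
  - rewrite tau_0. fold a. lra.
  - fold (vel_in a') in H3. rewrite tau_0 in H3. fold a in H3.
    assert (0 < g / (8 * INR Q) * (a' - a)); [|lra].
    apply Rmult_lt_0_compat; [apply Rdiv_lt_0_compat|]; lra.
Qed.

(** Every block of [Q] flights is translated back by [P] before the next one begins, so that the
    times [s k 0] show the drift alone. *)
Definition chain_orbit (s : nat -> nat -> R) : Prop :=
  forall k, chain L (s k) /\ s (S k) 0%nat = s k Q - P /\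
    leave_vel (s (S k) 0%nat) (s (S k) 1%nat) = arrive_vel (s k (pred Q)) (s k Q).

Lemma drift_up_crossing s b : chain_orbit s ->
  (forall x, s 0%nat 0%nat <= x <= b -> 0 < defect x) ->
  vel_out (s 0%nat 0%nat) < leave_vel (s 0%nat 0%nat) (s 0%nat 1%nat) ->
  exists k, b < s k 0%nat.
Proof.
  intros Hs Hpos Hv. apply NNPP. intros N.
  assert (Hb : forall k, s k 0%nat <= b).
  { intros k. apply Rnot_lt_le. intros H. apply N. now exists k. }
  set (a := s 0%nat 0%nat) in *.
  assert (ab : a <= b) by apply Hb.
  destruct (continuity_ab_min defect a b ab) as [z [Hz1 Hz2]].
  { intros x _. apply continuity_pt_filterlim, analytic_at_continuous, defect_analytic. }
  set (m := defect z). assert (m0 : 0 < m) by (apply Hpos; lra).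
  assert (mg : 0 < m / (2 * g)) by (apply Rdiv_lt_0_compat; lra).
  (* The initial excess over the curve may be arbitrarily small. After one block it exceeds the
     minimum [m] of [defect], and from then on each block advances by at least [m / (2 * g)]; hence
     the count starts with block 1. *)
  assert (claim : forall k,
    a + INR k * (m / (2 * g)) <= s (S k) 0%nat /\
    vel_out (s (S k) 0%nat) + m < leave_vel (s (S k) 0%nat) (s (S k) 1%nat)).
  { assert (next : forall k, a <= s k 0%nat ->
      vel_out (s k 0%nat) < leave_vel (s k 0%nat) (s k 1%nat) ->
      s k 0%nat < s (S k) 0%nat /\
      vel_out (s (S k) 0%nat) + m < leave_vel (s (S k) 0%nat) (s (S k) 1%nat)).
    { intros k Ha H. destruct (Hs k) as [C [E1 E2]].
      destruct (chain_step (s k) C H) as [S1 [_ S2]].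
      rewrite <- E1 in S1, S2. rewrite <- E2 in S2. split; [exact S1|].
      specialize (Hz1 (s (S k) 0%nat)). specialize (Hb (S k)).
      specialize (Hz1 ltac:(lra)). fold m in Hz1.
      unfold defect in Hz1. lra. }
    induction k as [|k [IH1 IH2]].
    - destruct (next 0%nat) as [N1 N2]; [unfold a; lra | exact Hv |].
      split; [simpl; unfold a; lra | exact N2].
    - assert (K0 : 0 <= INR k * (m / (2 * g))) by (apply Rmult_le_pos; [apply pos_INR|lra]).
      destruct (next (S k)) as [N1 N2]; [lra | lra |].
      split; [|exact N2].
      destruct (Hs (S k)) as [C [E1 E2]].
      destruct (chain_step (s (S k)) C ltac:(lra)) as [_ [[_ S1] _]].
      rewrite <- E1 in S1.
      assert (X : m / (2 * g) <= s (S (S k)) 0%nat - s (S k) 0%nat).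
      { apply Rmult_le_reg_l with (2 * g); [lra|].
        replace (2 * g * (m / (2 * g))) with m by (field; lra). lra. }
      rewrite S_INR. lra. }
  destruct (INR_unbounded ((b - a) / (m / (2 * g)))) as [k Hk].
  destruct (claim k) as [C _]. specialize (Hb (S k)).
  apply (Rmult_lt_compat_r (m / (2 * g))) in Hk; [|exact mg].
  unfold Rdiv in Hk at 1. rewrite Rmult_assoc, Rinv_l in Hk by lra. lra.
Qed.

(** * The trapezoidal rule with cubic error *)

Variable M3 : R.
Hypothesis hM3 : forall x, Rabs (Derive (Derive (Derive f)) x) <= M3.

(** [dx] and [dy] are directional derivatives at the two ends of a segment. The first six bounds are
    carried along to make the last one, the error of the rule, stable under products. *)
Definition trap (C h ux uy dx dy : R) : Prop :=
  Rabs ux <= C /\ Rabs uy <= C /\ Rabs (uy - ux) <= C * h /\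
  Rabs dx <= C * h /\ Rabs dy <= C * h /\ Rabs (dy - dx) <= C * h ^ 2 /\
  Rabs (uy - ux - / 2 * (dx + dy)) <= C * h ^ 3.

(* The trapezoidal rule for [u] with directional derivative [du], with cubic
   error, uniformly on pairs with gap in [[L, G]]. *)
Definition trapezoidal (G : R) (u : R -> R -> R) (du : R -> R -> R -> R -> R) : Prop :=
  exists C, 0 <= C /\ forall a b a' b' h,
    L <= b - a <= G -> L <= b' - a' <= G ->
    Rabs (a' - a) <= h -> Rabs (b' - b) <= h ->
    trap C h (u a b) (u a' b') (du a b (a' - a) (b' - b)) (du a' b' (a' - a) (b' - b)).

Lemma trap_plus C1 C2 h ux uy dx dy vx vy ex ey :
  trap C1 h ux uy dx dy -> trap C2 h vx vy ex ey ->
  trap (C1 + C2) h (ux + vx) (uy + vy) (dx + ex) (dy + ey).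
Proof.
  assert (T : forall x y z A B, Rabs x <= A -> Rabs y <= B -> z = x + y -> Rabs z <= A + B).
  { intros x y z A B Hx Hy ->. eapply Rle_trans; [apply Rabs_triang|]. lra. }
  intros (H1 & H2 & H3 & H4 & H5 & H6 & H7) (K1 & K2 & K3 & K4 & K5 & K6 & K7).
  unfold trap. rewrite !Rmult_plus_distr_r.
  repeat split; [exact (T _ _ _ _ _ H1 K1 eq_refl) | exact (T _ _ _ _ _ H2 K2 eq_refl)
    | apply (T _ _ _ _ _ H3 K3) | apply (T _ _ _ _ _ H4 K4) | apply (T _ _ _ _ _ H5 K5)
    | apply (T _ _ _ _ _ H6 K6) | apply (T _ _ _ _ _ H7 K7)]; ring.
Qed.

Lemma Rabs_mult_le x y A B : Rabs x <= A -> Rabs y <= B -> Rabs (x * y) <= A * B.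
Proof.
  intros Hx Hy. rewrite Rabs_mult. apply Rmult_le_compat; auto using Rabs_pos.
Qed.

Lemma trap_mult C1 C2 h ux uy dx dy vx vy ex ey : 0 <= h -> 0 <= C1 -> 0 <= C2 ->
  trap C1 h ux uy dx dy -> trap C2 h vx vy ex ey ->
  trap (4 * (C1 * C2)) h (ux * vx) (uy * vy) (dx * vx + ux * ex) (dy * vy + uy * ey).
Proof.
  intros Hh P1 P2 (H1 & H2 & H3 & H4 & H5 & H6 & H7) (K1 & K2 & K3 & K4 & K5 & K6 & K7).
  assert (P12 : 0 <= C1 * C2) by now apply Rmult_le_pos.
  assert (h2 : 0 <= C1 * C2 * h) by now apply Rmult_le_pos.
  assert (h3 : 0 <= C1 * C2 * h ^ 2) by (apply Rmult_le_pos; auto; now apply pow_le).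
  assert (h4 : 0 <= C1 * C2 * h ^ 3) by (apply Rmult_le_pos; auto; now apply pow_le).
  assert (T2 : forall x y z A B, Rabs x <= A -> Rabs y <= B -> z = x + y -> Rabs z <= A + B).
  { intros x y z A B Hx Hy ->. eapply Rle_trans; [apply Rabs_triang|]. lra. }
  assert (HA : Rabs (/ 2 * (ux + uy)) <= C1).
  { rewrite Rabs_mult, (Rabs_pos_eq (/ 2)) by lra.
    pose proof (Rabs_triang ux uy). lra. }
  assert (KA : Rabs (/ 2 * (vx + vy)) <= C2).
  { rewrite Rabs_mult, (Rabs_pos_eq (/ 2)) by lra.
    pose proof (Rabs_triang vx vy). lra. }
  unfold trap. repeat split.
  - apply Rle_trans with (C1 * C2); [now apply Rabs_mult_le | lra].
  - apply Rle_trans with (C1 * C2); [now apply Rabs_mult_le | lra].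
  - apply Rle_trans with (C1 * h * C2 + C1 * (C2 * h)); [|lra].
    eapply T2; [exact (Rabs_mult_le _ _ _ _ H3 K2) | exact (Rabs_mult_le _ _ _ _ H1 K3) | ring].
  - apply Rle_trans with (C1 * h * C2 + C1 * (C2 * h)); [|lra].
    eapply T2; [exact (Rabs_mult_le _ _ _ _ H4 K1) | exact (Rabs_mult_le _ _ _ _ H1 K4) | ring].
  - apply Rle_trans with (C1 * h * C2 + C1 * (C2 * h)); [|lra].
    eapply T2; [exact (Rabs_mult_le _ _ _ _ H5 K2) | exact (Rabs_mult_le _ _ _ _ H2 K5) | ring].
  - apply Rle_trans with ((C1 * h ^ 2 * C2 + C1 * h * (C2 * h)) +
      (C1 * h * (C2 * h) + C1 * (C2 * h ^ 2))); [|right; ring].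
    eapply T2; [eapply T2; [exact (Rabs_mult_le _ _ _ _ H6 K2)
                           |exact (Rabs_mult_le _ _ _ _ H4 K3) | reflexivity]
               |eapply T2; [exact (Rabs_mult_le _ _ _ _ H3 K5)
                           |exact (Rabs_mult_le _ _ _ _ H1 K6) | reflexivity] | ring].
  (* The error for the product is the mean of [u] times the error for [v], plus the mean of [v]
     times the error for [u], minus a quarter of each product of the increment of one factor with
     the increment of the derivative of the other. *)
  - apply Rle_trans with ((C1 * (C2 * h ^ 3) + C2 * (C1 * h ^ 3)) +
      (/ 4 * (C1 * h * (C2 * h ^ 2)) + / 4 * (C2 * h * (C1 * h ^ 2)))); [|lra].
    assert (Q4 : forall x A, Rabs x <= A -> Rabs (- / 4 * x) <= / 4 * A).
    { intros x A Hx. rewrite Rabs_mult, Rabs_left by lra. lra. }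
    eapply T2; [eapply T2; [exact (Rabs_mult_le _ _ _ _ HA K7)
                           |exact (Rabs_mult_le _ _ _ _ KA H7) | reflexivity]
               |eapply T2; [exact (Q4 _ _ (Rabs_mult_le _ _ _ _ H3 K6))
                           |exact (Q4 _ _ (Rabs_mult_le _ _ _ _ K3 H6)) | reflexivity] | field].
Qed.

Lemma trapezoidal_plus G u du v dv : trapezoidal G u du -> trapezoidal G v dv ->
  trapezoidal G (fun a b => u a b + v a b) (fun a b x y => du a b x y + dv a b x y).
Proof.
  intros [C1 [P1 H1]] [C2 [P2 H2]]. exists (C1 + C2). split; [lra|].
  intros. apply trap_plus; auto.
Qed.

Lemma trapezoidal_mult G u du v dv : trapezoidal G u du -> trapezoidal G v dv ->
  trapezoidal G (fun a b => u a b * v a b)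
    (fun a b x y => du a b x y * v a b + u a b * dv a b x y).
Proof.
  intros [C1 [P1 H1]] [C2 [P2 H2]]. exists (4 * (C1 * C2)).
  split; [assert (0 <= C1 * C2) by (now apply Rmult_le_pos); lra|].
  intros a b a' b' h Hg Hg' Ha Hb. apply trap_mult; auto.
  eapply Rle_trans; [apply Rabs_pos | exact Ha].
Qed.

Lemma trapezoidal_ext G u du v dv :
  (forall a b, L <= b - a -> u a b = v a b) ->
  (forall a b x y, L <= b - a -> du a b x y = dv a b x y) ->
  trapezoidal G u du -> trapezoidal G v dv.
Proof.
  intros E1 E2 [C [P0 H]]. exists C. split; [exact P0|].
  intros a b a' b' h Hg Hg' Ha Hb.
  rewrite <- !E1, <- !E2 by lra. now apply H.
Qed.

Lemma trapezoidal_const G c : trapezoidal G (fun _ _ => c) (fun _ _ _ _ => 0).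
Proof.
  exists (Rabs c). split; [apply Rabs_pos|].
  intros a b a' b' h Hg Hg' Ha Hb.
  assert (h0 : 0 <= h) by (eapply Rle_trans; [apply Rabs_pos | exact Ha]).
  assert (0 <= Rabs c * h) by (apply Rmult_le_pos; auto using Rabs_pos).
  assert (0 <= Rabs c * h ^ 2) by (apply Rmult_le_pos; auto using Rabs_pos, pow_le).
  assert (0 <= Rabs c * h ^ 3) by (apply Rmult_le_pos; auto using Rabs_pos, pow_le).
  unfold trap. rewrite !Rminus_diag, Rplus_0_r, Rmult_0_r, Rminus_0_r, Rabs_R0.
  repeat split; lra.
Qed.

Lemma trapezoidal_gap G : 0 <= G ->
  trapezoidal G (fun a b => b - a) (fun _ _ x y => y - x).
Proof.
  intros HG. exists (G + 2). split; [lra|].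
  intros a b a' b' h Hg Hg' Ha Hb.
  assert (h0 : 0 <= h) by (eapply Rle_trans; [apply Rabs_pos | exact Ha]).
  assert (D : Rabs (b' - b - (a' - a)) <= (G + 2) * h).
  { eapply Rle_trans; [apply Rabs_triang|]. rewrite Rabs_Ropp.
    assert (0 <= G * h) by now apply Rmult_le_pos. lra. }
  assert (0 <= (G + 2) * h ^ 2) by (apply Rmult_le_pos; [lra|now apply pow_le]).
  assert (0 <= (G + 2) * h ^ 3) by (apply Rmult_le_pos; [lra|now apply pow_le]).
  unfold trap. repeat split.
  - rewrite Rabs_pos_eq; lra.
  - rewrite Rabs_pos_eq; lra.
  - now replace (b' - a' - (b - a)) with (b' - b - (a' - a)) by ring.
  - exact D.
  - exact D.
  - now rewrite Rminus_diag, Rabs_R0.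
  - match goal with |- Rabs ?w <= _ => replace w with 0 by field end. now rewrite Rabs_R0.
Qed.

Lemma trapezoidal_inv_gap G :
  trapezoidal G (fun a b => / (b - a)) (fun a b x y => - (y - x) * (/ (b - a)) ^ 2).
Proof.
  set (i := / L). assert (i0 : 0 < i) by now apply Rinv_0_lt_compat.
  assert (i2 : 0 < i ^ 2) by now apply pow_lt.
  assert (i3 : 0 < i ^ 3) by now apply pow_lt.
  assert (i4 : 0 < i ^ 4) by now apply pow_lt.
  exists (i + 2 * i ^ 2 + 8 * i ^ 3 + 4 * i ^ 4). split; [lra|].
  intros a b a' b' h Hg Hg' Ha Hb.
  assert (h0 : 0 <= h) by (eapply Rle_trans; [apply Rabs_pos | exact Ha]).
  set (x := / (b - a)). set (y := / (b' - a')).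
  set (d := b' - b - (a' - a)).
  assert (Hx : Rabs x <= i).
  { unfold x, i. rewrite Rabs_pos_eq; [apply Rinv_le_contravar; lra|].
    left; apply Rinv_0_lt_compat; lra. }
  assert (Hy : Rabs y <= i).
  { unfold y, i. rewrite Rabs_pos_eq; [apply Rinv_le_contravar; lra|].
    left; apply Rinv_0_lt_compat; lra. }
  assert (Hd : Rabs d <= 2 * h).
  { unfold d. eapply Rle_trans; [apply Rabs_triang|]. rewrite Rabs_Ropp. lra. }
  assert (Hxy : y - x = - (x * y * d)) by (unfold x, y, d; field; lra).
  assert (Hyx : Rabs (y - x) <= i * i * (2 * h)).
  { rewrite Hxy, Rabs_Ropp. now repeat apply Rabs_mult_le. }
  assert (Hm : Rabs (x + y) <= 2 * i) by (pose proof (Rabs_triang x y); lra).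
  assert (k1 : 0 <= i * h) by (apply Rmult_le_pos; lra).
  assert (k2 : 0 <= i ^ 2 * h) by (apply Rmult_le_pos; lra).
  assert (k3 : 0 <= i ^ 3 * h) by (apply Rmult_le_pos; lra).
  assert (k4 : 0 <= i ^ 4 * h) by (apply Rmult_le_pos; lra).
  assert (q : 0 <= h ^ 2) by now apply pow_le.
  assert (c : 0 <= h ^ 3) by now apply pow_le.
  assert (D1 : forall z, Rabs z <= i -> Rabs (- d * z ^ 2) <= 2 * h * (i * (i * 1))).
  { intros z Hz. apply Rabs_mult_le; [now rewrite Rabs_Ropp|]. simpl.
    repeat apply Rabs_mult_le; auto. rewrite Rabs_R1. lra. }
  unfold trap. repeat split.
  - lra.
  - lra.
  - eapply Rle_trans; [exact Hyx|]. lra.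
  - eapply Rle_trans; [apply D1, Hx|]. lra.
  - eapply Rle_trans; [apply D1, Hy|]. lra.
  - replace (- d * y ^ 2 - - d * x ^ 2) with (- d * ((y - x) * (x + y))) by ring.
    eapply Rle_trans; [apply Rabs_mult_le; [rewrite Rabs_Ropp; exact Hd|
      apply Rabs_mult_le; [exact Hyx | exact Hm]]|].
    assert (0 <= i * h ^ 2) by (apply Rmult_le_pos; lra).
    assert (0 <= i ^ 2 * h ^ 2) by (apply Rmult_le_pos; lra).
    assert (0 <= i ^ 4 * h ^ 2) by (apply Rmult_le_pos; lra).
    replace (2 * h * (i * i * (2 * h) * (2 * i))) with (8 * (i ^ 3 * h ^ 2)) by ring. lra.
  (* By [y - x = - (x * y * d)] the error is exactly half of [d * (y - x) ^ 2], and both [d] and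
     [y - x] are of order [h]. *)
  - assert (E : y - x - / 2 * (- d * x ^ 2 + - d * y ^ 2) = / 2 * (d * ((y - x) * (y - x)))).
    { replace (y - x - / 2 * (- d * x ^ 2 + - d * y ^ 2)) with
        (y - x + x * y * d + / 2 * (d * ((y - x) * (y - x)))) by field.
      rewrite Hxy at 1. ring. }
    rewrite E, Rabs_mult, (Rabs_pos_eq (/ 2)) by lra.
    assert (X := Rabs_mult_le _ _ _ _ Hd (Rabs_mult_le _ _ _ _ Hyx Hyx)).
    replace (2 * h * (i * i * (2 * h) * (i * i * (2 * h)))) with (8 * (i ^ 4 * h ^ 3)) in X by ring.
    assert (0 <= i * h ^ 3) by (apply Rmult_le_pos; lra).
    assert (0 <= i ^ 2 * h ^ 3) by (apply Rmult_le_pos; lra).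
    assert (0 <= i ^ 3 * h ^ 3) by (apply Rmult_le_pos; lra). lra.
Qed.

Lemma trap_f x y h : Rabs (y - x) <= h ->
  trap (M0 + M1 + M2 + M3) h (f x) (f y) (Derive f x * (y - x)) (Derive f y * (y - x)).
Proof.
  intros Hh. assert (h0 : 0 <= h) by (eapply Rle_trans; [apply Rabs_pos | exact Hh]).
  pose proof M0_pos. pose proof M1_pos. pose proof M2_pos.
  assert (m3 : 0 <= M3) by (eapply Rle_trans; [apply Rabs_pos | apply (hM3 0)]).
  assert (S1 : forall C, C <= M0 + M1 + M2 + M3 -> forall w, 0 <= w ->
    C * w <= (M0 + M1 + M2 + M3) * w) by (intros; now apply Rmult_le_compat_r).
  unfold trap. repeat split.
  - specialize (hM0 x). lra.
  - specialize (hM0 y). lra.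
  - eapply Rle_trans; [apply f_lipschitz|].
    eapply Rle_trans; [apply Rmult_le_compat_l; [lra|exact Hh]|]. apply S1; lra.
  - eapply Rle_trans; [apply Rabs_mult_le; [apply hM1 | exact Hh]|]. apply S1; lra.
  - eapply Rle_trans; [apply Rabs_mult_le; [apply hM1 | exact Hh]|]. apply S1; lra.
  - rewrite <- Rmult_minus_distr_r.
    eapply Rle_trans; [apply Rabs_mult_le; [apply f1_lipschitz | exact Hh]|].
    apply Rle_trans with (M2 * h * h).
    + apply Rmult_le_compat_r; [exact h0|]. apply Rmult_le_compat_l; lra.
    + replace (M2 * h * h) with (M2 * h ^ 2) by ring. apply S1; [lra|now apply pow_le].
  (* The error as a function of the right end. By the mean value theorem its derivative is half a
     difference of second derivatives of [f] times [z - x], hence of order [h ^ 2]. *)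
  - set (psi := fun z => f z - f x - / 2 * (Derive f x * (z - x) + Derive f z * (z - x))).
    assert (E : psi x = 0) by (unfold psi; field).
    assert (D : forall z, is_derive psi z
       (/ 2 * ((Derive f z - Derive f x) - Derive (Derive f) z * (z - x)))).
    { intros z. unfold psi. pose proof (f_ex_derive z). pose proof (f1_ex_derive z).
      auto_derive; [repeat split; auto|].
      change (Derive (fun x => f x)) with (Derive f).
      change (Derive (fun x => Derive f x)) with (Derive (Derive f)). field. }
    assert (f2d : forall z, ex_derive (Derive (Derive f)) z).
    { intros z. apply analytic_at_ex_derive.
      apply (real_analytic_Derive _ (real_analytic_Derive f hf)). }
    replace (f y - f x - / 2 * (Derive f x * (y - x) + Derive f y * (y - x)))
      with (psi y - psi x) by (rewrite E; unfold psi; ring).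
    apply Rle_trans with (M3 * h ^ 2 * Rabs (y - x)).
    + apply (bounded_variation psi (fun z =>
        / 2 * ((Derive f z - Derive f x) - Derive (Derive f) z * (z - x)))).
      intros z Hz. split; [apply D|].
      destruct (MVT_gen (Derive f) x z (Derive (Derive f))) as [c [Hc Ec]].
      { intros; apply Derive_correct, f1_ex_derive. }
      { intros; apply continuity_pt_filterlim, (ex_derive_continuous (Derive f)), f1_ex_derive. }
      assert (Hcz : Rabs (c - z) <= h).
      { apply Rle_trans with (Rabs (z - x)); [|lra].
        unfold Rmin, Rmax in Hc. destruct (Rle_dec x z).
        - rewrite Rabs_left1, (Rabs_pos_eq (z - x)); lra.
        - rewrite Rabs_pos_eq, (Rabs_left1 (z - x)); lra. }
      assert (D2 := derive_bound_lipschitz (Derive (Derive f)) M3 z c f2d hM3).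
      rewrite Ec, <- Rmult_minus_distr_r.
      apply Rle_trans with (1 * (M3 * h * h)); [|right; ring].
      apply Rabs_mult_le; [rewrite Rabs_pos_eq; lra|].
      apply Rabs_mult_le; [|lra].
      eapply Rle_trans; [exact D2|]. now apply Rmult_le_compat_l.
    + apply Rle_trans with (M3 * h ^ 2 * h).
      * apply Rmult_le_compat_l; [|exact Hh]. apply Rmult_le_pos; auto using pow_le.
      * replace (M3 * h ^ 2 * h) with (M3 * h ^ 3) by ring. apply S1; [lra|now apply pow_le].
Qed.

Lemma trapezoidal_f_fst G : trapezoidal G (fun a _ => f a) (fun a _ x _ => Derive f a * x).
Proof.
  exists (M0 + M1 + M2 + M3). split.
  - eapply Rle_trans; [apply Rabs_pos|]. apply (trap_f 0 0 0). rewrite Rminus_diag, Rabs_R0. lra.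
  - intros. now apply trap_f.
Qed.

Lemma trapezoidal_f_snd G : trapezoidal G (fun _ b => f b) (fun _ b _ y => Derive f b * y).
Proof.
  exists (M0 + M1 + M2 + M3). split.
  - eapply Rle_trans; [apply Rabs_pos|]. apply (trap_f 0 0 0). rewrite Rminus_diag, Rabs_R0. lra.
  - intros. now apply trap_f.
Qed.

(** The action is a polynomial in the gap, its inverse and the values of [f] at the ends, for each
    of which the rule has been established. *)
Lemma trapezoidal_action G : 0 <= G -> trapezoidal G action
  (fun a b x y => action_fst a b * x + action_snd a b * y).
Proof.
  intros HG.
  assert (D := trapezoidal_gap G HG).
  assert (I := trapezoidal_inv_gap G).
  assert (F1 := trapezoidal_f_fst G). assert (F2 := trapezoidal_f_snd G).
  assert (K := trapezoidal_const G).
  assert (DF := trapezoidal_plus _ _ _ _ _ F2 (trapezoidal_mult _ _ _ _ _ (K (-1)) F1)).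
  assert (T1 := trapezoidal_mult _ _ _ _ _ (K (- (g ^ 2 / 24)))
    (trapezoidal_mult _ _ _ _ _ D (trapezoidal_mult _ _ _ _ _ D D))).
  assert (T2 := trapezoidal_mult _ _ _ _ _ (K (/ 2))
    (trapezoidal_mult _ _ _ _ _ DF (trapezoidal_mult _ _ _ _ _ DF I))).
  assert (T3 := trapezoidal_mult _ _ _ _ _ (K (- (g / 2)))
    (trapezoidal_mult _ _ _ _ _ D (trapezoidal_plus _ _ _ _ _ F1 F2))).
  assert (T := trapezoidal_plus _ _ _ _ _ (trapezoidal_plus _ _ _ _ _ T1 T2) T3).
  eapply trapezoidal_ext; [| |exact T].
  - intros a b H. cbv beta. unfold action. field. lra.
  - intros a b x y H. cbv beta.
    unfold action_fst, action_snd, leave_vel, arrive_vel, divdiff. field. lra.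
Qed.

Lemma chain_gap_upper t n : chain L t -> (n < Q)%nat -> t (S n) - t n <= t Q - t 0%nat.
Proof.
  intros [H _] Hn.
  assert (A : forall m, (m <= Q)%nat -> t 0%nat <= t m).
  { induction m as [|m IH]; intros Hm; [lra|].
    specialize (IH ltac:(lia)). specialize (H m ltac:(lia)). lra. }
  assert (B : forall k m, (m + k = Q)%nat -> t m <= t Q).
  { induction k as [|k IH]; intros m Hm.
    - replace m with Q by lia. lra.
    - specialize (IH (S m) ltac:(lia)). specialize (H m ltac:(lia)). lra. }
  specialize (A n ltac:(lia)). specialize (B (Q - S n)%nat (S n) ltac:(lia)). lra.
Qed.

(* Chains are critical points of the action with fixed ends, so that only the
   boundary terms of the trapezoidal rule survive. *)
Lemma chain_trapezoid : exists C, 0 <= C /\ forall t t' h, chain L t -> chain L t' ->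
  t Q - t 0%nat <= P + 1 -> t' Q - t' 0%nat <= P + 1 ->
  (forall n, (n <= Q)%nat -> Rabs (t' n - t n) <= h) ->
  Rabs (chain_action t' Q - chain_action t Q
    - / 2 * ((action_fst (t 0%nat) (t 1%nat) + action_fst (t' 0%nat) (t' 1%nat))
               * (t' 0%nat - t 0%nat)
             + (action_snd (t (pred Q)) (t Q) + action_snd (t' (pred Q)) (t' Q))
               * (t' Q - t Q))) <= C * h ^ 3.
Proof.
  assert (G0 : 0 <= P + 1).
  { assert (A := chain_gap_upper (tau 0) 0 (tau_chain 0) hQ).
    assert (B := tau_gap 0 0 hQ). rewrite tau_end, tau_0 in A. rewrite tau_0 in B. lra. }
  destruct (trapezoidal_action (P + 1) G0) as [C [C0 HC]].
  exists (INR Q * C). split; [apply Rmult_le_pos; [apply pos_INR|exact C0]|].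
  intros t t' h Ht Ht' Hg Hg' Hd.
  assert (A : forall n, (n < Q)%nat ->
    Rabs (chain_action t' (S n) - chain_action t (S n)
    - / 2 * ((action_fst (t 0%nat) (t 1%nat) + action_fst (t' 0%nat) (t' 1%nat))
               * (t' 0%nat - t 0%nat)
             + (action_snd (t n) (t (S n)) + action_snd (t' n) (t' (S n)))
               * (t' (S n) - t (S n)))) <= INR (S n) * C * h ^ 3).
  { assert (one : forall n, (n < Q)%nat -> Rabs (action (t' n) (t' (S n)) - action (t n) (t (S n))
      - / 2 * (action_fst (t n) (t (S n)) * (t' n - t n) + action_snd (t n) (t (S n)) * (t' (S n) - t (S n))
       + (action_fst (t' n) (t' (S n)) * (t' n - t n) + action_snd (t' n) (t' (S n)) * (t' (S n) - t (S n)))))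
       <= C * h ^ 3).
    { intros n Hn.
      assert (X := proj1 Ht n Hn). assert (X' := proj1 Ht' n Hn).
      assert (Y := chain_gap_upper t n Ht Hn). assert (Y' := chain_gap_upper t' n Ht' Hn).
      apply (HC (t n) (t (S n)) (t' n) (t' (S n)) h ltac:(lra) ltac:(lra)
        (Hd n ltac:(lia)) (Hd (S n) ltac:(lia))). }
    induction n as [|n IH]; intros Hn.
    - specialize (one 0%nat Hn). simpl chain_action. simpl INR. rewrite Rmult_1_l.
      eapply Rle_trans; [right|exact one]. f_equal. field.
    - specialize (one (S n) Hn). specialize (IH ltac:(lia)).
      assert (N := action_node t (S n) (proj2 Ht (S n) ltac:(lia))).
      assert (N' := action_node t' (S n) (proj2 Ht' (S n) ltac:(lia))).
      simpl pred in N, N'.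
      rewrite (S_INR (S n)), !Rmult_plus_distr_r, Rmult_1_l.
      eapply Rle_trans; [|exact (Rplus_le_compat _ _ _ _ IH one)].
      eapply Rle_trans; [right|apply Rabs_triang]. f_equal.
      change (chain_action t' (S (S n))) with (chain_action t' (S n) + action (t' (S n)) (t' (S (S n)))).
      change (chain_action t (S (S n))) with (chain_action t (S n) + action (t (S n)) (t (S (S n)))).
      replace (action_snd (t n) (t (S n))) with (- action_fst (t (S n)) (t (S (S n)))) by lra.
      replace (action_snd (t' n) (t' (S n))) with (- action_fst (t' (S n)) (t' (S (S n)))) by lra.
      field. }
  specialize (A (pred Q) ltac:(lia)). replace (S (pred Q)) with Q in A by lia. exact A.
Qed.

(* Next to a curve of periodic points, the height above the curve changes by a
   quadratic amount only; this is the conservation of area. *)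
Lemma excess_variation : (forall x, defect x = 0) ->
  exists C, 0 <= C /\ forall s, chain L s ->
    let a := s 0%nat in let a' := s Q - P in a < a' <= a + 1 ->
    Rabs ((/ 2 * arrive_vel (s (pred Q)) (s Q) ^ 2 - / 2 * vel_out a' ^ 2)
        - (/ 2 * leave_vel (s 0%nat) (s 1%nat) ^ 2 - / 2 * vel_out a ^ 2))
      <= C * (a' - a) ^ 2.
Proof.
  intros Hdef. destruct chain_trapezoid as [C [C0 HC]].
  (* The chain [s], from [a] to [a' + P], is compared with [tau a] and with [tau a']; of the two
     ends only the last, respectively the first, differs, by [h]. The actions of [tau a] and
     [tau a'] are equal, so the sum of the two estimates is [h / 2] times the change of the excess,
     with error [2 * C * (2 * h) ^ 3]. *)
  exists (32 * C). split; [lra|].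
  intros s Hs a a' Ha. set (h := a' - a).
  assert (h0 : 0 < h) by (unfold h; lra).
  assert (Es : s Q = a' + P) by (unfold a'; ring).
  assert (D1 : forall n, (n <= Q)%nat -> Rabs (s n - tau a n) <= 2 * h).
  { apply chain_compare; auto using tau_chain.
    - rewrite tau_0. fold a. rewrite Rminus_diag, Rabs_R0. lra.
    - rewrite tau_end, Es. replace (a' + P - (a + P)) with h by (unfold h; ring).
      rewrite Rabs_pos_eq; lra. }
  assert (D2 : forall n, (n <= Q)%nat -> Rabs (tau a' n - s n) <= 2 * h).
  { apply chain_compare; auto using tau_chain.
    - rewrite tau_0. fold a h. rewrite Rabs_pos_eq; lra.
    - rewrite tau_end, Es, Rminus_diag, Rabs_R0. lra. }
  assert (T1 := HC (tau a) s (2 * h) (tau_chain a) Hs).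
  assert (T2 := HC s (tau a') (2 * h) Hs (tau_chain a')).
  rewrite !tau_end, !tau_0, Es in T1. rewrite !tau_end, !tau_0, Es in T2.
  fold a in T1, T2.
  specialize (T1 ltac:(lra) ltac:(lra) D1). specialize (T2 ltac:(lra) ltac:(lra) D2).
  rewrite (chain_action_constant Hdef a' a) in T2.
  assert (W : forall x, vel_in x = vel_out x).
  { intros x. specialize (Hdef x). unfold defect in Hdef. lra. }
  apply Rmult_le_reg_l with (h / 2); [lra|].
  rewrite <- (Rabs_pos_eq (h / 2)) at 1 by lra. rewrite <- Rabs_mult.
  eapply Rle_trans; [|eapply Rle_trans; [exact (Rplus_le_compat _ _ _ _ T1 T2)|]].
  - eapply Rle_trans; [right|apply Rabs_triang].
    f_equal. unfold action_fst, action_snd.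
    fold (vel_out a) (vel_out a') .
    rewrite <- !Es.
    assert (V1 : leave_vel a (tau a 1%nat) = vel_out a) by (unfold vel_out; now rewrite tau_0).
    assert (V2 : leave_vel a' (tau a' 1%nat) = vel_out a') by (unfold vel_out; now rewrite tau_0).
    assert (V3 : arrive_vel (tau a (pred Q)) (a + P) = vel_out a)
      by (rewrite <- W; unfold vel_in; now rewrite tau_end).
    rewrite V1, V2, V3, Es, hp, !f_shift, !f1_shift.
    replace (s 0%nat) with a by reflexivity. unfold h. field.
  - right. unfold h. field.
Qed.

Lemma vel_upper a b : L <= b - a <= P + 1 ->
  leave_vel a b <= g / 2 * (P + 1) + 2 * M1.
Proof.
  intros H. assert (X := leave_vel_near a b ltac:(lra)). apply Rabs_le_between in X.
  assert (g / 2 * (b - a) <= g / 2 * (P + 1)) by (apply Rmult_le_compat_l; lra). lra.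
Qed.

(** By the twist a step [d] is at most [C1] times the excess energy [I], so the change of [I], at
    most [C * d ^ 2], is at most [C2 * I * d]: the relative loss is proportional to the distance
    covered. Over the length [eta] half of [I] survives, and [eta] does not depend on the initial
    excess; this uniformity is what contradicts stability. *)
Lemma drift_degenerate : (forall x, defect x = 0) ->
  exists eta, 0 < eta /\ forall s, chain_orbit s ->
    vel_out (s 0%nat 0%nat) < leave_vel (s 0%nat 0%nat) (s 0%nat 1%nat) ->
    exists k, s 0%nat 0%nat + eta < s k 0%nat.
Proof.
  intros Hdef. destruct (excess_variation Hdef) as [C [C0 HC]].
  pose proof Q_ge_1 as q1. pose proof M1_pos as m1.
  set (vmin := g * L / 4).
  assert (vm0 : 0 < vmin) by (unfold vmin; pose proof gL_pos; lra).
  set (vmax := g / 2 * (P + 1) + 2 * M1).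
  assert (out_le : forall x, vmin <= vel_out x <= vmax).
  { intros x. assert (G := tau_gap x 0 hQ).
    assert (G' := chain_gap_upper (tau x) 0 (tau_chain x) hQ).
    rewrite tau_end, tau_0 in G'. rewrite tau_0 in G.
    unfold vel_out. rewrite tau_0. split; [now apply vel_pos | apply vel_upper; lra]. }
  assert (vM0 : 0 < vmax) by (specialize (out_le 0); lra).
  set (C1 := 8 * INR Q / (g * vmin)).
  assert (C10 : 0 < C1) by (apply Rdiv_lt_0_compat; [lra|now apply Rmult_lt_0_compat]).
  set (C2 := C * C1).
  assert (C20 : 0 <= C2) by (apply Rmult_le_pos; lra).
  (* [C2 * eta <= / 2] preserves half of the excess, and [eta <= 1] keeps every step within the
     range of [excess_variation]. *)
  set (eta := / (2 * (C2 + 1))).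
  assert (eta0 : 0 < eta) by (apply Rinv_0_lt_compat; lra).
  assert (eta1 : C2 * eta <= / 2).
  { apply Rmult_le_reg_r with (2 * (C2 + 1)); [lra|]. unfold eta.
    rewrite Rmult_assoc, Rinv_l by lra. lra. }
  assert (eta2 : eta <= 1).
  { rewrite <- Rinv_1. apply Rinv_le_contravar; lra. }
  exists eta. split; [exact eta0|].
  intros s Hs Hv. apply NNPP. intros N.
  assert (Hb : forall k, s k 0%nat <= s 0%nat 0%nat + eta).
  { intros k. apply Rnot_lt_le. intros H. apply N. now exists k. }
  set (a := fun k => s k 0%nat).
  set (v := fun k => leave_vel (s k 0%nat) (s k 1%nat)).
  set (I := fun k => / 2 * v k ^ 2 - / 2 * vel_out (a k) ^ 2).
  assert (step : forall k, a 0%nat <= a k -> vel_out (a k) < v k ->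
    a k < a (S k) /\ vel_out (a (S k)) < v (S k) /\ 0 < I k /\
    I k * (1 - C2 * (a (S k) - a k)) <= I (S k) /\ I k <= 2 * g * vmax * (a (S k) - a k)).
  { intros k Hk H. destruct (Hs k) as [Ch [E1 E2]].
    destruct (chain_step (s k) Ch H) as [S1 [[S2 S2'] S3]].
    rewrite <- E1 in S1, S2, S2', S3. rewrite <- E2 in S3.
    assert (Hk' := Hb (S k)). fold (a (S k)) in Hk'. fold (a 0%nat) in Hk'.
    fold (v k) (v (S k)) (a k) (a (S k)) in S1, S2, S2', S3.
    assert (W : vel_in (a (S k)) = vel_out (a (S k))).
    { specialize (Hdef (a (S k))). unfold defect in Hdef. lra. }
    rewrite W in S3. split; [exact S1|]. split; [exact S3|].
    specialize (HC (s k) Ch). cbv zeta in HC. rewrite <- E1, <- E2 in HC.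
    fold (v k) (v (S k)) (a k) (a (S k)) in HC.
    specialize (HC ltac:(lra)). fold (I k) (I (S k)) in HC.
    set (d := a (S k) - a k) in *.
    assert (vk : v k <= vmax).
    { unfold v. apply vel_upper.
      assert (G := proj1 Ch 0%nat hQ).
      assert (G' := chain_gap_upper (s k) 0 Ch hQ).
      fold (a k) in G, G'.
      assert (s k Q = a (S k) + P) by (unfold a; rewrite E1; ring).
      fold (a k). lra. }
    destruct (out_le (a k)) as [o1 o2].
    assert (EI : I k = (v k - vel_out (a k)) * (/ 2 * (v k + vel_out (a k))))
      by (unfold I; field).
    assert (I1 : (v k - vel_out (a k)) * vmin <= I k).
    { rewrite EI. apply Rmult_le_compat_l; lra. }
    assert (I2 : I k <= (v k - vel_out (a k)) * vmax).
    { rewrite EI. apply Rmult_le_compat_l; lra. }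
    assert (I0 : 0 < I k).
    { eapply Rlt_le_trans; [|exact I1]. apply Rmult_lt_0_compat; lra. }
    assert (d0 : 0 < d) by (unfold d; lra).
    assert (dI : d <= C1 * I k).
    { apply Rle_trans with (C1 * ((v k - vel_out (a k)) * vmin));
        [|apply Rmult_le_compat_l; lra].
      apply Rmult_le_reg_l with (g / (8 * INR Q)); [apply Rdiv_lt_0_compat; lra|].
      replace (g / (8 * INR Q) * (C1 * ((v k - vel_out (a k)) * vmin))) with (v k - vel_out (a k))
        by (unfold C1; field; lra). exact S2. }
    split; [exact I0|]. split.
    - apply Rabs_le_between in HC.
      assert (X : C * d * d <= C * d * (C1 * I k)).
      { apply Rmult_le_compat_l; [|exact dI]. apply Rmult_le_pos; lra. }
      unfold C2. replace (d ^ 2) with (d * d) in HC by ring. lra.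
    - eapply Rle_trans; [exact I2|].
      replace (2 * g * vmax * d) with (2 * g * d * vmax) by ring.
      apply Rmult_le_compat_r; lra. }
  assert (all : forall k, a 0%nat <= a k /\ vel_out (a k) < v k /\
     I 0%nat * (1 - C2 * (a k - a 0%nat)) <= I k).
  { assert (I00 : 0 < I 0%nat) by (apply (step 0%nat); [lra|exact Hv]).
    induction k as [|k (A1 & A2 & A3)].
    - split; [lra|]. split; [exact Hv|]. rewrite Rminus_diag, Rmult_0_r, Rminus_0_r. lra.
    - destruct (step k A1 A2) as (B1 & B2 & B3 & B4 & _).
      split; [lra|]. split; [exact B2|].
      assert (Hk := Hb k). assert (Hk' := Hb (S k)).
      fold (a k) (a 0%nat) in Hk. fold (a (S k)) (a 0%nat) in Hk'.
      set (x := a k - a 0%nat) in *. set (d := a (S k) - a k) in *.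
      replace (a (S k) - a 0%nat) with (x + d) by (unfold x, d; ring).
      assert (x0 : 0 <= x) by (unfold x; lra). assert (d0 : 0 <= d) by (unfold d; lra).
      assert (xd : C2 * d <= / 2).
      { apply Rle_trans with (C2 * eta); [|exact eta1].
        apply Rmult_le_compat_l; unfold d; lra. }
      eapply Rle_trans; [|exact B4].
      (* Relative losses add up, because the product of [1 - C2 * x] and [1 - C2 * d] exceeds
         [1 - C2 * (x + d)] by the nonnegative term [C2 * x * (C2 * d)]. *)
      apply Rle_trans with (I 0%nat * (1 - C2 * x) * (1 - C2 * d)).
      + rewrite Rmult_assoc. apply Rmult_le_compat_l; [lra|].
        assert (0 <= C2 * x * (C2 * d)).
        { apply Rmult_le_pos; apply Rmult_le_pos; lra. }
        lra.
      + apply Rmult_le_compat_r; lra. }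
  set (m := I 0%nat / (4 * g * vmax)).
  assert (m0 : 0 < m).
  { apply Rdiv_lt_0_compat; [apply (step 0%nat); [lra|exact Hv]|].
    apply Rmult_lt_0_compat; lra. }
  assert (far : forall k, a 0%nat + INR k * m <= a k).
  { induction k as [|k IH]; [simpl; lra|].
    destruct (all k) as (A1 & A2 & A3).
    destruct (step k A1 A2) as (_ & _ & _ & _ & B).
    assert (Hk := Hb k). fold (a k) (a 0%nat) in Hk.
    assert (half : I 0%nat * / 2 <= I k).
    { eapply Rle_trans; [|exact A3].
      assert (I00 : 0 < I 0%nat) by (apply (step 0%nat); [lra|exact Hv]).
      apply Rmult_le_compat_l; [lra|].
      assert (C2 * (a k - a 0%nat) <= C2 * eta) by (apply Rmult_le_compat_l; lra). lra. }
    assert (m <= a (S k) - a k).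
    { apply Rmult_le_reg_l with (2 * g * vmax); [apply Rmult_lt_0_compat; lra|].
      unfold m. replace (2 * g * vmax * (I 0%nat / (4 * g * vmax))) with (I 0%nat * / 2)
        by (field; lra). lra. }
    rewrite S_INR. lra. }
  destruct (INR_unbounded (eta / m)) as [k Hk].
  specialize (far k). specialize (Hb k). fold (a k) (a 0%nat) in Hb.
  apply (Rmult_lt_compat_r m) in Hk; [|exact m0].
  unfold Rdiv in Hk. rewrite Rmult_assoc, Rinv_l in Hk by lra. lra.
Qed.

(** * Bouncing motions and chains *)

Variable vstar : R.
Hypothesis hv : 4 * M1 < vstar.

Lemma vstar_pos : 0 < vstar.
Proof. pose proof M1_pos. lra. Qed.

Lemma energy_vel e : / 2 * vstar ^ 2 < e -> vstar < sqrt (2 * e) /\ e = / 2 * sqrt (2 * e) ^ 2.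
Proof.
  intros H. pose proof vstar_pos.
  assert (0 <= vstar ^ 2) by (apply pow_le; lra).
  split.
  - rewrite <- (sqrt_pow2 vstar) by lra. apply sqrt_lt_1_alt. lra.
  - rewrite pow2_sqrt by lra. field.
Qed.

Lemma sqrt_energy v : 0 <= v -> sqrt (2 * (/ 2 * v ^ 2)) = v.
Proof.
  intros H. replace (2 * (/ 2 * v ^ 2)) with (v ^ 2) by field. now apply sqrt_pow2.
Qed.

Lemma impact_leave_vel t v s : t < s -> (impact_eq g f t v s <-> v = leave_vel t s).
Proof.
  intros H. unfold impact_eq, leave_vel. split; intros E.
  - apply Rmult_eq_reg_l with (2 / g); [|apply Rgt_not_eq, Rdiv_lt_0_compat; lra].
    replace (2 / g * (g / 2 * (s - t) + divdiff f t s - Derive f t)) with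
      (s - t + 2 / g * divdiff f t s - 2 / g * Derive f t) by (field; lra). lra.
  - rewrite E. field. lra.
Qed.

Lemma kick_bounds a b : a < b -> - (4 * M1) <= arrive_vel a b - leave_vel a b.
Proof.
  intros H. destruct (kicks_bound a b H) as [K1 K2].
  apply Rabs_le_between in K1, K2.
  unfold arrive_vel, leave_vel, leave_kick, arrive_kick in *. lra.
Qed.

(** The energy determines the velocity up to sign. A bounce costs at most [4 * M1 < vstar], so the
    new velocity is positive and equals the square root. *)
Lemma Phi_vel t e tb eb : / 2 * vstar ^ 2 < e -> Phi g f t e tb eb ->
  t < tb /\ sqrt (2 * e) = leave_vel t tb /\ sqrt (2 * eb) = arrive_vel t tb /\
  eb = / 2 * arrive_vel t tb ^ 2.
Proof.
  intros He [[H1 [H2 _]] H3]. destruct (energy_vel e He) as [Hv _].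
  apply impact_leave_vel in H2; auto.
  assert (E : sqrt (2 * e) - 2 * divdiff f t tb + Derive f tb + Derive f t = arrive_vel t tb).
  { rewrite H2. unfold leave_vel, arrive_vel. ring. }
  rewrite E in H3. repeat split; auto.
  rewrite H3. apply sqrt_energy. pose proof (kick_bounds t tb H1). lra.
Qed.

(** A long flight ends at the first solution: any solution [s] has the same leaving velocity, which
    forces [L <= s - t], and on this range [leave_vel] is strictly increasing in its second
    argument. *)
Lemma Phi_intro t tb : 2 * L <= tb - t ->
  Phi g f t (/ 2 * leave_vel t tb ^ 2) tb (/ 2 * arrive_vel t tb ^ 2).
Proof.
  intros H. pose proof L_dominates. pose proof M1_pos.
  pose proof gL_pos as gL.
  destruct (vel_pos t tb ltac:(lra)) as [V _].
  unfold Phi. rewrite sqrt_energy by lra. split.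
  - split; [lra|]. split; [apply impact_leave_vel; [lra|reflexivity]|].
    intros s Hs E. apply impact_leave_vel in E; auto.
    assert (X := leave_vel_near t tb ltac:(lra)). assert (Y := leave_vel_near t s Hs).
    apply Rabs_le_between in X, Y.
    assert (g / 2 * (2 * L) <= g / 2 * (tb - t)) by (apply Rmult_le_compat_l; lra).
    assert (Ls : L <= s - t).
    { apply Rmult_le_reg_l with (g / 2); lra. }
    apply Rnot_lt_le. intros Hlt.
    destruct (leave_vel_diff t s tb Ls) as [D _]; [lra|lra|].
    assert (0 < g / 4 * (tb - s)) by (apply Rmult_lt_0_compat; lra). lra.
  - unfold leave_vel at 1, arrive_vel at 1. f_equal. f_equal.
    unfold arrive_vel, leave_vel. ring.
Qed.

Lemma Phi_functional t e tb eb tb' eb' :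
  Phi g f t e tb eb -> Phi g f t e tb' eb' -> tb = tb' /\ eb = eb'.
Proof.
  intros [[A1 [A2 A3]] A4] [[B1 [B2 B3]] B4].
  assert (E : tb = tb') by (apply Rle_antisym; auto).
  split; [exact E|]. now rewrite A4, B4, E.
Qed.

Hypothesis hadm : admissible_velocity g f vstar.

Lemma Phi_total t e : / 2 * vstar ^ 2 < e -> exists tb eb, Phi g f t e tb eb.
Proof.
  intros He. destruct hadm as [_ [T [V [HPsi _]]]].
  destruct (energy_vel e He) as [Hv _].
  destruct (HPsi t _ Hv) as [H1 H2].
  exists (T t (sqrt (2 * e))), (/ 2 * V t (sqrt (2 * e)) ^ 2).
  split; [exact H1|]. now rewrite H2.
Qed.

(** The embedding is injective only modulo 1 in time. An integer shift of [t] would shift the image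
    by the same integer, so it must be zero on the lift. *)
Lemma Phi_injective t e t' e' tb eb :
  / 2 * vstar ^ 2 < e -> / 2 * vstar ^ 2 < e' ->
  Phi g f t e tb eb -> Phi g f t' e' tb eb -> t = t' /\ e = e'.
Proof.
  intros He He' HP HP'. destruct hadm as [_ [T [V [HPsi (Sh & _ & _ & Inj & _)]]]].
  assert (id : forall t e, / 2 * vstar ^ 2 < e -> Phi g f t e tb eb ->
    T t (sqrt (2 * e)) = tb /\ V t (sqrt (2 * e)) = sqrt (2 * eb)).
  { intros x ex Hx HPx. destruct (energy_vel ex Hx) as [Hvx _].
    destruct (Phi_vel _ _ _ _ Hx HPx) as (A1 & A2 & A3 & _).
    destruct (HPsi x _ Hvx) as [[B1 [B2 B3]] B4]. destruct HPx as [[C1 [C2 C3]] _].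
    assert (E : T x (sqrt (2 * ex)) = tb) by (apply Rle_antisym; auto).
    split; [exact E|]. rewrite B4, E, A3, A2. unfold leave_vel, arrive_vel. ring. }
  destruct (id t e He HP) as [T1 V1]. destruct (id t' e' He' HP') as [T2 V2].
  destruct (energy_vel e He) as [Hv E]. destruct (energy_vel e' He') as [Hv' E'].
  destruct (Inj t (sqrt (2 * e)) t' (sqrt (2 * e')) Hv Hv') as [[m Hm] Ev].
  - exists 0%Z. rewrite T1, T2. simpl. ring.
  - now rewrite V1, V2.
  - split; [|now rewrite E, E', Ev].
    assert (X := periodic_IZR (fun x => T x (sqrt (2 * e)) - x)).
    cbv beta in X. specialize (X ltac:(intros y; rewrite (proj1 (Sh y _ Hv)); ring) m t').
    rewrite <- Hm, T1, Ev, T2 in X. lra.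
Qed.

Lemma complete_motion_unique x y n0 : complete_motion g f vstar x ->
  complete_motion g f vstar y -> x n0 = y n0 -> forall n, x n = y n.
Proof.
  intros Hx Hy E.
  assert (F : forall k : nat, x (n0 + Z.of_nat k)%Z = y (n0 + Z.of_nat k)%Z).
  { induction k as [|k IH]; [now rewrite Z.add_0_r|].
    replace (n0 + Z.of_nat (S k))%Z with (n0 + Z.of_nat k + 1)%Z by lia.
    destruct (Hx (n0 + Z.of_nat k)%Z) as [_ X]. destruct (Hy (n0 + Z.of_nat k)%Z) as [_ Y].
    rewrite IH in X. destruct (Phi_functional _ _ _ _ _ _ X Y).
    now apply injective_projections. }
  assert (B : forall k : nat, x (n0 - Z.of_nat k)%Z = y (n0 - Z.of_nat k)%Z).
  { induction k as [|k IH]; [now rewrite Z.sub_0_r|].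
    destruct (Hx (n0 - Z.of_nat (S k))%Z) as [X0 X].
    destruct (Hy (n0 - Z.of_nat (S k))%Z) as [Y0 Y].
    replace (n0 - Z.of_nat (S k) + 1)%Z with (n0 - Z.of_nat k)%Z in X, Y by lia.
    rewrite IH in X. destruct (Phi_injective _ _ _ _ _ _ X0 Y0 X Y).
    now apply injective_projections. }
  intros n. destruct (Z_le_gt_dec n0 n).
  - replace n with (n0 + Z.of_nat (Z.to_nat (n - n0)))%Z by lia. apply F.
  - replace n with (n0 - Z.of_nat (Z.to_nat (n0 - n)))%Z by lia. apply B.
Qed.

Lemma motion_step x n : complete_motion g f vstar x ->
  fst (x n) < fst (x (n + 1)%Z) /\ vstar < sqrt (2 * snd (x n)) /\
  snd (x n) = / 2 * sqrt (2 * snd (x n)) ^ 2 /\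
  sqrt (2 * snd (x n)) = leave_vel (fst (x n)) (fst (x (n + 1)%Z)) /\
  sqrt (2 * snd (x (n + 1)%Z)) = arrive_vel (fst (x n)) (fst (x (n + 1)%Z)).
Proof.
  intros H. destruct (H n) as [H1 H2].
  destruct (energy_vel _ H1) as [H3 H4]. destruct (Phi_vel _ _ _ _ H1 H2) as (P1 & P2 & P3 & _).
  auto.
Qed.

(** * Periodic motions and zeros of the defect *)

Definition segment (x : motion) (n : Z) (i : nat) : R := fst (x (n + Z.of_nat i)%Z).

Lemma segment_chain x n : complete_motion g f vstar x ->
  (forall n, L <= fst (x (n + 1)%Z) - fst (x n)) -> chain L (segment x n).
Proof.
  intros H G. split.
  - intros i _. unfold segment. replace (n + Z.of_nat (S i))%Z with (n + Z.of_nat i + 1)%Z by lia.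
    apply G.
  - intros i Hi. destruct i as [|i]; [lia|]. unfold node, segment. simpl pred.
    destruct (motion_step x (n + Z.of_nat i) H) as (_ & _ & _ & _ & E1).
    destruct (motion_step x (n + Z.of_nat (S i)) H) as (_ & _ & _ & E2 & _).
    replace (n + Z.of_nat (S i))%Z with (n + Z.of_nat i + 1)%Z in * by lia.
    replace (n + Z.of_nat (S (S i)))%Z with (n + Z.of_nat i + 1 + 1)%Z by lia.
    now rewrite <- E1, <- E2.
Qed.

Variable q : Z.
Hypothesis hq : q = Z.of_nat Q.
Hypothesis hvL : vstar < g * L / 4.
Hypothesis hPbig : 2 * g * L + 4 * M1 * (INR Q + 1) <= g / 2 * (P / INR Q).

(** Among [q] consecutive flights one has at least the average length and thus starts fast; every
    bounce costs at most [4 * M1], so the speed persists over a period. The bound is twice what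
    [fast_gap] asks for, which leaves room for neighbouring motions. *)
Lemma periodic_vel x n : periodic_motion g f vstar p q x ->
  2 * g * L <= sqrt (2 * snd (x n)).
Proof.
  intros [Hx Hper]. pose proof Q_ge_1 as q1. pose proof M1_pos as m1.
  (* The window of [q] flights ends at [n], since the lower bound propagates forward in time. *)
  set (m := (n - q)%Z).
  assert (E : exists i, (i < Q)%nat /\
    P / INR Q <= fst (x (m + Z.of_nat i + 1)%Z) - fst (x (m + Z.of_nat i)%Z)).
  { apply NNPP. intros N.
    assert (A : forall i, (0 < i <= Q)%nat ->
      fst (x (m + Z.of_nat i)%Z) < fst (x m) + INR i * (P / INR Q)).
    { assert (lt : forall i, (i < Q)%nat ->
        fst (x (m + Z.of_nat i + 1)%Z) - fst (x (m + Z.of_nat i)%Z) < P / INR Q).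
      { intros i Hi. apply Rnot_le_lt. intros Hle. apply N. now exists i. }
      intros i. induction i as [|i IH]; intros Hi; [lia|].
      specialize (lt i ltac:(lia)). rewrite S_INR.
      replace (m + Z.of_nat (S i))%Z with (m + Z.of_nat i + 1)%Z by lia.
      destruct i as [|i].
      - simpl (Z.of_nat 0) in *. rewrite Z.add_0_r in *. simpl INR. lra.
      - specialize (IH ltac:(lia)). lra. }
    specialize (A Q ltac:(lia)). rewrite <- hq, Hper in A. simpl in A.
    replace (INR Q * (P / INR Q)) with (IZR p) in A by (rewrite <- hp; field; lra). lra. }
  destruct E as [i [Hi G]].
  assert (S1 : g / 2 * (P / INR Q) - 2 * M1 <= sqrt (2 * snd (x (m + Z.of_nat i)%Z))).
  { destruct (motion_step x (m + Z.of_nat i) Hx) as (X1 & _ & _ & -> & _).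
    assert (X := leave_vel_near _ _ X1). apply Rabs_le_between in X.
    apply (Rmult_le_compat_l (g / 2)) in G; lra. }
  assert (S2 : forall j, sqrt (2 * snd (x (m + Z.of_nat i)%Z)) - 4 * M1 * INR j
     <= sqrt (2 * snd (x (m + Z.of_nat i + Z.of_nat j)%Z))).
  { induction j as [|j IH].
    - simpl (Z.of_nat 0). rewrite Z.add_0_r. simpl. lra.
    - replace (m + Z.of_nat i + Z.of_nat (S j))%Z with (m + Z.of_nat i + Z.of_nat j + 1)%Z by lia.
      destruct (motion_step x (m + Z.of_nat i + Z.of_nat j) Hx) as (X1 & _ & _ & X2 & X3).
      rewrite X3. rewrite X2 in IH. pose proof (kick_bounds _ _ X1).
      rewrite S_INR. lra. }
  specialize (S2 (Q - i)%nat).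
  replace (m + Z.of_nat i + Z.of_nat (Q - i))%Z with n in S2 by (unfold m; lia).
  assert (INR (Q - i) <= INR Q) by (apply le_INR; lia).
  assert (4 * M1 * INR (Q - i) <= 4 * M1 * INR Q) by (apply Rmult_le_compat_l; lra).
  lra.
Qed.

Lemma fast_gap x n : complete_motion g f vstar x -> g * L <= sqrt (2 * snd (x n)) ->
  L <= fst (x (n + 1)%Z) - fst (x n).
Proof.
  intros Hx H. destruct (motion_step x n Hx) as (X1 & _ & _ & X2 & _).
  rewrite X2 in H. assert (X := leave_vel_near _ _ X1). apply Rabs_le_between in X.
  pose proof L_dominates. pose proof gL_pos.
  apply Rmult_le_reg_l with (g / 2); lra.
Qed.

Lemma periodic_gap x n : periodic_motion g f vstar p q x ->
  L <= fst (x (n + 1)%Z) - fst (x n).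
Proof.
  intros H. apply fast_gap; [apply H|]. pose proof (periodic_vel x n H).
  pose proof gL_pos. lra.
Qed.

Lemma periodic_segment x n i : periodic_motion g f vstar p q x -> (i <= Q)%nat ->
  segment x n i = tau (fst (x n)) i.
Proof.
  intros H Hi. apply (chain_unique (tau (fst (x n))) (segment x n)); auto using tau_chain.
  - apply segment_chain; [apply H|]. intros m. now apply periodic_gap.
  - unfold segment. rewrite tau_0. simpl. now rewrite Z.add_0_r.
  - unfold segment. rewrite tau_end, <- hq, (proj2 H n), hp. reflexivity.
Qed.

(** By uniqueness a period of the motion is the chain from its first impact. The energy returns
    after [q] bounces, so this chain arrives with the velocity with which it left. *)
Lemma periodic_point x n : periodic_motion g f vstar p q x ->
  snd (x n) = / 2 * vel_out (fst (x n)) ^ 2 /\ defect (fst (x n)) = 0.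
Proof.
  intros H. set (a := fst (x n)).
  destruct (motion_step x n (proj1 H)) as (_ & _ & E1 & E2 & _).
  assert (V : sqrt (2 * snd (x n)) = vel_out a).
  { rewrite E2. unfold vel_out. rewrite tau_0. fold a. f_equal.
    unfold a. rewrite <- periodic_segment by (auto; lia). unfold segment. reflexivity. }
  rewrite V in E1. split; [exact E1|].
  destruct (motion_step x (n + q - 1) (proj1 H)) as (_ & _ & _ & _ & E3).
  replace (n + q - 1 + 1)%Z with (n + q)%Z in E3 by lia.
  rewrite (proj2 H n) in E3 at 1. simpl snd in E3. rewrite V in E3.
  unfold defect, vel_in. fold a. rewrite E3.
  unfold a. rewrite <- !periodic_segment by (auto; lia). unfold segment.
  replace (n + Z.of_nat (pred Q))%Z with (n + q - 1)%Z by lia.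
  replace (n + Z.of_nat Q)%Z with (n + q)%Z by lia. ring.
Qed.

Definition tau_line (a : R) (n : Z) : R :=
  tau a (Z.to_nat (n mod q)) + IZR (n / q * p).

Definition tau_motion (a : R) : motion :=
  fun n => (tau_line a n, / 2 * leave_vel (tau_line a n) (tau_line a (n + 1)) ^ 2).

(** Both ends of a block are covered: impact [Q] is also impact 0 of the next block, which is how
    the joint between blocks is computed. *)
Lemma tau_line_eq a k i : (i <= Q)%nat ->
  tau_line a (k * q + Z.of_nat i) = tau a i + IZR (k * p).
Proof.
  intros Hi. unfold tau_line. destruct (Nat.eq_dec i Q) as [->|Hn].
  - rewrite <- hq. replace (k * q + q)%Z with ((k + 1) * q)%Z by ring.
    rewrite Z_mod_mult, Z_div_mult by lia. simpl Z.to_nat.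
    rewrite tau_0, tau_end, hp, !mult_IZR, plus_IZR. ring.
  - replace ((k * q + Z.of_nat i) mod q)%Z with (Z.of_nat i).
    2: { rewrite Z.add_comm, Z_mod_plus_full, Z.mod_small; lia. }
    replace ((k * q + Z.of_nat i) / q)%Z with k.
    2: { rewrite Z.div_add_l by lia. rewrite Z.div_small; lia. }
    now rewrite Nat2Z.id.
Qed.

Lemma Z_decompose n : exists k i, (i < Q)%nat /\ n = (k * q + Z.of_nat i)%Z.
Proof.
  exists (n / q)%Z, (Z.to_nat (n mod q)).
  assert (B := Z.mod_pos_bound n q ltac:(lia)). split; [lia|].
  rewrite Z2Nat.id by lia. rewrite (Z_div_mod_eq_full n q) at 1. ring.
Qed.

Lemma tau_line_gap a n : 2 * L <= tau_line a (n + 1) - tau_line a n.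
Proof.
  destruct (Z_decompose n) as (k & i & Hi & ->).
  replace (k * q + Z.of_nat i + 1)%Z with (k * q + Z.of_nat (S i))%Z by lia.
  rewrite !tau_line_eq by lia.
  destruct (htau a) as [[G _] _]. specialize (G i Hi). lra.
Qed.

(** Inside a block this is a node of the chain; at the joint of two blocks it is the equation
    [defect a = 0]. *)
Lemma tau_line_node a n : defect a = 0 ->
  arrive_vel (tau_line a n) (tau_line a (n + 1)) =
  leave_vel (tau_line a (n + 1)) (tau_line a (n + 1 + 1)).
Proof.
  intros Ha. destruct (Z_decompose n) as (k & i & Hi & ->).
  replace (k * q + Z.of_nat i + 1)%Z with (k * q + Z.of_nat (S i))%Z by lia.
  destruct (Nat.eq_dec (S i) Q) as [E|Hn].
  - rewrite !tau_line_eq by lia.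
    replace (k * q + Z.of_nat (S i) + 1)%Z with ((k + 1) * q + Z.of_nat 1)%Z by lia.
    rewrite tau_line_eq by lia.
    replace (tau a (S i) + IZR (k * p)) with (tau a 0%nat + IZR ((k + 1) * p)) at 2.
    2: { rewrite E, tau_0, tau_end, hp, !mult_IZR, plus_IZR. ring. }
    rewrite arrive_vel_shift, leave_vel_shift.
    unfold defect, vel_in, vel_out in Ha. rewrite E. replace i with (pred Q) by lia. lra.
  - replace (k * q + Z.of_nat (S i) + 1)%Z with (k * q + Z.of_nat (S (S i)))%Z by lia.
    rewrite !tau_line_eq by lia.
    rewrite arrive_vel_shift, leave_vel_shift.
    apply (proj2 (tau_chain a) (S i)). lia.
Qed.

Lemma tau_line_period a n : tau_line a (n + q) = tau_line a n + IZR p.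
Proof.
  destruct (Z_decompose n) as (k & i & Hi & ->).
  replace (k * q + Z.of_nat i + q)%Z with ((k + 1) * q + Z.of_nat i)%Z by ring.
  rewrite !tau_line_eq, !mult_IZR, plus_IZR by lia. ring.
Qed.

Lemma tau_motion_periodic a : defect a = 0 ->
  periodic_motion g f vstar p q (tau_motion a).
Proof.
  intros Ha. pose proof vstar_pos. split.
  - intros n. unfold tau_motion. simpl. split.
    + destruct (vel_pos (tau_line a n) (tau_line a (n + 1))) as [V _].
      * pose proof (tau_line_gap a n). lra.
      * apply Rmult_lt_compat_l; [lra|]. simpl. rewrite !Rmult_1_r.
        apply Rmult_le_0_lt_compat; lra.
    + rewrite <- tau_line_node by exact Ha. apply Phi_intro, tau_line_gap.
  - intros n. unfold tau_motion. simpl fst. simpl snd.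
    replace (n + q + 1)%Z with (n + 1 + q)%Z by ring.
    now rewrite !tau_line_period, leave_vel_shift.
Qed.

Lemma tau_motion_0 a : tau_motion a 0%Z = (a, / 2 * vel_out a ^ 2).
Proof.
  unfold tau_motion.
  assert (E0 := tau_line_eq a 0 0 ltac:(lia)). assert (E1 := tau_line_eq a 0 1 ltac:(lia)).
  simpl in E0, E1. simpl (0 + 1)%Z. rewrite E0, E1, !Rplus_0_r.
  unfold vel_out. now rewrite tau_0.
Qed.

Lemma tau_motion_translate a m n : tau_motion (a + IZR m) n = translate m (tau_motion a) n.
Proof.
  assert (E : forall n, tau_line (a + IZR m) n = tau_line a n + IZR m).
  { intros k. unfold tau_line. rewrite tau_shift; [ring|].
    assert (B := Z.mod_pos_bound k q ltac:(lia)). lia. }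
  unfold translate, tau_motion. simpl. now rewrite !E, leave_vel_shift.
Qed.

Lemma periodic_motion_eq x n : periodic_motion g f vstar p q x ->
  x n = tau_motion (fst (x 0%Z)) n.
Proof.
  intros H. destruct (periodic_point x 0 H) as [E D].
  apply (complete_motion_unique x _ 0%Z); [apply H | apply tau_motion_periodic, D |].
  rewrite tau_motion_0, <- E. apply surjective_pairing.
Qed.

Lemma isolated_finite :
  (forall c, exists r, 0 < r /\ forall x, 0 < Rabs (x - c) < r -> defect x <> 0) ->
  finite_mod_translation (periodic_motion g f vstar p q).
Proof.
  intros iso. destruct (isolated_zeros_finite defect 0 1) as [l Hl]; [lra | exact iso |].
  exists (map tau_motion l). intros x Hx.
  destruct (fractional (fst (x 0%Z))) as [m Hm].
  exists (tau_motion (fst (x 0%Z) + IZR m)). split.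
  - apply in_map, Hl; [lra|]. rewrite defect_shift. now apply periodic_point.
  - exists (- m)%Z. intros n. rewrite (periodic_motion_eq x n Hx), <- tau_motion_translate.
    f_equal. rewrite opp_IZR. ring.
Qed.

(** The curve is parametrized by the impact time itself. A complete motion that meets it coincides
    with a shifted [tau_motion] by uniqueness. *)
Lemma zero_defect_degenerate : (forall x, defect x = 0) -> degenerate g f vstar p q.
Proof.
  intros Hdef. exists (fun s => s), (fun s => / 2 * vel_out s ^ 2).
  split; [|split; [exact energy_analytic|split; [|split]]].
  - intros c. apply (An_analytic_at c 1 (Rabs c + Rabs 1 * 1)); [lra|].
    eapply An_ext; [|apply (An_affine c 1 c 1); lra]. intros; simpl; ring.
  - intros s. split; [reflexivity|]. now rewrite (vel_out_shift 1).
  - intros x. destruct (fractional x) as [m Hm]. exists (x + IZR m). split.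
    + split; [exact Hm|]. now exists m.
    + intros s [Hs [k Hk]].
      assert (E : IZR (k - m) < 1 /\ -1 < IZR (k - m)).
      { rewrite minus_IZR. lra. }
      destruct E as [E1 E2]. apply lt_IZR in E1, E2. replace k with m in Hk by lia. lra.
  - intros x Hx. split.
    + intros Hp'. exists 0%Z, (fst (x 0%Z)).
      destruct (periodic_point x 0 Hp') as [E _]. rewrite <- E. apply surjective_pairing.
    + intros [n0 [s0 E]].
      destruct (tau_motion_periodic s0 (Hdef s0)) as [C Per].
      assert (Eq : forall n, x n = tau_motion s0 (n - n0)%Z).
      { apply (complete_motion_unique x (fun n => tau_motion s0 (n - n0)%Z) n0 Hx).
        - intros n. replace (n + 1 - n0)%Z with (n - n0 + 1)%Z by ring. apply C.
        - rewrite E, Z.sub_diag, tau_motion_0. reflexivity. }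
      split; [exact Hx|]. intros n. rewrite !Eq.
      replace (n + q - n0)%Z with (n - n0 + q)%Z by ring. apply Per.
Qed.

(** * Instability *)

Lemma periodic_multiple x n (k : nat) : periodic_motion g f vstar p q x ->
  x (n + Z.of_nat k * q)%Z = (fst (x n) + IZR (Z.of_nat k * p), snd (x n)).
Proof.
  intros H. induction k as [|k IH].
  - simpl (Z.of_nat 0). rewrite !Z.mul_0_l, Z.add_0_r, Rplus_0_r. apply surjective_pairing.
  - replace (n + Z.of_nat (S k) * q)%Z with (n + Z.of_nat k * q + q)%Z by lia.
    rewrite (proj2 H), IH. simpl fst. simpl snd. f_equal.
    rewrite Rplus_assoc, <- plus_IZR. do 2 f_equal. lia.
Qed.

Lemma dist_euc_abs x0 y0 x1 y1 :
  Rabs (x0 - x1) <= dist_euc x0 y0 x1 y1 /\ Rabs (y0 - y1) <= dist_euc x0 y0 x1 y1 /\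
  dist_euc x0 y0 x1 y1 <= Rabs (x0 - x1) + Rabs (y0 - y1).
Proof.
  unfold dist_euc. pose proof (Rle_0_sqr (x0 - x1)). pose proof (Rle_0_sqr (y0 - y1)).
  repeat split.
  - rewrite <- sqrt_Rsqr_abs. apply sqrt_le_1_alt. lra.
  - rewrite <- sqrt_Rsqr_abs. apply sqrt_le_1_alt. lra.
  - pose proof (Rabs_pos (x0 - x1)). pose proof (Rabs_pos (y0 - y1)).
    rewrite <- (sqrt_Rsqr (Rabs (x0 - x1) + Rabs (y0 - y1))) by lra.
    apply sqrt_le_1_alt. rewrite (Rsqr_abs (x0 - x1)), (Rsqr_abs (y0 - y1)).
    unfold Rsqr. assert (0 <= Rabs (x0 - x1) * Rabs (y0 - y1)) by now apply Rmult_le_pos. lra.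
Qed.

(** Stability supplies a complete motion through every nearby point, and closeness to the fast
    motion [x] keeps its flights longer than [L]; cut into blocks of [Q] flights it is a
    [chain_orbit]. *)
Lemma stable_orbit x eps : periodic_motion g f vstar p q x -> stable g f vstar x ->
  0 < eps -> eps <= (g * L) ^ 2 ->
  exists delta, 0 < delta /\ forall a0 e0,
    Rabs (fst (x 0%Z) - a0) + Rabs (snd (x 0%Z) - e0) < delta ->
    exists s, chain_orbit s /\ s 0%nat 0%nat = a0 /\
      leave_vel (s 0%nat 0%nat) (s 0%nat 1%nat) = sqrt (2 * e0) /\
      forall k, Rabs (s k 0%nat - fst (x 0%Z)) < eps.
Proof.
  intros Hx St Heps Heps1. destruct (St eps Heps) as [delta [d0 Hd]].
  pose proof gL_pos as gL.
  exists delta. split; [exact d0|]. intros a0 e0 Hnear.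
  destruct (Hd a0 e0) as [y [Y0 [Yc Yn]]].
  { eapply Rle_lt_trans; [apply dist_euc_abs|exact Hnear]. }
  (* The velocity of [x] is at least [2 * g * L], so an energy error below [(g * L) ^ 2] leaves at
     least [g * L]. *)
  assert (Yg : forall n, L <= fst (y (n + 1)%Z) - fst (y n)).
  { intros n. apply fast_gap; [exact Yc|].
    assert (X := periodic_vel x n Hx).
    destruct (motion_step x n (proj1 Hx)) as (_ & _ & E & _ & _).
    destruct (dist_euc_abs (fst (y n)) (snd (y n)) (fst (x n)) (snd (x n))) as (_ & D & _).
    specialize (Yn n).
    assert (B : Rabs (snd (y n) - snd (x n)) < (g * L) ^ 2) by lra.
    apply Rabs_def2 in B.
    assert (Q4 : (2 * (g * L)) ^ 2 <= sqrt (2 * snd (x n)) ^ 2) by (apply pow_incr; lra).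
    rewrite <- (sqrt_pow2 (g * L)) by lra. apply sqrt_le_1_alt.
    replace ((2 * (g * L)) ^ 2) with (4 * (g * L) ^ 2) in Q4 by ring. lra. }
  set (s := fun (k i : nat) => segment y (Z.of_nat k * q) i + IZR (- (Z.of_nat k * p))).
  assert (S0 : forall k, s k 0%nat = fst (y (Z.of_nat k * q)%Z) + IZR (- (Z.of_nat k * p))).
  { intros k. unfold s, segment. simpl (Z.of_nat 0). now rewrite Z.add_0_r. }
  assert (V : forall k, leave_vel (s k 0%nat) (s k 1%nat) = sqrt (2 * snd (y (Z.of_nat k * q)%Z))).
  { intros k. unfold s. rewrite leave_vel_shift. unfold segment.
    destruct (motion_step y (Z.of_nat k * q) Yc) as (_ & _ & _ & -> & _).
    simpl (Z.of_nat 0). simpl (Z.of_nat 1). now rewrite Z.add_0_r. }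
  exists s. repeat split.
  - apply (chain_shift L _ (segment y (Z.of_nat k * q))), segment_chain; auto.
  - apply (chain_shift L _ (segment y (Z.of_nat k * q))), segment_chain; auto.
  - rewrite S0. unfold s, segment. rewrite hp, <- hq.
    replace (Z.of_nat (S k) * q)%Z with (Z.of_nat k * q + q)%Z by lia.
    replace (- (Z.of_nat (S k) * p))%Z with (- (Z.of_nat k * p) - p)%Z by lia.
    rewrite minus_IZR. ring.
  - rewrite V. unfold s. rewrite arrive_vel_shift. unfold segment. rewrite <- hq.
    destruct (motion_step y (Z.of_nat k * q + Z.of_nat (pred Q)) Yc) as (_ & _ & _ & _ & E).
    replace (Z.of_nat k * q + Z.of_nat (pred Q) + 1)%Z with (Z.of_nat (S k) * q)%Z in E by lia.
    replace (Z.of_nat k * q + q)%Z with (Z.of_nat (S k) * q)%Z by lia. exact E.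
  - rewrite S0. simpl (Z.of_nat 0). rewrite Z.mul_0_l, Y0. simpl. ring.
  - rewrite V. simpl (Z.of_nat 0). now rewrite Z.mul_0_l, Y0.
  - intros k. rewrite S0.
    destruct (dist_euc_abs (fst (y (Z.of_nat k * q)%Z)) (snd (y (Z.of_nat k * q)%Z))
      (fst (x (Z.of_nat k * q)%Z)) (snd (x (Z.of_nat k * q)%Z))) as (D & _ & _).
    specialize (Yn (Z.of_nat k * q)%Z).
    assert (E := periodic_multiple x 0 k Hx). rewrite Z.add_0_l in E.
    rewrite E in D at 1. simpl fst in D at 2.
    rewrite opp_IZR. eapply Rle_lt_trans; [|exact Yn].
    eapply Rle_trans; [right|exact D]. f_equal. ring.
Qed.

Lemma above_vel_out a e : / 2 * vel_out a ^ 2 < e -> vel_out a < sqrt (2 * e).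
Proof.
  intros H. pose proof (vel_out_pos a).
  rewrite <- (sqrt_pow2 (vel_out a)) at 1 by lra. apply sqrt_lt_1_alt.
  assert (0 <= vel_out a ^ 2) by (apply pow_le; lra). lra.
Qed.

Lemma up_crossing_unstable c r : 0 < r -> defect c = 0 ->
  (forall x, c < x < c + r -> 0 < defect x) -> unstable g f vstar (tau_motion c).
Proof.
  intros r0 Hc Hpos St.
  assert (gL : 0 < (g * L) ^ 2) by (apply pow_lt; now apply Rmult_lt_0_compat).
  set (eps := Rmin (r / 2) ((g * L) ^ 2)).
  assert (e1 : eps <= r / 2) by apply Rmin_l.
  assert (e2 : eps <= (g * L) ^ 2) by apply Rmin_r.
  assert (e0 : 0 < eps) by (apply Rmin_glb_lt; lra).
  destruct (stable_orbit _ eps (tau_motion_periodic c Hc) St e0 e2) as [d [d0 Hd]].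
  rewrite tau_motion_0 in Hd. cbn [fst snd] in Hd.
  destruct (continuous_eps (fun x => / 2 * vel_out x ^ 2) c (d / 4)) as [r1 [r10 Hr1]];
    [apply analytic_at_continuous, energy_analytic | lra |].
  (* The start is to the right of [c] and slightly above the curve. [h <= eps / 2] puts it before
     [c + eps], and [eps <= r / 2] keeps [defect] positive up to there. *)
  set (h := Rmin (Rmin (r1 / 2) (d / 4)) (eps / 2)).
  assert (h1 : h <= r1 / 2) by (eapply Rle_trans; [apply Rmin_l | apply Rmin_l]).
  assert (h2 : h <= d / 4) by (eapply Rle_trans; [apply Rmin_l | apply Rmin_r]).
  assert (h3 : h <= eps / 2) by apply Rmin_r.
  assert (h0 : 0 < h) by (unfold h; repeat apply Rmin_glb_lt; lra).
  set (a0 := c + h).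
  assert (Hh : a0 - c = h) by (unfold a0; ring).
  specialize (Hr1 a0). rewrite Hh, Rabs_pos_eq in Hr1 by lra. specialize (Hr1 ltac:(lra)).
  destruct (Hd a0 (/ 2 * vel_out a0 ^ 2 + d / 4)) as [s [S1 [S2 [S3 S4]]]].
  { rewrite <- (Rabs_Ropp (c - a0)). replace (- (c - a0)) with h by (unfold a0; ring).
    rewrite Rabs_pos_eq by lra.
    assert (Rabs (/ 2 * vel_out c ^ 2 - (/ 2 * vel_out a0 ^ 2 + d / 4)) <= d / 4 + d / 4); [|lra].
    rewrite <- Rabs_Ropp. match goal with |- Rabs ?w <= _ => replace w with
      ((/ 2 * vel_out a0 ^ 2 - / 2 * vel_out c ^ 2) + d / 4) by ring end.
    eapply Rle_trans; [apply Rabs_triang|]. rewrite (Rabs_pos_eq (d / 4)) by lra. lra. }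
  destruct (drift_up_crossing s (c + eps) S1) as [k Hk].
  - rewrite S2. intros x Hx. apply Hpos. unfold a0 in Hx. lra.
  - rewrite S3, S2. apply above_vel_out. lra.
  - specialize (S4 k). apply Rabs_def2 in S4. lra.
Qed.

(** The perturbation is a vertical one and as small as stability demands, whereas the drift length
    [eta] is fixed beforehand. *)
Lemma zero_defect_unstable x : (forall a, defect a = 0) ->
  periodic_motion g f vstar p q x -> unstable g f vstar x.
Proof.
  intros Hdef Hx St.
  assert (gL : 0 < (g * L) ^ 2) by (apply pow_lt; now apply Rmult_lt_0_compat).
  destruct (drift_degenerate Hdef) as [eta [eta0 Heta]].
  set (eps := Rmin eta ((g * L) ^ 2)).
  assert (e1 : eps <= eta) by apply Rmin_l.
  assert (e2 : eps <= (g * L) ^ 2) by apply Rmin_r.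
  assert (e0 : 0 < eps) by (apply Rmin_glb_lt; lra).
  destruct (stable_orbit x eps Hx St e0 e2) as [d [d0 Hd]].
  destruct (periodic_point x 0 Hx) as [E _].
  destruct (Hd (fst (x 0%Z)) (snd (x 0%Z) + d / 2)) as [s [S1 [S2 [S3 S4]]]].
  { rewrite Rminus_diag, Rabs_R0. replace (snd (x 0%Z) - (snd (x 0%Z) + d / 2)) with (- (d / 2)) by ring.
    rewrite Rabs_Ropp, Rabs_pos_eq; lra. }
  destruct (Heta s S1) as [k Hk].
  - rewrite S3, S2. apply above_vel_out. rewrite E. lra.
  - specialize (S4 k). apply Rabs_def2 in S4. rewrite S2 in Hk. lra.
Qed.

(** * Degenerate sets and isolated zeros *)

Lemma Phi_lipschitz t e tb eb : / 2 * vstar ^ 2 < e -> 2 * g * L <= sqrt (2 * e) ->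
  Phi g f t e tb eb ->
  exists C d0, 0 < d0 /\ 0 <= C /\ forall d a e', d <= d0 ->
    Rabs (a - t) <= d -> Rabs (e' - e) <= d ->
    / 2 * vstar ^ 2 < e' /\ exists a1 e1, Phi g f a e' a1 e1 /\
      Rabs (a1 - tb) <= C * d /\ Rabs (e1 - eb) <= C * d.
Proof.
  intros He Hv HPhi. pose proof M1_pos as m1. pose proof M2_pos as m2.
  pose proof kap_pos as k0. pose proof kap_le_g as k1. pose proof L_dominates as ld.
  pose proof gL_pos as gL.
  destruct (energy_vel e He) as [Hv1 He2]. set (v := sqrt (2 * e)) in *.
  destruct (Phi_vel _ _ _ _ He HPhi) as (Q1 & Q2 & Q3 & Q4). fold v in Q2.
  set (w := arrive_vel t tb) in *.
  assert (w0 : 0 < w) by (pose proof (kick_bounds t tb Q1); unfold w; lra).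
  assert (gap : forall b b' u, b < b' -> g * L <= u -> u = leave_vel b b' -> L <= b' - b).
  { intros b b' u Hb Hu ->. assert (X := leave_vel_near b b' Hb). apply Rabs_le_between in X.
    apply Rmult_le_reg_l with (g / 2); lra. }
  assert (G := gap t tb v Q1 ltac:(lra) Q2).
  set (C1 := 4 / g * (g / 2 + kap + M2 + 2 / v)).
  assert (v0 : 0 < v) by lra.
  assert (iv : 0 < 2 / v) by (apply Rdiv_lt_0_compat; lra).
  assert (C10 : 0 <= C1).
  { apply Rmult_le_pos; [left; apply Rdiv_lt_0_compat; lra|lra]. }
  set (C2 := (g / 2 + kap + M2) * (C1 + 1)).
  assert (C20 : 0 <= C2) by (apply Rmult_le_pos; lra).
  set (C3 := C2 * (w + C2)).
  assert (C30 : 0 <= C3) by (apply Rmult_le_pos; lra).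
  set (gap_e := Rmin (e - / 2 * vstar ^ 2) ((g * L) ^ 2)).
  assert (ge : 0 < gap_e) by (apply Rmin_glb_lt; [lra|now apply pow_lt]).
  assert (ge1 : gap_e <= e - / 2 * vstar ^ 2) by apply Rmin_l.
  assert (ge2 : gap_e <= (g * L) ^ 2) by apply Rmin_r.
  exists (C1 + C3), (Rmin 1 (gap_e / 2)).
  split; [apply Rmin_glb_lt; lra|]. split; [lra|].
  intros d a e' Hd Ha He'.
  assert (d1 : d <= 1) by (eapply Rle_trans; [exact Hd|apply Rmin_l]).
  assert (d2 : d <= gap_e / 2) by (eapply Rle_trans; [exact Hd|apply Rmin_r]).
  assert (d0 : 0 <= d) by (eapply Rle_trans; [apply Rabs_pos|exact Ha]).
  assert (He'' := He'). apply Rabs_le_between in He''.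
  assert (Hs : / 2 * vstar ^ 2 < e') by lra. split; [exact Hs|].
  destruct (Phi_total a e' Hs) as [a1 [e1 HP1]]. exists a1, e1. split; [exact HP1|].
  destruct (energy_vel e' Hs) as [Hv1' He2']. set (v' := sqrt (2 * e')) in *.
  destruct (Phi_vel _ _ _ _ Hs HP1) as (R1 & R2 & R3 & R4). fold v' in R2.
  set (w' := arrive_vel a a1) in *.
  assert (vv : g * L <= v').
  { unfold v'. rewrite <- (sqrt_pow2 (g * L)) by lra. apply sqrt_le_1_alt.
    assert ((2 * (g * L)) ^ 2 <= v ^ 2) by (apply pow_incr; lra).
    replace ((2 * (g * L)) ^ 2) with (4 * (g * L) ^ 2) in H by ring. lra. }
  assert (G' := gap a a1 v' R1 vv R2).
  assert (dv : Rabs (v' - v) <= 2 / v * d).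
  { apply Rmult_le_reg_r with (v' + v); [lra|].
    rewrite <- (Rabs_pos_eq (v' + v)) at 1 by lra. rewrite <- Rabs_mult.
    replace ((v' - v) * (v' + v)) with (2 * (e' - e)) by (rewrite He2, He2'; field).
    rewrite Rabs_mult, (Rabs_pos_eq 2) by lra.
    apply Rle_trans with (2 / v * d * v); [|apply Rmult_le_compat_l; [apply Rmult_le_pos; lra|lra]].
    replace (2 / v * d * v) with (2 * d) by (field; lra). lra. }
  set (D := Rabs (a1 - tb)). assert (D0 : 0 <= D) by apply Rabs_pos.
  assert (dF : Rabs (divdiff f a a1 - divdiff f t tb) <= kap * (d + D)).
  { apply divdiff_lipschitz; auto; fold D; lra. }
  assert (df : Rabs (Derive f a - Derive f t) <= M2 * d).
  { eapply Rle_trans; [apply f1_lipschitz|]. apply Rmult_le_compat_l; lra. }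
  assert (T : forall x y z u X Y Z, Rabs x <= X -> Rabs y <= Y -> Rabs z <= Z ->
     u = x + y + z -> Rabs u <= X + Y + Z).
  { intros x y z u X Y Z Hx Hy Hz ->. eapply Rle_trans; [apply Rabs_triang|].
    pose proof (Rabs_triang x y). lra. }
  assert (Sc : forall x X, Rabs x <= X -> Rabs (g / 2 * x) <= g / 2 * X).
  { intros x X Hx. rewrite Rabs_mult, (Rabs_pos_eq (g / 2)) by lra.
    apply Rmult_le_compat_l; lra. }
  (* The new impact time also enters the divided difference; its share [kap * D] is at most
     [g / 32 * D] and is absorbed on the left. *)
  assert (HD : D <= C1 * d).
  { assert (X : g / 2 * D <= 2 / v * d + (g / 2 * d + kap * (d + D)) + M2 * d).
    { unfold D. rewrite <- (Rabs_pos_eq (g / 2)) at 1 by lra. rewrite <- Rabs_mult.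
      apply (T (v' - v) (g / 2 * (a - t) - (divdiff f a a1 - divdiff f t tb))
               (Derive f a - Derive f t)); auto.
      - eapply Rle_trans; [apply Rabs_triang|]. rewrite Rabs_Ropp.
        apply Rplus_le_compat; [now apply Sc|exact dF].
      - rewrite Q2, R2. unfold leave_vel. field. }
    assert (kD : kap * D <= g / 32 * D) by (apply Rmult_le_compat_r; lra).
    apply Rmult_le_reg_l with (g / 4); [lra|].
    replace (g / 4 * (C1 * d)) with ((g / 2 + kap + M2 + 2 / v) * d) by (unfold C1; field; lra).
    assert (0 <= g * D) by (apply Rmult_le_pos; lra). lra. }
  assert (dw : Rabs (w' - w) <= C2 * d).
  { assert (X : Rabs (w' - w) <= g / 2 * (d + D) + kap * (d + D) + M2 * D).
    { apply (T (g / 2 * ((a1 - tb) - (a - t))) (- (divdiff f a a1 - divdiff f t tb))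
               (Derive f a1 - Derive f tb)).
      - apply Sc. eapply Rle_trans; [apply Rabs_triang|]. rewrite Rabs_Ropp. fold D. lra.
      - now rewrite Rabs_Ropp.
      - apply f1_lipschitz.
      - unfold w', w, arrive_vel. ring. }
    eapply Rle_trans; [exact X|].
    assert (DD : d + D <= (C1 + 1) * d) by lra.
    assert (Y := Rmult_le_compat_l (g / 2 + kap + M2) _ _ ltac:(lra) DD).
    assert (0 <= M2 * d) by (apply Rmult_le_pos; lra). unfold C2. lra. }
  assert (z1 : 0 <= C1 * d) by (apply Rmult_le_pos; lra).
  assert (z3 : 0 <= C3 * d) by (apply Rmult_le_pos; lra).
  split; [fold D; lra|].
  rewrite Q4, R4. replace (/ 2 * w' ^ 2 - / 2 * w ^ 2) with
    ((w' - w) * (w + / 2 * (w' - w))) by field.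
  assert (Y : Rabs (w + / 2 * (w' - w)) <= w + C2).
  { eapply Rle_trans; [apply Rabs_triang|]. rewrite Rabs_mult, (Rabs_pos_eq w), (Rabs_pos_eq (/ 2)) by lra.
    assert (C2 * d <= C2 * 1) by (apply Rmult_le_compat_l; lra).
    pose proof (Rabs_pos (w' - w)). lra. }
  apply Rle_trans with (C2 * d * (w + C2)); [now apply Rabs_mult_le|].
  unfold C3. lra.
Qed.

(** Stability is expressed at time 0, but the curve of a degenerate set may meet the motion at
    another time; this carries a perturbation through the bounces in between. *)
Lemma push_forward x (m : nat) n : periodic_motion g f vstar p q x ->
  forall delta, 0 < delta -> exists d, 0 < d /\ forall a e,
    Rabs (a - fst (x n)) <= d -> Rabs (e - snd (x n)) <= d ->
    exists z : nat -> R * R, z 0%nat = (a, e) /\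
      (forall i, (i < m)%nat -> / 2 * vstar ^ 2 < snd (z i) /\
         Phi g f (fst (z i)) (snd (z i)) (fst (z (S i))) (snd (z (S i)))) /\
      Rabs (fst (z m) - fst (x (n + Z.of_nat m)%Z)) <= delta /\
      Rabs (snd (z m) - snd (x (n + Z.of_nat m)%Z)) <= delta.
Proof.
  intros Hx. revert n. induction m as [|m IH]; intros n delta Hdel.
  - exists delta. split; [exact Hdel|]. intros a e Ha He. exists (fun _ => (a, e)).
    simpl (Z.of_nat 0). rewrite Z.add_0_r. repeat split; auto; intros; lia.
  - destruct (IH (n + 1)%Z delta Hdel) as [d1 [d10 H1]].
    destruct (proj1 Hx n) as [E0 EP].
    destruct (Phi_lipschitz _ _ _ _ E0 (periodic_vel x n Hx) EP) as (C & d0 & D0 & C0 & HC).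
    assert (dd : 0 < Rmin d0 (d1 / (C + 1))).
    { apply Rmin_glb_lt; [exact D0|]. apply Rdiv_lt_0_compat; lra. }
    exists (Rmin d0 (d1 / (C + 1))). split; [exact dd|]. intros a e Ha He.
    assert (CD : C * Rmin d0 (d1 / (C + 1)) <= d1).
    { apply Rle_trans with ((C + 1) * (d1 / (C + 1))); [|right; field; lra].
      apply Rmult_le_compat; try lra. apply Rmin_r. }
    destruct (HC _ a e (Rmin_l _ _) Ha He) as (Hs & a1 & e1 & HP1 & A1 & E1).
    destruct (H1 a1 e1) as (z & Z0 & Z1 & Z2 & Z3); [lra|lra|].
    exists (fun i => match i with O => (a, e) | S j => z j end). split; [reflexivity|].
    split.
    + intros [|i] Hi; [rewrite Z0; now split | apply Z1; lia].
    + replace (n + Z.of_nat (S m))%Z with (n + 1 + Z.of_nat m)%Z by lia. now split.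
Qed.

(** If [x] is stable, the points of the curve close to the one on [x] lie on complete motions. These
    are periodic by degeneracy, so [defect] vanishes at their impact times; since distinct nearby
    parameters give distinct times, the zero is not isolated. *)
Lemma degenerate_isolated_unstable x : degenerate g f vstar p q ->
  (forall c, exists r, 0 < r /\ forall a, 0 < Rabs (a - c) < r -> defect a <> 0) ->
  periodic_motion g f vstar p q x -> unstable g f vstar x.
Proof.
  intros (tc & ec & At & Ae & Sh & Uq & Iff) iso Hx St.
  destruct (proj1 (Iff x (proj1 Hx)) Hx) as [n0 [s0 E0]].
  assert (tcp : forall m s, tc (s + IZR m) - (s + IZR m) = tc s - s).
  { intros m s. apply (periodic_IZR (fun s => tc s - s)). intros t.
    rewrite (proj1 (Sh t)). ring. }
  assert (ecp : forall m s, ec (s + IZR m) = ec s).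
  { intros m s. apply (periodic_IZR ec). intros t. apply Sh. }
  (* The meeting time [n0] is moved back by [K] periods to a time [- m <= 0], from which a
     perturbation can be pushed forward to time 0. *)
  set (K := Z.abs_nat n0).
  set (m := Z.to_nat (Z.of_nat K * q - n0)).
  assert (Em : (n0 - Z.of_nat K * q = - Z.of_nat m)%Z).
  { unfold m. rewrite Z2Nat.id; [ring|]. unfold K. rewrite Zabs2Nat.id_abs.
    assert (Z.abs n0 * 1 <= Z.abs n0 * q)%Z by (apply Z.mul_le_mono_nonneg_l; lia). lia. }
  set (s1 := s0 + IZR (- (Z.of_nat K * p))).
  assert (E1 : x (- Z.of_nat m)%Z = (tc s1, ec s1)).
  { rewrite <- Em. assert (H := periodic_multiple x (n0 - Z.of_nat K * q) K Hx).
    replace (n0 - Z.of_nat K * q + Z.of_nat K * q)%Z with n0 in H by ring.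
    rewrite E0 in H. injection H as H1 H2.
    apply injective_projections; simpl.
    - assert (T := tcp (- (Z.of_nat K * p))%Z s0). fold s1 in T. unfold s1 at 2 in T.
      rewrite opp_IZR in T. lra.
    - unfold s1. rewrite ecp. now symmetry. }
  destruct (St 1 Rlt_0_1) as [delta [dl0 Hdel]].
  destruct (push_forward x m (- Z.of_nat m) Hx (delta / 4) ltac:(lra)) as [d [d0 Hd]].
  rewrite E1 in Hd. simpl fst in Hd. simpl snd in Hd.
  replace (- Z.of_nat m + Z.of_nat m)%Z with 0%Z in Hd by ring.
  destruct (continuous_eps tc s1 d (analytic_at_continuous _ _ (At s1)) d0) as [r1 [r10 R1]].
  destruct (continuous_eps ec s1 d (analytic_at_continuous _ _ (Ae s1)) d0) as [r2 [r20 R2]].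
  destruct (iso (tc s1)) as [r3 [r30 R3]].
  destruct (continuous_eps tc s1 r3 (analytic_at_continuous _ _ (At s1)) r30) as [r4 [r40 R4]].
  set (h := Rmin (Rmin r1 r2) (Rmin r4 1) / 2).
  assert (h0 : 0 < h).
  { unfold h. assert (0 < Rmin (Rmin r1 r2) (Rmin r4 1)); [|lra].
    repeat apply Rmin_glb_lt; lra. }
  assert (h1 : h < r1 /\ h < r2 /\ h < r4 /\ h < 1).
  { pose proof (Rmin_l (Rmin r1 r2) (Rmin r4 1)). pose proof (Rmin_r (Rmin r1 r2) (Rmin r4 1)).
    pose proof (Rmin_l r1 r2). pose proof (Rmin_r r1 r2).
    pose proof (Rmin_l r4 1). pose proof (Rmin_r r4 1). unfold h in *. lra. }
  destruct h1 as (h1 & h2 & h4 & h5).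
  set (s := s1 + h).
  assert (Hs : Rabs (s - s1) = h).
  { unfold s. replace (s1 + h - s1) with h by ring. rewrite Rabs_pos_eq; lra. }
  specialize (R1 s ltac:(lra)). specialize (R2 s ltac:(lra)). specialize (R4 s ltac:(lra)).
  destruct (Hd (tc s) (ec s)) as (z & Z0 & Z1 & Z2 & Z3); [lra|lra|].
  destruct (Hdel (fst (z m)) (snd (z m))) as (y & Y0 & Yc & _).
  { eapply Rle_lt_trans; [apply dist_euc_abs|].
    rewrite (Rabs_minus_sym (fst (x 0%Z))), (Rabs_minus_sym (snd (x 0%Z))). lra. }
  (* The motion given by stability passes through [z m] at time 0; injectivity of the map traces it
     back to the chosen point of the curve. *)
  assert (back : forall i, (i <= m)%nat -> y (- Z.of_nat i)%Z = z (m - i)%nat).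
  { induction i as [|i IH]; intros Hi.
    - rewrite Nat.sub_0_r. simpl. rewrite Y0. symmetry. apply surjective_pairing.
    - specialize (IH ltac:(lia)).
      destruct (Yc (- Z.of_nat (S i))%Z) as [A1 A2].
      replace (- Z.of_nat (S i) + 1)%Z with (- Z.of_nat i)%Z in A2 by lia.
      destruct (Z1 (m - S i)%nat ltac:(lia)) as [B1 B2].
      replace (S (m - S i)) with (m - i)%nat in B2 by lia. rewrite IH in A2.
      destruct (Phi_injective _ _ _ _ _ _ A1 B1 A2 B2). now apply injective_projections. }
  specialize (back m ltac:(lia)). rewrite Nat.sub_diag, Z0 in back.
  assert (Yp : periodic_motion g f vstar p q y).
  { apply (Iff y Yc). now exists (- Z.of_nat m)%Z, s. }
  destruct (periodic_point y (- Z.of_nat m) Yp) as [_ Yd]. rewrite back in Yd. simpl in Yd.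
  apply (R3 (tc s)); [|exact Yd]. split; [|exact R4].
  (* Equal times would, by uniqueness of the parameter modulo 1, make [h] an integer, although
     [0 < h < 1]. *)
  apply Rabs_pos_lt. intros Eq. apply Rminus_diag_uniq in Eq.
  destruct (fractional s) as [k Hk]. destruct (fractional s1) as [k1 Hk1].
  destruct (Uq (tc s)) as [u [_ Hu]].
  assert (U1 : u = s + IZR k).
  { apply Hu. split; [exact Hk|]. exists k. assert (T := tcp k s). lra. }
  assert (U2 : u = s1 + IZR k1).
  { apply Hu. split; [exact Hk1|]. exists k1. assert (T := tcp k1 s1). lra. }
  assert (Hc : IZR (k - k1) = - h) by (rewrite minus_IZR; unfold s in U1; lra).
  assert (E2 : 0 < IZR (k1 - k) < 1) by (rewrite minus_IZR in Hc |- *; lra).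
  destruct E2 as [E2 E3]. apply lt_IZR in E2, E3. lia.
Qed.

Lemma periodic_motions_alternative :
  (finite_mod_translation (periodic_motion g f vstar p q) \/
   degenerate g f vstar p q) /\
  (finite_mod_translation (periodic_motion g f vstar p q) ->
   exists x : motion,
     periodic_motion g f vstar p q x /\ unstable g f vstar x) /\
  (degenerate g f vstar p q ->
   forall x : motion,
     periodic_motion g f vstar p q x -> unstable g f vstar x).
Proof.
  destruct (analytic_zeros_dichotomy defect defect_analytic) as [Z|iso].
  - split; [right; now apply zero_defect_degenerate|]. split.
    + intros _. exists (tau_motion 0).
      assert (H := tau_motion_periodic 0 (Z 0)). split; [exact H|].
      now apply zero_defect_unstable.
    + intros _ x Hx. now apply zero_defect_unstable.
  - split; [left; now apply isolated_finite|]. split.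
    + intros _. destruct (up_crossing iso) as (c & r & r0 & Hc & Hpos).
      exists (tau_motion c). split; [now apply tau_motion_periodic|].
      now apply (up_crossing_unstable c r).
    + intros D x Hx. now apply degenerate_isolated_unstable.
Qed.
End Chains.

(** * Bounds on the racket motion and choice of the thresholds *)

Lemma Rabs_le_sup_norm (h : R -> R) x : Rbar_le (Rabs (h x)) (sup_norm h).
Proof.
  apply (proj1 (Lub_Rbar_correct (fun y => exists x, y = Rabs (h x)))). now exists x.
Qed.

Lemma admissible_derive_bound g f vstar : admissible_velocity g f vstar ->
  exists M1, 4 * M1 < vstar /\ forall x, Rabs (Derive f x) <= M1.
Proof.
  intros [H _]. assert (B := Rabs_le_sup_norm (Derive f)).
  destruct (sup_norm (Derive f)) as [s| |]; simpl in *.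
  - now exists s.
  - exfalso. revert H. unfold Rbar_mult; simpl.
    destruct (Rle_dec 0 4) as [h|h]; [|lra].
    destruct (Rle_lt_or_eq_dec 0 4 h); simpl; [auto|lra].
  - destruct (B 0).
Qed.

Theorem proposition4p7 (g : R) (hg : 0 < g) (q : Z) (hq : (0 < q)%Z) :
  exists epsq : R, 0 < epsq /\
    forall f : R -> R, periodic1 f -> real_analytic f ->
    forall vstar : R, admissible_velocity g f vstar ->
    exists alpha : R, 0 < alpha /\
      forall p : Z, (0 < p)%Z -> rel_prime p q -> alpha < IZR p ->
        Rbar_lt (sup_norm (Derive_n f 2)) epsq ->
        (finite_mod_translation (periodic_motion g f vstar p q) \/
         degenerate g f vstar p q) /\
        (finite_mod_translation (periodic_motion g f vstar p q) ->
         exists x : motion,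
           periodic_motion g f vstar p q x /\ unstable g f vstar x) /\
        (degenerate g f vstar p q ->
         forall x : motion,
           periodic_motion g f vstar p q x -> unstable g f vstar x).
Proof.
  set (Q := Z.to_nat q).
  assert (hQ : (0 < Q)%nat) by (unfold Q; lia).
  assert (q1 : 1 <= INR Q) by now apply INR_ge_1.
  assert (Q2 : 1 <= INR Q ^ 2) by now apply pow_R1_Rle.
  (* The same value bounds the second derivative and serves as [kap]; [hsmall] then holds with
     equality. *)
  set (kap := g / (64 * INR Q ^ 2)).
  assert (kap0 : 0 < kap) by (apply Rdiv_lt_0_compat; lra).
  exists kap. split; [exact kap0|].
  intros f hper hf vstar hadm.
  destruct (admissible_derive_bound g f vstar hadm) as [M1 [hv hM1]].
  assert (m1 : 0 <= M1) by (eapply Rle_trans; [apply Rabs_pos | apply (hM1 0)]).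
  assert (cont : forall h, real_analytic h -> forall x, continuous h x).
  { intros h Hh x. apply analytic_at_continuous, Hh. }
  destruct (periodic_bounded f hper (cont f hf)) as [M0 hM0].
  assert (m0 : 0 <= M0) by (eapply Rle_trans; [apply Rabs_pos | apply (hM0 0)]).
  destruct (periodic_bounded (Derive (Derive (Derive f)))) as [M3 hM3].
  { now repeat apply periodic_Derive. }
  { apply cont. now repeat apply real_analytic_Derive. }
  set (A := 4 * (M1 + 1) + 4 * (2 * M0 + 1)).
  (* [L > 1] gives [/ L ^ 2 <= / L], and then the term [A / kap] yields [hkap]; the term
     [4 * vstar / g] yields [hvL]. *)
  set (L := 1 + A / kap + 4 * vstar / g).
  assert (A0 : 0 < A / kap) by (apply Rdiv_lt_0_compat; unfold A; lra).
  assert (V0 : 0 < 4 * vstar / g) by (apply Rdiv_lt_0_compat; lra).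
  assert (hL : 1 < L) by (unfold L; lra).
  assert (hkap : 4 * (M1 + 1) / L + (2 * M0 + 1) * (4 / L ^ 2) <= kap).
  { assert (iL : / L ^ 2 <= / L).
    { apply Rinv_le_contravar; [lra|]. simpl. rewrite Rmult_1_r.
      rewrite <- (Rmult_1_l L) at 1. apply Rmult_le_compat_r; lra. }
    apply Rle_trans with (A / L).
    - replace (A / L) with (4 * (M1 + 1) / L + (2 * M0 + 1) * (4 * / L))
        by (unfold A; field; lra).
      apply Rplus_le_compat_l, Rmult_le_compat_l; [lra|]. unfold Rdiv. lra.
    - apply Rmult_le_reg_r with L; [lra|]. unfold Rdiv. rewrite Rmult_assoc, Rinv_l by lra.
      apply Rle_trans with (kap * (A / kap)); [right; field; lra|].
      apply Rmult_le_compat_l; unfold L; lra. }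
  assert (hvL : vstar < g * L / 4).
  { unfold L. replace (g * (1 + A / kap + 4 * vstar / g) / 4) with
      (vstar + g * (1 + A / kap) / 4) by (field; lra).
    assert (0 < g * (1 + A / kap)) by (apply Rmult_lt_0_compat; lra). lra. }
  (* [INR Q] times the sum of the two lower bounds required of [P / INR Q]: one for the existence of
     chains, one for the speed of periodic motions. *)
  set (alpha := INR Q * ((2 * L + 64 * INR Q ^ 2 * M1 / g)
     + 2 / g * (2 * g * L + 4 * M1 * (INR Q + 1)))).
  assert (B1 : 0 < 2 * L + 64 * INR Q ^ 2 * M1 / g).
  { assert (0 <= 64 * INR Q ^ 2 * M1 / g); [|lra].
    apply Rdiv_le_0_compat; [|exact hg]. apply Rmult_le_pos; lra. }
  assert (B2 : 0 < 2 / g * (2 * g * L + 4 * M1 * (INR Q + 1))).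
  { apply Rmult_lt_0_compat; [apply Rdiv_lt_0_compat; lra|].
    assert (0 < g * L) by (apply Rmult_lt_0_compat; lra).
    assert (0 <= M1 * (INR Q + 1)) by (apply Rmult_le_pos; lra). lra. }
  exists alpha. split; [apply Rmult_lt_0_compat; lra|].
  intros p _ _ hp hM2.
  assert (hP : alpha / INR Q <= IZR p / INR Q).
  { apply Rmult_le_compat_r; [left; apply Rinv_0_lt_compat|]; lra. }
  replace (alpha / INR Q) with ((2 * L + 64 * INR Q ^ 2 * M1 / g)
     + 2 / g * (2 * g * L + 4 * M1 * (INR Q + 1))) in hP by (unfold alpha; field; lra).
  assert (hsmall : 8 * INR Q ^ 2 * (4 / g * (kap + kap)) <= 1).
  { right. unfold kap. field. lra. }
  assert (hM2' : forall x, Rabs (Derive (Derive f) x) < kap).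
  { intros x. exact (Rbar_le_lt_trans _ _ _ (Rabs_le_sup_norm (Derive_n f 2) x) hM2). }
  assert (ex : forall x, exists t, chain g f Q (2 * L) t /\ t 0%nat = x /\ t Q = x + IZR p).
  { apply (chain_exists g f Q M0 M1 kap L kap); auto; lra. }
  set (tau := fun x => proj1_sig (constructive_indefinite_description _ (ex x))).
  apply (periodic_motions_alternative g f Q M0 M1 kap L kap) with (P := IZR p)
    (tau := tau) (M3 := M3); auto; try lra.
  - intros x. unfold tau. exact (proj2_sig (constructive_indefinite_description _ (ex x))).
  - unfold Q. lia.
  - apply Rmult_le_reg_l with (2 / g); [apply Rdiv_lt_0_compat; lra|].
    replace (2 / g * (g / 2 * (IZR p / INR Q))) with (IZR p / INR Q) by (field; lra). lra.
Qed.
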